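(* Let $\mathcal{I}$ be a system of dyadic arcs in $\mathbb{T}$. Then $H^{\log}_{\mathrm{at},\mathcal{I}}(\mathbb{T})\cong H^{\log}_{\mathcal{I}}(\mathbb{T})$; that is, the two spaces coincide as subspaces of $\mathcal{D}'$ and their quasi-norms $\|\cdot\|_{H^{\log}_{\mathrm{at},\mathcal{I}}(\mathbb{T})}$ and $\|\cdot\|_{H^{\log}_{\mathcal{I}}(\mathbb{T})}$ are equivalent.
   Context: $\mathbb{T}=\mathbb{R}/2\pi\mathbb{Z}$ with Lebesgue measure $d\theta$; $|A|$ is the Lebesgue measure of $A$. $\mathcal{D}'$ is the space of distributions on $\mathbb{T}$; an integrable $f$ is identified with $\langle f,\varphi\rangle=\int_{\mathbb{T}}f\varphi\,d\theta$, and $\widehat{f}(0):=(2\pi)^{-1}\langle f,1\rangle$. $\Psi_0(t):=t\,[\log(e+t)]^{-1}$, $t\ge0$. A system of dyadic arcs $\mathcal{I}$ is a family of the form $\mathcal{I}^{\delta}=\{[2\pi(2^{-k}m+\delta),2\pi(2^{-k}(m+1)+\delta)):k\in\mathbb{N}_0,\ m=0,\dots,2^k-1\}$ (mod $2\pi$) for some $\delta\in[0,1)$. For $I\in\mathcal{I}$, $h_I:=|I|^{-1/2}(\chi_{I_-}-\chi_{I_+})$, with $I_-,I_+$ the left and right halves of $I$. For a collection of complex numbers $\mathbf{f}=\{f_I\}_{I\in\mathcal{I}}\cup\{f_0\}$ put $f_N:=f_0+\sum_{I\in\mathcal{I},|I|\ge2^{-N}}f_Ih_I$ and $S_{\mathcal{I}}[\mathbf{f}]:=|f_0|+\big(\sum_{I\in\mathcal{I}}|f_I|^2\chi_I/|I|\big)^{1/2}$.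 $h^{\log}_{\mathcal{I}}(\mathbb{T})$ is the class of all $\mathbf{f}$ with $\int_{\mathbb{T}}\Psi_0(S_{\mathcal{I}}[\mathbf{f}])\,d\theta<\infty$, with $\|\mathbf{f}\|_{h^{\log}_{\mathcal{I}}(\mathbb{T})}:=\inf\{\lambda>0:(2\pi)^{-1}\int_{\mathbb{T}}\Psi_0(\lambda^{-1}S_{\mathcal{I}}[\mathbf{f}])\,d\theta\le1\}$. For each $\mathbf{f}\in h^{\log}_{\mathcal{I}}(\mathbb{T})$ the sequence $(f_N)_N$ converges in $\mathcal{D}'$ to some $\iota(\mathbf{f})$. Set $H^{\log}_{\mathcal{I}}(\mathbb{T}):=\iota[h^{\log}_{\mathcal{I}}(\mathbb{T})]$ and $\|f\|_{H^{\log}_{\mathcal{I}}(\mathbb{T})}:=\|\mathbf{f}\|_{h^{\log}_{\mathcal{I}}(\mathbb{T})}$ for $f=\iota(\mathbf{f})$. An $H^{\log}_{\mathcal{I}}$-atom associated to $I\in\mathcal{I}$ is a measurable function $a_I$ on $\mathbb{T}$ with $\mathrm{supp}(a_I)\subset I$, $\int_Ia_I\,d\theta=0$ and $\|a_I\|_{L^\infty(\mathbb{T})}\le\|\chi_I\|_{L^{\log}(\mathbb{T})}$, where $\|g\|_{L^{\log}(\mathbb{T})}:=\inf\{\lambda>0:(2\pi)^{-1}\int_{\mathbb{T}}\Psi_0(\lambda^{-1}|g|)\,d\theta\le1\}$. $H^{\log}_{\mathrm{at},\mathcal{I}}(\mathbb{T})$ is the class of all $f\in\mathcal{D}'$ for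 which there is a sequence $\{\beta_{I_k}\}_{k\in\mathbb{N}}$ of scalar multiples of $H^{\log}_{\mathcal{I}}$-atoms ($\beta_{I_k}$ associated to $I_k\in\mathcal{I}$) with $f-\widehat{f}(0)=\sum_k\beta_{I_k}$ in $\mathcal{D}'$ and $\sum_k|I_k|\Psi_0(\|\beta_{I_k}\|_{L^\infty(\mathbb{T})})<\infty$. Its quasi-norm $\|f\|_{H^{\log}_{\mathrm{at},\mathcal{I}}(\mathbb{T})}$ is the infimum, over all such sequences, of $\Lambda_\infty(f,\{\beta_{I_k}\}):=\inf\{\lambda>0:\Psi_0(\lambda^{-1}|\widehat{f}(0)|)+\sum_k|I_k|\Psi_0(\lambda^{-1}\|\beta_{I_k}\|_{L^\infty(\mathbb{T})})\le1\}$. *)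

(* Defs.v *)
From HB Require Import structures.
From mathcomp Require Import all_boot all_order all_algebra.
From mathcomp Require Import all_classical all_reals all_analysis.
From mathcomp Require Import complex.

Set Implicit Arguments.
Unset Strict Implicit.
Unset Printing Implicit Defensive.

Import Order.TTheory GRing.Theory Num.Theory.
Import numFieldNormedType.Exports.
Import ComplexField.Normc.

Local Open Scope classical_set_scope.
Local Open Scope complex_scope.
Local Open Scope ring_scope.

(* The circle R/2piZ: its functions and subsets are 2pi-periodic functions on R
   and 2pi-periodic subsets of R, and its measure is Lebesgue measure on R
   restricted to the period [0, 2pi[. *)

Section Torus.
Variable R : realType.

Definition torus_measure : {measure set (measurableTypeR R) -> \bar R} :=
  mrestr (@lebesgue_measure R) (measurable_itv `[0, pi *+ 2[).

Definition torus_integral (f : R -> R[i]) : R[i] :=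
  (\int[torus_measure]_x complex.Re (f x)) +i*
  (\int[torus_measure]_x complex.Im (f x)).

Definition Linfty_norm (f : R -> R[i]) : \bar R :=
  ('N[torus_measure]_+oo[EFin \o (@normc R \o f)])%E.

Definition Psi0 (t : R) : R := t / ln (expR 1 + t).

(* Needed because the square function may be infinite; -oo never occurs. *)
Definition Psi0e (t : \bar R) : \bar R :=
  match t with
  | r%:E => (Psi0 r)%:E
  | +oo => +oo
  | -oo => 0
  end%E.

Definition Llog_norm (g : R -> \bar R) : \bar R :=
  ereal_inf [set l%:E | l in [set l : R | 0 < l /\
    (((pi *+ 2)^-1)%:E * \int[torus_measure]_x Psi0e ((l^-1)%:E * `|g x|)
       <= 1)%E]].

End Torus.

Section TestFunctions.
Variable R : realType.

Definition smooth (f : R -> R) :=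
  forall n x, derivable (derive1n n f : R -> R) x 1.

Lemma derive1n_lin (a b : R) (f g : R -> R) : smooth f -> smooth g ->
  forall n, derive1n n (fun x => a * f x + b * g x) =
    (fun x => a * derive1n n f x + b * derive1n n g x).
Proof.
move=> sf sg; elim=> [//|n IH]; rewrite !derive1nS IH; apply/funext => x.
have df : derivable (a \*: derive1n n f : R -> R) x 1.
  by apply: derivableZ; exact: sf.
have dg : derivable (b \*: derive1n n g : R -> R) x 1.
  by apply: derivableZ; exact: sg.
rewrite !derive1E.
have := deriveD df dg; rewrite (deriveZ a (sf n x)) (deriveZ b (sg n x)).
by move=> <-.
Qed.

Lemma smooth_lin (a b : R) (f g : R -> R) : smooth f -> smooth g ->
  smooth (fun x => a * f x + b * g x).
Proof.
move=> sf sg n x; rewrite derive1n_lin //.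
by apply: (@derivableD _ _ _ (a \*: derive1n n f) (b \*: derive1n n g));
  apply: derivableZ; [exact: sf|exact: sg].
Qed.

Lemma smooth_cst (c : R) : smooth (fun=> c).
Proof.
move=> n x; suff [d ->] : exists d, derive1n n (fun=> c) = (fun=> d : R).
  exact: derivable_cst.
elim: n => [|n [d IH]]; first by exists c.
by exists 0; rewrite derive1nS IH; apply/funext => y; rewrite derive1E derive_cst.
Qed.

Definition is_test (phi : R -> R[i]) : Prop :=
  [/\ periodic phi (pi *+ 2), smooth (fun x => complex.Re (phi x)) &
      smooth (fun x => complex.Im (phi x))].

Definition test_pred : {pred R -> R[i]} := fun phi => `[< is_test phi >].

Let ReMD (a z w : R[i]) : complex.Re (a * z + w) =
  1 * (complex.Re a * complex.Re z + - complex.Im a * complex.Im z)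
  + 1 * complex.Re w.
Proof. by rewrite !mul1r mulNr; case: a z w => [? ?] [? ?] []. Qed.

Let ImMD (a z w : R[i]) : complex.Im (a * z + w) =
  1 * (complex.Re a * complex.Im z + complex.Im a * complex.Re z)
  + 1 * complex.Im w.
Proof. by rewrite !mul1r; case: a z w => [? ?] [? ?] []. Qed.

Lemma is_test_lin (a : R[i]) (f g : R -> R[i]) : is_test f -> is_test g ->
  is_test (fun x => a * f x + g x).
Proof.
move=> [pf rf jf] [pg rg jg]; split.
- by move=> x; rewrite pf pg.
- rewrite (funext (fun x => ReMD a (f x) (g x))).
  exact: (@smooth_lin 1 1 _ _ (@smooth_lin _ _ _ _ rf jf) rg).
- rewrite (funext (fun x => ImMD a (f x) (g x))).
  exact: (@smooth_lin 1 1 _ _ (@smooth_lin _ _ _ _ jf rf) jg).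
Qed.

Lemma is_test_cst (c : R[i]) : is_test (fun=> c).
Proof. by split; [move=> x| |]; try exact: smooth_cst. Qed.

Lemma test_submod_closed : submod_closed test_pred.
Proof.
split; first exact/asboolP/(is_test_cst 0).
move=> a f g /asboolP tf /asboolP tg; exact/asboolP/(is_test_lin a tf tg).
Qed.

HB.instance Definition _ :=
  GRing.isSubmodClosed.Build _ _ test_pred test_submod_closed.

Record test_fun := TestFun {
  test_val :> R -> R[i];
  test_valP : test_val \in test_pred }.

HB.instance Definition _ := [isSub for test_val].
HB.instance Definition _ := [Choice of test_fun by <:].
HB.instance Definition _ := [SubChoice_isSubLmodule of test_fun by <:].

End TestFunctions.

Section Distributions.
Variable R : realType.

Definition test_cst (c : R[i]) : test_fun R :=
  TestFun (introT (asboolP _) (is_test_cst c)).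

Definition test_deriv (n : nat) (phi : test_fun R) (x : R) : R[i] :=
  derive1n n (fun y => complex.Re (phi y)) x +i*
  derive1n n (fun y => complex.Im (phi y)) x.

(* Continuity for the Frechet topology of C^oo(T), via its defining
   seminorms. *)
Definition dist_continuous (u : test_fun R -> R[i]) :=
  exists (n : nat) (M : R), forall (phi : test_fun R) (B : R),
    (forall j x, (j <= n)%N -> normc (test_deriv j phi x) <= B) ->
    normc (u phi) <= M * B.

Record torus_dist := TorusDist {
  dist_val :> {scalar test_fun R};
  dist_valP : dist_continuous dist_val }.

Definition pairing (f : R -> R[i]) (phi : test_fun R) : R[i] :=
  torus_integral (fun x => f x * phi x).

Definition fourier0 (F : torus_dist) : R[i] :=
  ((pi *+ 2)^-1)%:C * F (test_cst 1).

(* Weak-* convergence; R[i]^o carries the usual topology of the field R[i]. *)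
Definition cvg_dist (u : nat -> test_fun R -> R[i]) (v : test_fun R -> R[i]) :=
  forall phi, u n phi @[n --> \oo] --> (v phi : R[i]^o).

End Distributions.

Section Dyadic.
Variables (R : realType) (delta : R).

Definition dyadic_arc (k m : nat) : set R := [set x | exists z : int,
  pi *+ 2 * (m%:R / 2 ^+ k + delta) <= x + pi *+ 2 * z%:~R
    < pi *+ 2 * (m.+1%:R / 2 ^+ k + delta)].

(* The arcs of the system I^delta, indexed by generation k and position m. *)
Definition dyadic := {k : nat & 'I_(2 ^ k)}.

Definition darc (I : dyadic) : set R := dyadic_arc (tag I) (tagged I).

Definition arc_left (I : dyadic) : set R :=
  dyadic_arc (tag I).+1 (2 * tagged I).

Definition arc_right (I : dyadic) : set R :=
  dyadic_arc (tag I).+1 (2 * tagged I).+1.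

Definition arc_len (I : dyadic) : R := fine (torus_measure R (darc I)).

Definition haar (I : dyadic) (x : R) : R :=
  (Num.sqrt (arc_len I))^-1 * (\1_(arc_left I) x - \1_(arc_right I) x).

Record haar_data := HaarData { hd0 : R[i] ; hd : dyadic -> R[i] }.

(* The sum is finite, as |I| = 2pi 2^-k for I of generation k. *)
Definition haar_sum (f : haar_data) (N : nat) (x : R) : R[i] :=
  hd0 f + \sum_(I \in [set I | 2 ^- N <= arc_len I]) hd f I * (haar I x)%:C.

Definition square_fun (f : haar_data) (x : R) : \bar R :=
  ((normc (hd0 f))%:E + sqrte (\esum_(I in [set: dyadic])
     (normc (hd f I) ^+ 2 * \1_(darc I) x / arc_len I)%:E))%E.

Definition hlog (f : haar_data) : Prop :=
  (\int[torus_measure R]_x Psi0e (square_fun f x) < +oo)%E.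

Definition hlog_norm (f : haar_data) : \bar R := Llog_norm (square_fun f).

(* F = iota(f). Limits of distributions being unique, iota is rendered as a
   functional relation. *)
Definition is_iota (f : haar_data) (F : torus_dist R) : Prop :=
  cvg_dist (fun N => pairing (haar_sum f N)) F.

Definition Hlog (F : torus_dist R) : Prop :=
  exists2 f : haar_data, hlog f & is_iota f F.

(* Supports of measurable functions are not closed up: I is half-open, and the
   condition is that a vanishes off I. *)
Definition is_atom (I : dyadic) (a : R -> R[i]) : Prop :=
  [/\ periodic a (pi *+ 2),
      measurable_fun [set: R] (fun x => complex.Re (a x)) /\
      measurable_fun [set: R] (fun x => complex.Im (a x)),
      forall x, ~ darc I x -> a x = 0,
      torus_integral a = 0 &
      (Linfty_norm a <= Llog_norm (fun x => (\1_(darc I) x)%:E))%E].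

Record atom_seq := AtomSeq {
  atom_arc : nat -> dyadic ;
  atom_fun : nat -> R -> R[i] }.

(* The sequences admissible in the definition of the atomic space; the constant
   \hat F(0) is the distribution given by the constant function. *)
Definition atomic_decomp (F : torus_dist R) (b : atom_seq) : Prop :=
  [/\ forall k, exists (c : R[i]) (a : R -> R[i]),
        is_atom (atom_arc b k) a /\ atom_fun b k = (fun x => c * a x),
      cvg_dist (fun n phi => \sum_(k < n) pairing (atom_fun b k) phi)
        (fun phi => F phi - pairing (fun=> fourier0 F) phi) &
      (\sum_(0 <= k <oo) (arc_len (atom_arc b k))%:E *
         Psi0e (Linfty_norm (atom_fun b k)) < +oo)%E].

Definition Hlog_at (F : torus_dist R) : Prop :=
  exists b : atom_seq, atomic_decomp F b.

Definition Lambda_oo (F : torus_dist R) (b : atom_seq) : \bar R :=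
  ereal_inf [set l%:E | l in [set l : R | 0 < l /\
    ((Psi0 (l^-1 * normc (fourier0 F)))%:E +
     \sum_(0 <= k <oo) (arc_len (atom_arc b k))%:E *
       Psi0e ((l^-1)%:E * Linfty_norm (atom_fun b k)) <= 1)%E]].

Definition Hlog_at_norm (F : torus_dist R) : \bar R :=
  ereal_inf [set Lambda_oo F b | b in [set b | atomic_decomp F b]].

End Dyadic.

(* Main.v *)
(* Put d_J = f_J |J|^(-1/2), let S_n be the square function truncated at
   generation n, and Psi(t) = Psi0(t/lambda).

   From Haar data to atoms: run a stopping time down the dyadic tree, which
   restarts at an arc I when the square function since the last forced generation
   exceeds twice its level L at the last restart, when the martingale has moved by
   more than 8 L since then, or at sparse forced generations. The Haar sum over
   the arcs whose last restart is I is bounded by 10 L(I), hence a multiple of an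
   atom, and a potential |deviation|^2 Psi(S)/S^2 shows that the sum of
   |I| Psi(L(I)) is at most a constant times the integral of Psi(S); the forced
   generations are chosen so that the square functions started there are
   geometrically small.

   From atoms to Haar data: the Haar coefficients of sum beta_k converge because
   sum |I_k| b_k / (n_k + 1) < oo, where b_k is the bound and n_k the generation of
   beta_k. Minkowski's inequality, subadditivity of Psi and
   Psi(s) <= Psi(b) (1 + s^2/b^2) with Bessel's inequality for each atom bound the
   integral of Psi(S).

   The two constructions meet because the distribution determines the coefficients
   of an atomic series: smooth approximations of the indicator of an arc at scale
   2^-i reproduce the mass of beta_k on the arc up to O(b_k |I_k| 2^-|i - n_k|). The
   sum of these errors over k and over i, with weights 1/(i+1), is finite, so that
   by divergence of the harmonic series the errors are arbitrarily small. *)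
From HB Require Import structures.
From mathcomp Require Import all_boot all_order all_algebra.
From mathcomp Require Import all_classical all_reals all_analysis.
From mathcomp Require Import measurable_realfun ess_sup_inf complex ring lra zify.
Require Import Defs.

Set Implicit Arguments.
Unset Strict Implicit.
Unset Printing Implicit Defensive.

Import Order.TTheory GRing.Theory Num.Theory.
Import numFieldNormedType.Exports.
Import ComplexField.Normc.

Local Open Scope classical_set_scope.
Local Open Scope ring_scope.

(** * Growth functions *)

(** An atom needs a sup bound, whereas the square function controls the martingale only in the mean:
    hence the second stopping rule, on the deviation. Since |h_J| is constant on J, the square
    function at a node already contains the next jump; when a block ends, the deviation before the
    last jump is at most 8 L and the jump at most 2 L, which gives 10 L. In the other direction the
    quasi-norm of F is read from Haar data f with iota(f) = F, while an atomic series yields data of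
    its own, and the two must be shown to agree. Indicators of arcs are no test functions and, Psi0
    being sublinear, sum |I_k| b_k may diverge. The factor 1/(n_k + 1) repairs this, but it bounds
    the error at scale 2^-i only up to a factor i + 1, which does not show that it tends to 0; this
    is why the scales are averaged with weights 1/(i+1). Both constructions compare modulars, with
    constants independent of lambda. Quasi-norms follow because replacing lambda by 2^j lambda
    multiplies Psi by at most (3/4)^j. *)

Section Growth.
Variable R : realType.
Implicit Types r s t : R.

(** The second clause is a quantitative strict increase, the third says that [P t / t] is
    nonincreasing. The stopping argument uses nothing else about [P], and both clauses survive the
    substitution of [l^-1 * t], so that its constants do not depend on [l]. *)
Definition moderate (P : R -> R) : Prop :=
  [/\ forall t, 0 <= t -> 0 <= P t,
      forall r t, 0 <= r <= 1 -> 0 <= t -> P (r * t) <= (1 + r) / 2 * P t &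
      forall r t, 0 <= r <= 1 -> 0 <= t -> r * P t <= P (r * t)].

Section Moderate.
Variable P : R -> R.
Hypothesis mP : moderate P.

Lemma moderate_ge0 t : 0 <= t -> 0 <= P t.
Proof. by case: mP => + _ _; exact. Qed.

Lemma moderate0 : P 0 = 0.
Proof.
have [p0 pK _] := mP.
have := pK 0 0; rewrite lexx ler01 mulr0 => /(_ isT isT).
have := p0 _ (lexx 0); lra.
Qed.

Lemma moderate_le s t : 0 <= s -> s <= t -> P s <= P t.
Proof.
move=> s0 st; have [p0 pK _] := mP.
have [t0'|t0] := eqVneq t 0; first by rewrite (_ : s = t) //; lra.
have tp : 0 < t by rewrite lt_neqAle eq_sym t0 /= (le_trans s0).
have r01 : 0 <= s / t <= 1 by rewrite ler_pdivrMr// mul1r st divr_ge0 ?(ltW tp).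
have := pK _ _ r01 (ltW tp); rewrite divfK//.
have := p0 _ (ltW tp); nra.
Qed.

Lemma moderate_half t : 0 <= t -> P (t / 2) <= 3 / 4 * P t.
Proof.
move=> t0; have [p0 pK _] := mP.
have := pK 2^-1 t; rewrite (mulrC _ t); have := p0 _ t0; lra.
Qed.

Lemma moderate_half_iter i t : 0 <= t -> P (t / 2 ^+ i) <= (3 / 4) ^+ i * P t.
Proof.
move=> t0; elim: i => [|i IH]; first by rewrite !expr0 divr1 mul1r.
rewrite !exprS invfM (mulrC 2^-1) mulrA.
have h : 0 <= t / 2 ^+ i by rewrite divr_ge0 ?exprn_ge0.
apply: (le_trans (moderate_half h)).
by rewrite -[leRHS]mulrA ler_pM2l//; lra.
Qed.

Lemma moderate_scale c t : 1 <= c -> 0 <= t -> P (c * t) <= c * P t.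
Proof.
move=> c1 t0; have [p0 _ pg] := mP.
have c0 : 0 < c by lra.
have := pg c^-1 (c * t); rewrite mulKf ?gt_eqF//.
rewrite invr_ge0 (ltW c0) invf_le1// c1 mulr_ge0 ?(ltW c0)// => /(_ isT isT).
by rewrite ler_pdivrMl.
Qed.

Lemma moderate_add s t : 0 <= s -> 0 <= t -> P (s + t) <= P s + P t.
Proof.
move=> s0 t0; have [p0 _ pg] := mP.
have [e|ne] := eqVneq (s + t) 0.
  by rewrite e moderate0 addr_ge0 ?p0.
have st : 0 < s + t by rewrite lt_neqAle eq_sym ne addr_ge0.
have f (u : R) : 0 <= u -> u <= s + t -> u / (s + t) * P (s + t) <= P u.
  move=> u0 us; rewrite -[X in _ <= P X](divfK ne u); apply: pg; last exact: ltW.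
  by rewrite divr_ge0 ?(ltW st)//= ler_pdivrMr// mul1r.
have := lerD (f s s0 _) (f t t0 _); rewrite lerDl lerDr => /(_ t0 s0).
by rewrite -mulrDl -mulrDl divff// mul1r.
Qed.

Lemma moderate_sum n (f : nat -> R) : (forall i, 0 <= f i) ->
  P (\sum_(i < n) f i) <= \sum_(i < n) P (f i).
Proof.
move=> f0; elim: n => [|n IH]; first by rewrite !big_ord0 moderate0.
rewrite !big_ord_recr/=; apply: (le_trans (moderate_add _ _)) => //.
  exact: sumr_ge0.
by rewrite lerD2r.
Qed.

(** Up to [b] monotonicity suffices; beyond [b] the growth is at most linear, hence at most that of
    [s ^+ 2 / b ^+ 2]. This converts an L^2 bound on the square function of an atom into a bound on
    its [P]-mean. *)
Lemma moderate_quad s b : 0 <= s -> 0 < b -> P s <= P b * (1 + s ^+ 2 / b ^+ 2).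
Proof.
move=> s0 b0; have Pb := moderate_ge0 (ltW b0).
have [sb|bs] := leP s b.
  apply: (le_trans (moderate_le s0 sb)); rewrite ler_peMr//.
  by rewrite lerDl divr_ge0 ?exprn_ge0 ?(ltW b0).
have c1 : 1 <= s / b by rewrite ler_pdivlMr// mul1r ltW.
have := moderate_scale c1 (ltW b0); rewrite divfK ?gt_eqF// => /le_trans; apply.
rewrite mulrC ler_wpM2l// -expr_div_n; nra.
Qed.

Lemma moderate_weight_le s t : 0 < s -> s <= t -> P t / t ^+ 2 <= P s / s ^+ 2.
Proof.
move=> s0 st; have t0 : 0 < t by exact: lt_le_trans st.
have r01 : 0 <= s / t <= 1 by rewrite ler_pdivrMr// mul1r st divr_ge0 ?(ltW tp) ?(ltW t0) ?(ltW s0).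
have [p0 _ pg] := mP.
have := pg _ _ r01 (ltW t0); rewrite divfK ?gt_eqF// => h.
have h2 : (s / t) ^+ 2 * P t <= P s.
  apply: le_trans h; rewrite ler_wpM2r ?p0 ?(ltW t0)// expr2 ler_piMl//; lra.
rewrite ler_pdivlMr ?exprn_gt0// mulrAC -mulrA -expr_div_n mulrC//.
Qed.

(** With [r = s / t] the second clause gives [P t - P s >= (1 - r) / 2 * P t], while
    [1 - r ^+ 2 <= 2 * (1 - r)]. Through this bound, sums of squares weighted by [P t / t ^+ 2] are
    dominated by telescoping sums. *)
Lemma moderate_increment s t : 0 <= s -> s <= t -> 
  (t ^+ 2 - s ^+ 2) * (P t / t ^+ 2) <= 4 * (P t - P s).
Proof.
move=> s0 st; have [p0 pK _] := mP.
have [t0'|t0] := eqVneq t 0.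
  have -> : s = t by lra.
  by rewrite subrr mul0r subrr mulr0.
have tp : 0 < t by rewrite lt_neqAle eq_sym t0 /= (le_trans s0).
have r01 : 0 <= s / t <= 1 by rewrite ler_pdivrMr// mul1r st divr_ge0 ?(ltW tp).
have := pK _ _ r01 (ltW tp); rewrite divfK// => h.
rewrite mulrCA mulrBl divff ?expf_neq0// -expr_div_n.
have := p0 _ (ltW tp); move/andP: r01 => [].
set r := s / t in h *; set Q := P t in h *; move=> r0 r1 Q0.
have : Q * (1 - r ^+ 2) <= Q * (2 * (1 - r)) by rewrite ler_wpM2l//; nra.
lra.
Qed.

Lemma moderate_scaled l : 0 < l -> moderate (fun t => P (l^-1 * t)).
Proof.
move=> l0; have [p0 pK pg] := mP.
have il t : 0 <= t -> 0 <= l^-1 * t by move=> ?; rewrite mulr_ge0// invr_ge0 ltW.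
split=> [t t0|r t r1 t0|r t r1 t0]; rewrite ?(mulrCA _ r).
- exact/p0/il.
- exact/pK/il.
- exact/pg/il.
Qed.

End Moderate.

Lemma ge1_ln_e t : 0 <= t -> 1 <= ln (expR 1 + t).
Proof.
by move=> t0; rewrite -{1}(expRK 1) ler_ln ?posrE ?ltr_wpDr ?expR_gt0// lerDl.
Qed.

Lemma Psi0_moderate : moderate (@Psi0 R).
Proof.
have e2 : 1 < expR 1 :> R by rewrite expR_gt1.
split=> [t t0|r t /andP[r0 r1] t0|r t /andP[r0 r1] t0].
- by rewrite divr_ge0// (le_trans _ (ge1_ln_e t0)).
- have u0 : 0 <= r * t by rewrite mulr_ge0.
  have l1 := ge1_ln_e t0; have m1 := ge1_ln_e u0.
  rewrite /Psi0 ler_pdivrMr; last by lra.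
  rewrite mulrAC mulrA ler_pdivlMr; last by lra.
  set L := ln _ in l1 *; set l := ln _ in m1 *.
  (* Tangent bounds for the logarithm give [L - l <= (1 - r) t / (e + r t)] and
     [l >= 2 r t / (e + r t)], hence [r (L - l) <= (1 - r) l / 2]. *)
  suff : r * L <= (1 + r) / 2 * l by move=> h; nra.
  have e0 : 0 < expR 1 + t by lra.
  have f0 : 0 < expR 1 + r * t by lra.
  have Ll : L - l <= (1 - r) * t / (expR 1 + r * t).
    rewrite -ln_div ?posrE//.
    have -> : (1 - r) * t / (expR 1 + r * t) = (expR 1 + t) / (expR 1 + r * t) - 1.
      by field; lra.
    have : -1 < (expR 1 + t) / (expR 1 + r * t) - 1.
      by rewrite ltrBrDr addrC subrr divr_gt0.
    by move=> /le_ln1Dx; rewrite addrC subrK.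
  have l2 : 2 * (r * t) / (expR 1 + r * t) <= l.
    have : -1 < expR 1 / (expR 1 + r * t) - 1.
      by rewrite ltrBrDr addrC subrr divr_gt0//; lra.
    move=> /le_ln1Dx; rewrite addrC subrK ln_div ?posrE ?expR_gt0//.
    rewrite expRK -/l => h.
    have : 2 * (r * t) / (expR 1 + r * t) = 2 - 2 * (expR 1 / (expR 1 + r * t)).
      by field; lra.
    have : 0 < expR 1 / (expR 1 + r * t) by rewrite divr_gt0// expR_gt0.
    lra.
  set q := (expR 1 + r * t)^-1 in Ll l2.
  have : r * (L - l) <= r * ((1 - r) * t * q) by rewrite ler_wpM2l.
  have : (1 - r) * (2 * (r * t) * q) <= (1 - r) * l by rewrite ler_wpM2l// subr_ge0.
  nra.
- have u0 : 0 <= r * t by rewrite mulr_ge0.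
  have l1 := ge1_ln_e t0; have m1 := ge1_ln_e u0.
  rewrite /Psi0 mulrA ler_wpM2l// lef_pV2 ?posrE; [|lra|lra].
  rewrite ler_ln ?posrE; [|lra|lra].
  by rewrite lerD2l ler_piMl.
Qed.

Lemma Psi0_le t : 0 <= t -> Psi0 t <= t.
Proof.
by move=> t0; rewrite ler_pdivrMr ?ler_peMr ?ge1_ln_e// (lt_le_trans _ (ge1_ln_e t0)).
Qed.

(** From [ln q < q] at [q = sqrt (e + t)]: [Psi0] dominates a square root. This crude inversion
    serves whenever [t] has to be bounded in terms of [Psi0 t]. *)
Lemma sqrt_le_Psi0 t : 0 <= t -> Num.sqrt (expR 1 + t) <= expR 1 + 2 * Psi0 t.
Proof.
move=> t0; have e2 : 1 < expR 1 :> R by rewrite expR_gt1.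
have e0 : 0 < expR 1 + t by lra.
set q := Num.sqrt _; have q2 : q ^+ 2 = expR 1 + t by rewrite sqr_sqrtr// ltW.
have q0 : 0 < q by rewrite sqrtr_gt0.
have l1 := ge1_ln_e t0.
have lq : ln (expR 1 + t) <= 2 * q.
  have := ln_sublinear q0; rewrite -q2 lnXn// mulr2n; lra.
have : t / (2 * q) <= Psi0 t.
  by rewrite ler_wpM2l// lef_pV2 ?posrE//; lra.
rewrite ler_pdivrMr; last by lra.
have [|q2'] := leP q (expR 1); first by have := moderate_ge0 Psi0_moderate t0; lra.
set P := Psi0 t; nra.
Qed.

(** The square-root bound makes [t] at most of the order of a power of [2 ^+ n], and the logarithm
    turns this into a linear function of [n]. *)
Lemma ln_e_le_Psi0 t M n : 0 <= t -> 0 <= M -> Psi0 t <= M * 2 ^+ n ->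
  ln (expR 1 + t) <= 2 * (expR 1 + 2 * M) * n.+1%:R.
Proof.
move=> t0 M0 h.
have e2 : 1 + 1 <= expR 1 :> R by exact: expR_ge1Dx.
have e0 : 0 < expR 1 + t by lra.
have q2 : Num.sqrt (expR 1 + t) ^+ 2 = expR 1 + t by rewrite sqr_sqrtr// ltW.
have q0 : 0 < Num.sqrt (expR 1 + t) by rewrite sqrtr_gt0.
rewrite -q2 lnXn// mulr2n.
have p1 : 1 <= 2 ^+ n :> R by rewrite exprn_ege1// ler1n.
set A := expR 1 + 2 * M.
have A0 : 0 < A by rewrite /A; lra.
have : ln (Num.sqrt (expR 1 + t)) <= ln (A * 2 ^+ n).
  rewrite ler_ln ?posrE//; last by rewrite mulr_gt0//; lra.
  by apply: (le_trans (sqrt_le_Psi0 t0)); rewrite /A; nra.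
rewrite lnM ?posrE ?exprn_gt0// lnXn//.
have l2 : ln 2 < 2 :> R by exact: ln_sublinear.
have lA := ln_sublinear A0.
rewrite -natr1.
have n0 : 0 <= n%:R :> R by [].
have : n%:R * ln 2 <= n%:R * A :> R by rewrite ler_wpM2l// /A; lra.
lra.
Qed.
End Growth.

(** * Stopping times on the dyadic tree *)

Section Mean.
Variable R : realType.

(** The normalised integral of the function with value [g m] on the arc [m] of generation [n]. *)
Definition mean (n : nat) (g : nat -> R) : R := (2 ^+ n)^-1 * \sum_(m < 2 ^ n) g m.

Lemma sum_double (V : zmodType) k (g : nat -> V) :
  \sum_(i < k.*2) g i = \sum_(i < k) (g i.*2 + g i.*2.+1).
Proof.
elim: k => [|k IH]; first by rewrite !big_ord0.
by rewrite doubleS !big_ord_recr /= IH addrA.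
Qed.

Lemma meanS n g : mean n.+1 g = mean n (fun m => (g m.*2 + g m.*2.+1) / 2).
Proof.
rewrite /mean expnS mul2n sum_double -big_distrl /= exprS invfM.
by rewrite mulrA mulrC mulrA mulrC mulrA mulrAC (mulrC (2 ^- n)) mulrC.
Qed.

Lemma mean0 g : mean 0 g = g 0%N.
Proof. by rewrite /mean expr0 invr1 mul1r big_ord_recl big_ord0 addr0. Qed.

Lemma mean_half n g : mean n.+1 (fun m => g m./2) = mean n g.
Proof.
rewrite meanS /mean; congr (_ * _); apply: eq_bigr => i _.
by rewrite doubleK -[i.*2.+1./2]/(uphalf i.*2) uphalf_double; field.
Qed.

Lemma le_mean n f g : (forall m, (m < 2 ^ n)%N -> f m <= g m) -> mean n f <= mean n g.
Proof.
move=> fg; rewrite ler_wpM2l ?invr_ge0 ?exprn_ge0//.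
by apply: ler_sum => i _; exact: fg.
Qed.

Lemma mean_ge0 n f : (forall m, 0 <= f m) -> 0 <= mean n f.
Proof. by move=> f0; rewrite mulr_ge0 ?invr_ge0 ?exprn_ge0 ?sumr_ge0. Qed.

Lemma meanD n f g : mean n (fun m => f m + g m) = mean n f + mean n g.
Proof. by rewrite /mean big_split mulrDr. Qed.

Lemma meanZ n c f : mean n (fun m => c * f m) = c * mean n f.
Proof. by rewrite /mean -big_distrr /= mulrCA. Qed.

Lemma mean_sum n k (f : nat -> nat -> R) :
  mean n (fun m => \sum_(i < k) f i m) = \sum_(i < k) mean n (f i).
Proof. by rewrite /mean exchange_big /= big_distrr. Qed.

Lemma eq_mean n f g : (forall m, (m < 2 ^ n)%N -> f m = g m) -> mean n f = mean n g.
Proof. by move=> fg; congr (_ * _); apply: eq_bigr => i _; exact: fg. Qed.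

Definition anc (n k m : nat) : nat := (m %/ 2 ^ (n - k))%N.

Lemma ancnn n m : anc n n m = m.
Proof. by rewrite /anc subnn expn0 divn1. Qed.

Lemma ancS n k m : (k <= n)%N -> anc n.+1 k m = anc n k m./2.
Proof. by move=> kn; rewrite /anc subSn// expnS divnMA divn2. Qed.

Lemma anc_trans n j k m : (k <= j <= n)%N -> anc j k (anc n j m) = anc n k m.
Proof.
by move=> /andP[kj jn]; rewrite /anc -divnMA -expnD; congr (_ %/ 2 ^ _)%N; lia.
Qed.

Lemma anc_lt n k m : (k <= n)%N -> (m < 2 ^ n)%N -> (anc n k m < 2 ^ k)%N.
Proof.
by move=> kn mn; rewrite /anc ltn_divLR ?expn_gt0// -expnD subnKC.
Qed.

Lemma mean_anc n k g : (k <= n)%N -> mean n (fun m => g (anc n k m)) = mean k g.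
Proof.
elim: n => [|n IH]; first by rewrite leqn0 => /eqP ->; under eq_mean do rewrite ancnn.
rewrite leq_eqVlt => /predU1P[->|]; first by under eq_mean do rewrite ancnn.
rewrite ltnS => kn; under eq_mean do rewrite ancS//.
by rewrite (mean_half n (fun m => g (anc n k m))) IH.
Qed.

(** A sum along the branch leading to the node [m] of generation [n]. The node itself is left out,
    so that siblings have the same value. *)
Definition path_sum (V : nmodType) (e : nat -> nat -> V) (s n m : nat) : V :=
  \sum_(s <= k < n) e k (anc n k m).

Lemma path_sumS (V : nmodType) (e : nat -> nat -> V) s n m : (s <= n)%N ->
  path_sum e s n.+1 m = path_sum e s n m./2 + e n m./2.
Proof.
move=> sn; rewrite /path_sum big_nat_recr//= ancS// ancnn; congr (_ + _).
by apply: eq_big_nat => k /andP[_ kn]; rewrite ancS// ltnW.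
Qed.

Lemma path_sum_geq (V : nmodType) (e : nat -> nat -> V) s n m : (n <= s)%N -> path_sum e s n m = 0.
Proof. by move=> ns; rewrite /path_sum big_geq. Qed.

Lemma path_sum_ge0 e s n m : (forall k i, 0 <= e k i) -> 0 <= path_sum e s n m :> R.
Proof. by move=> e0; apply: sumr_ge0. Qed.

Lemma path_sum_cat (V : nmodType) (e : nat -> nat -> V) s n t m : (s <= n <= t)%N ->
  path_sum e s t m = path_sum e s n (anc t n m) + path_sum e n t m.
Proof.
move=> /andP[sn nt]; rewrite /path_sum (big_cat_nat sn nt) /=; congr (_ + _).
by apply: eq_big_nat => k /andP[_ kn]; rewrite anc_trans// (ltnW kn).
Qed.

Lemma mean_path_sum e s n : mean n (path_sum e s n) = \sum_(s <= k < n) mean k (e k).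
Proof.
have [ns|sn] := leqP n s.
  rewrite big_geq// /mean big1 ?mulr0// => i _; exact: path_sum_geq.
elim: n sn => // n IH; rewrite ltnS => sn.
rewrite (eq_mean (g := fun m => path_sum e s n m./2 + e n m./2)); last first.
  by move=> m _; rewrite path_sumS.
rewrite (mean_half n (fun m => path_sum e s n m + e n m)) meanD big_nat_recr//=.
congr (_ + _); move: sn; rewrite leq_eqVlt => /predU1P[<-|]; last exact: IH.
rewrite big_geq// /mean big1 ?mulr0// => i _; exact: path_sum_geq.
Qed.

End Mean.

(** * Tails of the square function in [P]-mean *)

Section Tail.
Variable R : realType.
Variables (P : R -> R) (mP : moderate P) (e : nat -> nat -> R).
Hypothesis e0 : forall n m, 0 <= e n m.

Definition sq_mean s n := mean n (fun m => P (Num.sqrt (path_sum e s n m))).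

Lemma sq_mean_ge0 s n : 0 <= sq_mean s n.
Proof. by rewrite mean_ge0// => m; rewrite moderate_ge0 ?sqrtr_ge0. Qed.

Lemma sq_mean_le s s' n n' : (s <= s')%N -> (n <= n')%N ->
  sq_mean s' n <= sq_mean s n'.
Proof.
move=> ss' nn'; rewrite /sq_mean -(mean_anc (fun m => P (Num.sqrt (path_sum e s' n m))) nn'); apply: le_mean => m _.
apply: (moderate_le mP); rewrite ?sqrtr_ge0// ler_wsqrtr//.
have [ns|s'n] := leqP n s'; first by rewrite path_sum_geq// path_sum_ge0.
rewrite (@path_sum_cat _ e s n n'); last by rewrite nn' andbT; lia.
rewrite (@path_sum_cat _ e s s' n); last by rewrite ss' ltnW.
by rewrite -addrA addrCA lerDl addr_ge0// path_sum_ge0.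
Qed.

(* Either sqrt t is at most 2^-i sqrt s, or t contributes a fixed proportion of
   the increment of P. *)
Lemma moderate_split i : exists2 C, 0 <= C & forall s t, 0 <= s -> 0 <= t ->
  P (Num.sqrt t) <= (3 / 4) ^+ i * P (Num.sqrt s) +
    C * (P (Num.sqrt (s + t)) - P (Num.sqrt s)).
Proof.
(* The ratio of [sqrt s] to [sqrt (s + t)] at the threshold [t = 4^-i s]; for larger [t] the ratio
   is smaller still. *)
pose r := Num.sqrt (1 + 4^-1 ^+ i : R)^-1.
have p0 : 0 < 4^-1 ^+ i :> R by rewrite exprn_gt0.
have r0 : 0 <= r by exact: sqrtr_ge0.
have r2 : r ^+ 2 = (1 + 4^-1 ^+ i)^-1 by rewrite sqr_sqrtr// invr_ge0; lra.
have r1 : r < 1.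
  have : r ^+ 2 < 1 by rewrite r2 invf_lt1; lra.
  by rewrite expr_lt1.
exists (2 / (1 - r)); first by rewrite divr_ge0// subr_ge0 ltW.
move=> s t s0 t0.
have Ps := moderate_ge0 mP (sqrtr_ge0 s).
have mono : P (Num.sqrt s) <= P (Num.sqrt (s + t)).
  by apply: (moderate_le mP); rewrite ?sqrtr_ge0// ler_wsqrtr// lerDl.
have C0 : 0 <= 2 / (1 - r) by rewrite divr_ge0// subr_ge0 ltW.
have [ts|st] := leP t (4^-1 ^+ i * s).
  apply: (@le_trans _ _ ((3 / 4) ^+ i * P (Num.sqrt s))).
    apply: le_trans (moderate_half_iter mP i (sqrtr_ge0 s)).
    apply: (moderate_le mP); rewrite ?sqrtr_ge0//.
    have -> : Num.sqrt s / 2 ^+ i = Num.sqrt (4^-1 ^+ i * s).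
      rewrite sqrtrM ?exprn_ge0// mulrC; congr (_ * _).
      rewrite exprVn -[in RHS](_ : 2 ^+ 2 = 4); last by ring.
      by rewrite -exprM mulnC exprM sqrtrV ?exprn_ge0// sqrtr_sqr ger0_norm// exprn_ge0.
    exact: ler_wsqrtr.
  by rewrite lerDl mulr_ge0// subr_ge0.
have t0' : P (Num.sqrt t) <= P (Num.sqrt (s + t)).
  by apply: (moderate_le mP); rewrite ?sqrtr_ge0// ler_wsqrtr// lerDr.
have sr : Num.sqrt s <= r * Num.sqrt (s + t).
  rewrite -sqrtrM ?invr_ge0; last by lra.
  rewrite ler_wsqrtr// mulrC ler_pdivlMr; lra.
have : P (Num.sqrt s) <= (1 + r) / 2 * P (Num.sqrt (s + t)).
  case: mP => _ pK _; apply: le_trans (pK r _ _ (sqrtr_ge0 _)); last by rewrite r0 ltW.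
  by apply: (moderate_le mP); rewrite ?sqrtr_ge0.
move=> h.
have : P (Num.sqrt (s + t)) <= 2 / (1 - r) * (P (Num.sqrt (s + t)) - P (Num.sqrt s)).
  rewrite mulrAC ler_pdivlMr; lra.
have : 0 <= (3 / 4) ^+ i * P (Num.sqrt s) by rewrite mulr_ge0// exprn_ge0.
lra.
Qed.

(** A substitute for dominated convergence: [moderate_split] bounds the tail by a small multiple of
    the whole plus [C] times an increment of the bounded monotone sequence [sq_mean 0]. First [i] is
    fixed, which fixes [C], and then [s]. *)
Lemma sq_mean_tail X eta : (forall n, sq_mean 0 n <= X) -> 0 < eta ->
  exists s, forall n, sq_mean s n <= eta.
Proof.
move=> hX eta0.
have X0 : 0 <= X by exact: le_trans (sq_mean_ge0 0 0) (hX _).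
have [i hi] : exists i, (3 / 4) ^+ i * X <= eta / 2.
  have : (fun i => (3 / 4) ^+ i * X) @ \oo --> (0 : R).
    rewrite -(mul0r X); apply: cvgMl; apply: cvg_expr; rewrite ger0_norm; lra.
  move/cvgrPdist_le => /(_ (eta / 2)) []; first lra.
  move=> N _ /(_ N (leqnn _)) /=; rewrite sub0r normrN => h; exists N.
  by apply: le_trans h; exact: ler_norm.
have [C C0 hC] := moderate_split i.
have [s hs] : exists s, forall n, (s <= n)%N -> C * (sq_mean 0 n - sq_mean 0 s) <= eta / 2.
  have nd : nondecreasing_seq (sq_mean 0) by move=> a b ab; exact: sq_mean_le.
  have cv : cvgn (sq_mean 0).
    by apply: nondecreasing_is_cvgn => //; exists X => _ [n _ <-].
  have [c cvg ub] : exists2 c, sq_mean 0 @ \oo --> c & forall n, sq_mean 0 n <= c.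
    by exists (limn (sq_mean 0)) => // n; exact: nondecreasing_cvgn_le.
  have : (fun n => C * (c - sq_mean 0 n)) @ \oo --> (0 : R).
    rewrite -(mulr0 C) -(subrr c); apply: cvgMr; apply: cvgB => //; exact: cvg_cst.
  move/cvgrPdist_le => /(_ (eta / 2)) []; first lra.
  move=> N _ /(_ N (leqnn _)) /=; rewrite sub0r normrN => h; exists N => n _.
  apply: (@le_trans _ _ (C * (c - sq_mean 0 N))); last by apply: le_trans h; exact: ler_norm.
  by rewrite ler_wpM2l// lerD2r.
exists s => n; have [ns|sn] := leqP n s.
  rewrite /sq_mean (eq_mean (g := fun=> P 0)); last by move=> m _; rewrite path_sum_geq// sqrtr0.
  by rewrite (moderate0 mP) /mean big1 ?mulr0 ?ltW.
apply: (@le_trans _ _ ((3 / 4) ^+ i * sq_mean 0 s + C * (sq_mean 0 n - sq_mean 0 s))).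
  rewrite /sq_mean -(mean_anc (fun m => P (Num.sqrt (path_sum e 0 s m))) (ltnW sn)) -mulN1r -!meanZ -meanD -!meanZ -meanD; apply: le_mean => m _.
  rewrite mulN1r (@path_sum_cat _ e 0 s n) ?(ltnW sn)//.
  by apply: hC; exact: path_sum_ge0.
have := hs n (ltnW sn); have : (3 / 4) ^+ i * sq_mean 0 s <= (3 / 4) ^+ i * X by rewrite ler_wpM2l// exprn_ge0.
lra.
Qed.

End Tail.

(** * The stopping procedure and its cost *)

Section Stopping.
Variable R : realType.
Variables (d : nat -> nat -> R[i]) (frc : pred nat) (P : R -> R).
Hypothesis mP : moderate P.

Definition esq n m : R := normc (d n m) ^+ 2.
Definition sgn (m : nat) : R[i] := (-1) ^+ m.

(* State of the stopping procedure at node m of generation n: sstat is the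
   square of the square function since the last forced generation, slev its
   value at the last restart, sdev the deviation of the martingale since then. *)
Record state := State { sstat : R ; slev : R ; sdev : R[i] ; sgen : nat }.

(** The statistic at a node contains the coefficient [d n m] of the node itself, while the deviation
    ends with that of its parent: the square function is known one step ahead. Only a forced restart
    clears the statistic; any other one just resets the level and the deviation. *)
Fixpoint stop (n m : nat) : state :=
  if n is k.+1 then
    let p := stop k m./2 in
    let s := esq n m + (if frc n then 0 else sstat p) in
    let q := sdev p + sgn m * d k m./2 in
    let r := [|| frc n, 2 * slev p < Num.sqrt s | 8 * slev p < normc q] in
    State s (if r then Num.sqrt s else slev p) (if r then 0 else q)
      (if r then n else sgen p)
  else State (esq 0 m) (Num.sqrt (esq 0 m)) 0 0.

Definition restart n m := sgen (stop n m) == n.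

Lemma esq_ge0 n m : 0 <= esq n m.
Proof. exact: sqr_ge0. Qed.

Lemma normc_ge0 (z : R[i]) : 0 <= normc z.
Proof. by case: z => a b; exact: sqrtr_ge0. Qed.

Lemma stopP n m : [/\ 0 <= sstat (stop n m), 0 <= slev (stop n m) <= Num.sqrt (sstat (stop n m)),
  Num.sqrt (sstat (stop n m)) <= 2 * slev (stop n m),
  normc (sdev (stop n m)) <= 8 * slev (stop n m) & (sgen (stop n m) <= n)%N].
Proof.
have sq z : Num.sqrt z <= 2 * Num.sqrt z :> R by have := sqrtr_ge0 z; lra.
have n0 z : normc (0 : R[i]) <= 8 * Num.sqrt z by rewrite normc0 mulr_ge0.
elim: n m => [|n IH] m /=; first by rewrite esq_ge0 sqrtr_ge0 lexx sq n0.
have [s0 /andP[l0 ls] sl dl gn] := IH m./2.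
set s := esq _ _ + _; set q := sdev _ + _.
have se : 0 <= s by rewrite addr_ge0 ?esq_ge0//; case: ifP.
case: ifP => [_|/negbT]; first by rewrite se sqrtr_ge0 lexx sq n0.
rewrite !negb_or -!leNgt => /and3P[fn h1 h2]; split => //; last exact: leqW.
rewrite l0/= (le_trans ls)// ler_wsqrtr// /s (negbTE fn) lerDr esq_ge0//.
Qed.

Lemma sgen_le n m : (sgen (stop n m) <= n)%N.
Proof. by case: (stopP n m). Qed.

Lemma sgnD m : sgn m.*2 = 1.
Proof. by rewrite /sgn -signr_odd odd_double. Qed.

Lemma sgnDS m : sgn m.*2.+1 = -1.
Proof. by rewrite /sgn -signr_odd /= odd_double. Qed.

Lemma normc_sqr (z : R[i]) : normc z ^+ 2 = complex.Re z ^+ 2 + complex.Im z ^+ 2.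
Proof. by case: z => a b; rewrite sqr_sqrtr// addr_ge0 ?sqr_ge0. Qed.

Lemma normc_parallelogram (z w : R[i]) :
  normc (z + w) ^+ 2 + normc (z - w) ^+ 2 = 2 * (normc z ^+ 2 + normc w ^+ 2).
Proof. by rewrite !normc_sqr; case: z w => [a b] [x y] /=; ring. Qed.

Definition cost n m := if restart n m then P (slev (stop n m)) else 0.

Definition stop_weight n m :=
  P (Num.sqrt (sstat (stop n m))) / Num.sqrt (sstat (stop n m)) ^+ 2.

Lemma stop_weight_ge0 n m : 0 <= stop_weight n m.
Proof. by rewrite divr_ge0 ?sqr_ge0 ?(moderate_ge0 mP) ?sqrtr_ge0. Qed.

(* A restart caused by |sdev| > 8 slev with S <= 2 slev releases at least
   64/16 slev^2 P(S)/S^2 >= P(S) of the quadratic part; one caused by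
   S > 2 slev is paid for by 4 (P(S) - P(slev)) >= P(S). *)
Definition potential n m :=
  normc (sdev (stop n m)) ^+ 2 * stop_weight n m / 16 - 4 * P (slev (stop n m)).

Lemma restartS n m (p := stop n m./2)
  (s := esq n.+1 m + (if frc n.+1 then 0 else sstat p))
  (q := sdev p + sgn m * d n m./2) :
  restart n.+1 m = [|| frc n.+1, 2 * slev p < Num.sqrt s | 8 * slev p < normc q].
Proof.
rewrite /restart /= -/p -/s -/q; case: ifP => // _; first by rewrite eqxx.
by apply/negbTE; rewrite neq_ltn ltnS sgen_le.
Qed.

Lemma restart_forced n m : frc n || (n == 0)%N -> restart n m.
Proof. by case: n => [//|n]; rewrite orbF => fn; rewrite restartS fn. Qed.

Lemma restart_state n m : restart n m ->
  slev (stop n m) = Num.sqrt (sstat (stop n m)) /\ sdev (stop n m) = 0.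
Proof.
by case: n => [//|n]; rewrite restartS /= => ->.
Qed.

Lemma cost_restart n m : restart n m ->
  cost n m + potential n m <= 0.
Proof.
move=> r; rewrite /cost /potential r; have [_ ->] := restart_state r.
have [_ /andP[l0 _] _ _ _] := stopP n m.
have := moderate_ge0 mP l0; rewrite normc0 expr0n /= !mul0r; lra.
Qed.

Lemma esq_le n m : esq n m <= sstat (stop n m).
Proof.
case: n => [//|n] /=; rewrite lerDl; case: ifP => // _.
by case: (stopP n m./2).
Qed.

Lemma child_cost n m (q := sdev (stop n m./2) + sgn m * d n m./2) : ~~ frc n.+1 ->
  cost n.+1 m + potential n.+1 m <=
    normc q ^+ 2 * stop_weight n m./2 / 16 - 4 * P (slev (stop n m./2)).
Proof.
move=> fn; have [s0 /andP[l0 ls] sl dl gn] := stopP n m./2.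
have [s0' /andP[l0' ls'] sl' dl' _] := stopP n.+1 m.
have := restartS n m; rewrite (negbTE fn) /=; rewrite -/q.
move: s0' l0' ls' sl' dl'; rewrite /cost /potential /stop_weight /= (negbTE fn) /= -/q.
set L := slev _ in l0 ls sl dl *; set S := sstat _ in s0 ls sl *.
set S' := esq _ _ + S; move=> s0' l0' ls' sl' dl' rE.
have SS' : Num.sqrt S <= Num.sqrt S' by rewrite ler_wsqrtr// lerDr esq_ge0.
rewrite rE (fun_if (@normc R)) normc0; have q0 := normc_ge0 q.
have [h1|h1] := ltP (2 * L) (Num.sqrt S') => /=; rewrite ?expr0n /= ?mul0r.
  have h : 0 <= normc q ^+ 2 * (P (Num.sqrt S) / Num.sqrt S ^+ 2) / 16.
    by rewrite !(mulr_ge0, divr_ge0, sqr_ge0)// (moderate_ge0 mP)// sqrtr_ge0.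
  have := moderate_half mP (sqrtr_ge0 S').
  have : P L <= P (Num.sqrt S' / 2) by apply: (moderate_le mP) => //; lra.
  lra.
(* A zero statistic makes the weight [0] through division by zero; in that case the level, the
   deviation and the coefficient of the parent all vanish. *)
have [z|Sp] := eqVneq (Num.sqrt S) 0.
  have L0 : L = 0 by lra.
  have d0 : normc (d n m./2) = 0.
    have : normc (d n m./2) <= Num.sqrt S.
      rewrite -(ger0_norm (normc_ge0 (d n m./2))) -sqrtr_sqr ler_wsqrtr//; exact: esq_le.
    by have := normc_ge0 (d n m./2); lra.
  have q00 : normc q = 0.
    rewrite /q (eq0_normc d0) mulr0 addr0; have := normc_ge0 (sdev (stop n m./2)); lra.
  by rewrite q00 L0 mulr0 ltxx expr0n/= !mul0r add0r.
have Sgt : 0 < Num.sqrt S by rewrite lt_neqAle eq_sym Sp sqrtr_ge0.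
have w := moderate_weight_le mP Sgt SS'.
have qw : normc q ^+ 2 * (P (Num.sqrt S') / Num.sqrt S' ^+ 2) <=
     normc q ^+ 2 * (P (Num.sqrt S) / Num.sqrt S ^+ 2) by rewrite ler_wpM2l ?sqr_ge0.
have [h2|h2] := ltP (8 * L) (normc q) => /=; rewrite ?expr0n /= ?mul0r; last lra.
have := @moderate_le _ _ mP L (Num.sqrt S') l0 (le_trans ls SS').
have : 16 * P (Num.sqrt S') <= normc q ^+ 2 * (P (Num.sqrt S') / Num.sqrt S' ^+ 2).
  rewrite mulrCA mulrC ler_wpM2l ?(moderate_ge0 mP) ?sqrtr_ge0//.
  rewrite ler_pdivlMr ?exprn_gt0//; last by lra.
  nra.
lra.
Qed.


(** Averaging over two siblings cancels the cross term of the deviation with [d] (parallelogram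
    law), so that only the square of the jump, times the weight of the parent, is added. *)
Lemma mean_potential_step n : ~~ frc n.+1 ->
  mean n.+1 (cost n.+1) + mean n.+1 (potential n.+1) <=
  mean n (potential n) + mean n (fun m => esq n m * stop_weight n m) / 16.
Proof.
move=> fn; rewrite -meanD meanS mulrC -meanZ -meanD; apply: le_mean => m _.
have := child_cost m.*2 fn; have := child_cost m.*2.+1 fn.
rewrite sgnD sgnDS doubleK (_ : m.*2.+1./2 = m); last first.
  by rewrite -[LHS]/(uphalf m.*2) uphalf_double.
rewrite mul1r mulN1r /potential.
have := normc_parallelogram (sdev (stop n m)) (d n m).
rewrite -/(esq n m); set w := stop_weight n m.
set a := normc _ ^+ 2; set b := normc _ ^+ 2; set c := normc _ ^+ 2 => abc.
have : a * w + b * w = 2 * (c * w + esq n m * w) by rewrite -mulrDl abc; ring.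
lra.
Qed.

Lemma stat_path s n m : (frc s || (s == 0)%N) -> (s <= n)%N ->
  (forall i, (s < i <= n)%N -> ~~ frc i) ->
  sstat (stop n m) = path_sum esq s n m + esq n m.
Proof.
move=> fs; elim: n m => [|n IH] m sn nf.
  by rewrite /= path_sum_geq ?add0r.
move: sn; rewrite leq_eqVlt => /predU1P[sE|].
  rewrite /= -sE path_sum_geq ?add0r//; move: fs; rewrite sE orbF => ->; exact: addr0.
rewrite ltnS => sn; rewrite /= (negbTE (nf _ _)) ?ltnS ?sn//=.
rewrite path_sumS// addrC IH//.
by move=> i /andP[si i_n]; apply: nf; rewrite si ltnW// ltnS.
Qed.

(** By [moderate_increment] each added term is at most [4 / 16] of an increment of [P] of the square
    function, and these increments telescope. At [n = s] every node restarts and the left side is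
    nonpositive. *)
Lemma mean_cost_potential s n : (frc s || (s == 0)%N) -> (s <= n)%N ->
  (forall i, (s < i <= n)%N -> ~~ frc i) ->
  \sum_(s <= i < n.+1) mean i (cost i) + mean n (potential n) <=
  mean n (fun m => P (Num.sqrt (path_sum esq s n m))) / 4.
Proof.
move=> fs; elim: n => [|n IH] sn nf.
- move: sn; rewrite leqn0 => /eqP ->; rewrite big_nat1 -meanD.
  apply: (@le_trans _ _ 0); first rewrite mean0 cost_restart// restart_forced// orbT.
  by rewrite divr_ge0// mean_ge0// => m; rewrite moderate_ge0 ?sqrtr_ge0.
- move: sn; rewrite leq_eqVlt => /predU1P[sE|].
    rewrite sE big_nat1 -meanD.
    apply: (@le_trans _ _ 0).
      rewrite -[leRHS](_ : mean n.+1 (fun=> 0) = 0); last by rewrite /mean big1 ?mulr0.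
      by apply: le_mean => m _; rewrite cost_restart// restart_forced// -sE.
    by rewrite divr_ge0// mean_ge0// => m; rewrite moderate_ge0 ?sqrtr_ge0.
  rewrite ltnS => sn; rewrite big_nat_recr/=; last exact: leqW.
  have nf' i : (s < i <= n)%N -> ~~ frc i.
    by move=> /andP[si i_n]; apply: nf; rewrite si leqW.
  have := mean_potential_step (nf n.+1 _); rewrite ltnS sn leqnn => /(_ isT).
  have := IH sn nf'.
  rewrite [X in _ -> _ -> _ <= X / _](_ : _ = mean n (fun m => P (Num.sqrt (sstat (stop n m))))); last first.
    rewrite -(mean_half n); apply: eq_mean => m _; rewrite path_sumS//.
    by rewrite -stat_path.
  have : mean n (fun m => esq n m * stop_weight n m) <=
      4 * (mean n (fun m => P (Num.sqrt (sstat (stop n m)))) -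
           mean n (fun m => P (Num.sqrt (path_sum esq s n m)))).
    rewrite -mulN1r -meanZ -meanD -meanZ; apply: le_mean => m _; rewrite mulN1r.
    rewrite (stat_path _ fs sn nf') /stop_weight (stat_path _ fs sn nf').
    have p0 : 0 <= path_sum esq s n m by apply: path_sum_ge0 => *; exact: esq_ge0.
    have q0 := esq_ge0 n m.
    have le : Num.sqrt (path_sum esq s n m) <= Num.sqrt (path_sum esq s n m + esq n m).
      by rewrite ler_wsqrtr// lerDl.
    have := moderate_increment mP (sqrtr_ge0 _) le.
    by rewrite !sqr_sqrtr ?addr_ge0// [_ + esq n m - _]addrAC subrr add0r.
  lra.
Qed.

(** The constant [5] covers [1 / 4] from the telescoping sum and [4] from the negative part of the
    final potential. The last generation counted is [n - 1], whose statistic is the path sum up to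
    [n]. *)
Lemma mean_cost s n : (frc s || (s == 0)%N) -> (s < n)%N ->
  (forall i, (s < i < n)%N -> ~~ frc i) ->
  \sum_(s <= i < n) mean i (cost i) <=
  5 * mean n (fun m => P (Num.sqrt (path_sum esq s n m))).
Proof.
case: n => // n fs; rewrite ltnS => sn nf.
have := mean_cost_potential fs sn nf.
rewrite [X in _ -> _ <= _ * X](_ : _ = mean n (fun m => P (Num.sqrt (sstat (stop n m))))); last first.
  rewrite -(mean_half n); apply: eq_mean => m _; rewrite path_sumS//.
  by rewrite -stat_path.
have : mean n (fun m => P (Num.sqrt (path_sum esq s n m))) <=
       mean n (fun m => P (Num.sqrt (sstat (stop n m)))).
  apply: le_mean => m _; apply: (moderate_le mP) => //; rewrite ?sqrtr_ge0//.
  by rewrite (stat_path _ fs sn nf) ler_wsqrtr// lerDl esq_ge0.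
have : - mean n (potential n) <= 4 * mean n (fun m => P (Num.sqrt (sstat (stop n m)))).
  rewrite -mulN1r -!meanZ; apply: le_mean => m _.
  have [s0 /andP[l0 ls] _ _ _] := stopP n m.
  rewrite /potential; have := moderate_le mP l0 ls.
  have : 0 <= normc (sdev (stop n m)) ^+ 2 * stop_weight n m / 16.
    by rewrite divr_ge0// mulr_ge0 ?sqr_ge0 ?stop_weight_ge0.
  lra.
have : 0 <= mean n (fun m => P (Num.sqrt (sstat (stop n m)))).
  by rewrite mean_ge0// => m; rewrite moderate_ge0 ?sqrtr_ge0.
lra.
Qed.

End Stopping.

(** * Choice of the forced generations *)

Section Epochs.
Variable R : realType.
Variables (d : nat -> nat -> R[i]) (P : R -> R) (X : R).
Hypothesis mP : moderate P.
Hypothesis dX : forall n, sq_mean P (esq d) 0 n <= X.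

(** [sq_mean_tail] provides a generation for each [j], and the maximum makes the sequence strictly
    increasing. For [X = 0], where no positive [eta] is available, all tails already vanish. *)
Lemma epochs : exists nj : nat -> nat, [/\ nj 0%N = 0%N, forall j, (nj j < nj j.+1)%N &
  forall j N, sq_mean P (esq d) (nj j) N <= (2 ^+ j)^-1 * X].
Proof.
have e0 := @esq_ge0 _ d.
have [nu hnu] : {nu : nat -> nat & forall j N, sq_mean P (esq d) (nu j) N <= (2 ^+ j)^-1 * X}.
  apply: (@choice _ _ (fun j s => forall N, sq_mean P (esq d) s N <= (2 ^+ j)^-1 * X)) => j.
  have X0 : 0 <= X by exact: le_trans (sq_mean_ge0 mP _ 0 0) (dX _).
  move: X0; rewrite le_eqVlt => /predU1P[XE|X0].
    by exists 0%N => N; rewrite -XE mulr0 (le_trans (dX N))// -XE.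
  by apply: (sq_mean_tail mP e0 dX); rewrite mulr_gt0// invr_gt0 exprn_gt0.
pose nj := fix nj j := if j is k.+1 then maxn (nj k).+1 (nu k.+1) else 0%N.
exists nj; split => // [j|j N]; first by rewrite leq_max leqnn.
case: j => [|j]; first by rewrite expr0 invr1 mul1r.
by apply: le_trans (hnu j.+1 N); apply: (sq_mean_le mP e0) => //; rewrite leq_maxr.
Qed.

(** A forced restart makes all blocks finite at the price of restarting at every node of the
    generation. The epoch that begins at [nj j] costs at most [5 * 2^-j * X], and the geometric
    series gives [10 * X]. *)
Lemma forced_generations : exists frc : pred nat, (forall n, exists2 t, (n < t)%N & frc t) /\
  forall N, \sum_(i < N) mean i (cost d frc P i) <= 10 * X.
Proof.
have [nj [nj0 njS hnj]] := epochs.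
have nj_homo : {homo nj : a b / (a < b)%N >-> (a < b)%N} by apply: homo_ltn => //; exact: ltn_trans.
have nj_mono : {mono nj : a b / (a <= b)%N >-> (a <= b)%N} by apply: leq_mono.
have nj_ge j : (j <= nj j)%N by elim: j => // j IH; exact: leq_ltn_trans (njS j).
have X0 : 0 <= X by exact: le_trans (sq_mean_ge0 mP _ 0 0) (dX _).
pose frc n := [exists j : 'I_n.+1, nj j == n].
have frcP n : reflect (exists j, nj j = n) (frc n).
  apply: (iffP existsP) => [[j /eqP <-]|[j <-]]; first by exists j.
  by exists (Ordinal (nj_ge j : (j < (nj j).+1)%N)).
exists frc; split=> [n|N].
  by exists (nj n.+1); [exact: leq_trans (nj_ge n.+1)|apply/frcP; exists n.+1].
have cost0 i : 0 <= mean i (cost d frc P i).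
  rewrite mean_ge0// => m; rewrite /cost; case: ifP => // _.
  by have [_ /andP[l0 _] _ _ _] := stopP d frc i m; exact: (moderate_ge0 mP).
have epoch j : \sum_(nj j <= i < nj j.+1) mean i (cost d frc P i) <= 5 * ((2 ^+ j)^-1 * X).
  apply: (@le_trans _ _ (5 * sq_mean P (esq d) (nj j) (nj j.+1))); last by rewrite ler_wpM2l.
  rewrite /sq_mean; apply: (@mean_cost _ d frc P mP) => //; first by apply/orP; left; apply/frcP; exists j.
  move=> i /andP[ji iS]; apply/frcP => -[k kE]; move: ji iS.
  by rewrite -kE !ltnNge !nj_mono -!ltnNge ltnS => h /(leq_trans h); rewrite ltnn.
have tot J : \sum_(0 <= i < nj J) mean i (cost d frc P i) <= 10 * (1 - (2 ^+ J)^-1) * X.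
  elim: J => [|J IH]; first by rewrite nj0 big_geq// expr0 invr1 subrr mulr0 mul0r.
  rewrite (big_cat_nat (n := nj J)) ?(ltnW (njS J))//=.
  have := epoch J; rewrite exprS invfM; set q := (2 ^+ J)^-1 in IH *; lra.
apply: (@le_trans _ _ (\sum_(0 <= i < nj N) mean i (cost d frc P i))).
  rewrite -(big_mkord xpredT (fun i => mean i (cost d frc P i))).
  by rewrite (big_cat_nat (n := N) (p := nj N))//= lerDl sumr_ge0.
apply: (le_trans (tot N)); rewrite ler_wpM2r//.
have : 0 <= (2 ^+ N)^-1 :> R by rewrite invr_ge0 exprn_ge0.
lra.
Qed.
End Epochs.

(** * Blocks of the stopping procedure and their sup bound *)

Section Block.
Variable R : realType.

(** The value on the arc [m] of generation [N] of the Haar sum over the generations [k < N]; the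
    sign of h_J on a child is given by the parity of its position. *)
Definition mart (d : nat -> nat -> R[i]) (N m : nat) : R[i] :=
  \sum_(k < N) sgn R (anc N k.+1 m) * d k (anc N k m).

Lemma martS d N m : mart d N.+1 m = mart d N m./2 + sgn R m * d N m./2.
Proof.
rewrite /mart big_ord_recr /= ancnn ancS// ancnn; congr (_ + _).
by apply: eq_bigr => k _; rewrite !ancS// ltnW.
Qed.

Lemma normc_sgn m : normc (sgn R m) = 1.
Proof. by rewrite /sgn -signr_odd; case: odd; rewrite ?expr0 ?expr1 ?normcN normc1. Qed.

Variables (d : nat -> nat -> R[i]) (frc : pred nat) (n0 m0 : nat).
Hypothesis r0 : restart d frc n0 m0.

(* The coefficients of the arcs whose last restarted ancestor is (n0, m0). *)
Definition block n m : R[i] :=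
  if (sgen (stop d frc n m) == n0) && (anc n n0 m == m0) then d n m else 0.

Let L := slev (stop d frc n0 m0).

Lemma block_lt n m : (n < n0)%N -> block n m = 0.
Proof.
move=> nn0; rewrite /block (_ : _ == n0 = false)//; apply/negbTE.
by rewrite neq_ltn (leq_ltn_trans (sgen_le _ _ n m) nn0).
Qed.

Lemma sgen_forced t n m : frc t -> (t <= n)%N -> (t <= sgen (stop d frc n m))%N.
Proof.
move=> ft; elim: n m => [|n IH] m; first by rewrite leqn0 => /eqP ->.
rewrite leq_eqVlt => /predU1P[<-|].
  have /eqP -> // : restart d frc t m by apply: restart_forced; rewrite ft.
by rewrite ltnS => tn /=; case: ifP => _; [exact: leqW|exact: IH].
Qed.

Lemma block_ge t n m : frc t -> (n0 < t)%N -> (t <= n)%N -> block n m = 0.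
Proof.
move=> ft n0t tn; rewrite /block (_ : _ == n0 = false)//; apply/negbTE.
by rewrite neq_ltn (leq_trans n0t (sgen_forced m ft tn)) orbT.
Qed.

Lemma mart_block0 N m : (N <= n0)%N || (anc N n0 m != m0) -> mart block N m = 0.
Proof.
move=> h; rewrite /mart big1// => -[k kN] _ /=.
have [kn0|n0k] := ltnP k n0; first by rewrite block_lt// mulr0.
have n0N : (n0 < N)%N by exact: leq_ltn_trans kN.
move: h; rewrite leqNgt n0N /= => h.
by rewrite /block anc_trans ?n0k 1?ltnW// (negbTE h) andbF mulr0.
Qed.

(** Inside the block the partial sum is the deviation since the restart; after the exit it is
    frozen. The increment at the exit is at most [Num.sqrt sstat], hence at most [2 * L], and is
    added to a deviation of at most [8 * L]. *)
Lemma mart_block_dichotomy N m : (n0 <= N)%N -> anc N n0 m = m0 ->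
  [/\ sgen (stop d frc N m) = n0, mart block N m = sdev (stop d frc N m) &
      slev (stop d frc N m) = L] \/
  (n0 < sgen (stop d frc N m))%N /\ normc (mart block N m) <= 10 * L.
Proof.
elim: N m => [|N IH] m.
  rewrite leqn0 => /eqP n00; rewrite n00 ancnn => mE; left.
  by rewrite /mart big_ord0 /L n00 mE.
rewrite leq_eqVlt => /predU1P[n0E|].
  rewrite -n0E ancnn => mE; left; rewrite mE mart_block0 ?leqnn//.
  by have [_ ->] := restart_state r0; rewrite (eqP r0).
rewrite ltnS => n0N; rewrite ancS// => mE.
rewrite martS; have [[gE -> LE]|[gt le]] := IH _ n0N mE; last first.
  right; rewrite {2}/block (gtn_eqF gt)/= mulr0 addr0; split=> //.
  by case: ifP => // _; exact: leq_ltn_trans n0N _.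
rewrite /block gE eqxx mE eqxx /=.
have [s0 /andP[l0 ls] sl dl _] := stopP d frc N m./2.
case: ifP => [_|_]; last by left.
right; split; first by rewrite ltnS.
apply: le_trans (le_normcD _ _) _; rewrite normcM.
rewrite normc_sgn.
have : normc (d N m./2) <= Num.sqrt (sstat (stop d frc N m./2)).
  rewrite -(ger0_norm (normc_ge0 (d N m./2))) -sqrtr_sqr ler_wsqrtr//; exact: esq_le.
rewrite mul1r; move: sl dl; rewrite LE; lra.
Qed.

Lemma mart_block_le N m : normc (mart block N m) <= 10 * L.
Proof.
have [_ /andP[l0 _] _ _ _] := stopP d frc n0 m0; rewrite -/L in l0.
have z : normc (0 : R[i]) <= 10 * L by rewrite normc0 mulr_ge0.
have [h|] := boolP ((N <= n0)%N || (anc N n0 m != m0)); first by rewrite mart_block0.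
rewrite negb_or negbK -ltnNge => /andP[n0N /eqP mE].
have [[_ -> <-]|[]//] := mart_block_dichotomy (ltnW n0N) mE.
by have [_ /andP[? _] _ + _] := stopP d frc N m; lra.
Qed.

End Block.

(** Hence the blocks partition the tree: each node belongs to the block of exactly one restarted
    ancestor, possibly itself. *)
Lemma restart_owner (R : realType) (d : nat -> nat -> R[i]) frc n m :
  restart d frc (sgen (stop d frc n m)) (anc n (sgen (stop d frc n m)) m).
Proof.
elim: n m => [|n IH] m; first by rewrite ancnn.
have [r|nr] := boolP (restart d frc n.+1 m).
  by rewrite (eqP r) ancnn.
have gE : sgen (stop d frc n.+1 m) = sgen (stop d frc n m./2).
  move: nr; rewrite restartS => /negbTE nr.
  by rewrite [LHS]/=; case: ifP => //; rewrite nr.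
by rewrite gE ancS ?IH// sgen_le.
Qed.

(** * Dyadic arcs and Haar coefficients *)

Section Torus.
Variables (R : realType) (delta : R).
Hypothesis hdelta : 0 <= delta < 1.
Notation mu := (torus_measure R).
Notation pi2 := (pi *+ 2 : R).

Lemma pi2_gt0 : 0 < pi2.
Proof. by rewrite mulrn_wgt0// pi_gt0. Qed.

(** In the coordinate [phase] the arcs of generation [n] are [[m / 2^n, (m + 1) / 2^n[], and
    [idx n x] is the position of the one containing [x]. Membership in an arc becomes an equation
    between natural numbers. *)
Definition turn (x : R) : R := x / pi2 - delta.
Lemma turnK x : pi2 * (turn x + delta) = x.
Proof. by rewrite /turn subrK mulrCA divff ?mulr1// lt0r_neq0// pi2_gt0. Qed.

Definition phase (x : R) : R := turn x - (Num.floor (turn x))%:~R.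
Definition idx (n : nat) (x : R) : nat := Num.truncn (2 ^+ n * phase x).

Lemma phase_itv x : 0 <= phase x < 1.
Proof.
have /andP[] := floor_itv (turn x); rewrite intrD mulr1z /phase; lra.
Qed.

Lemma idxP n x m : idx n x = m <-> m%:R <= 2 ^+ n * phase x < m.+1%:R.
Proof.
have /andP[p0 _] := phase_itv x.
have h : 0 <= 2 ^+ n * phase x by rewrite mulr_ge0 ?exprn_ge0.
by rewrite -truncn_eq//; split => /eqP.
Qed.

Lemma idx_lt n x : (idx n x < 2 ^ n)%N.
Proof.
have /andP[p0 p1] := phase_itv x.
rewrite truncn_lt_nat ?mulr_ge0 ?exprn_ge0// natrX gtr_pMr// exprn_gt0//.
Qed.

Lemma idxS n x : (idx n.+1 x)./2 = idx n x.
Proof.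
apply/esym/idxP; have /idxP := erefl (idx n.+1 x).
set k := idx n.+1 x; rewrite exprS -mulrA; set y := 2 ^+ n * _.
have := odd_double_half k; set j := k./2 => <-.
rewrite -mul2n -natr1 natrD natrM -natr1.
by case: (odd k) => /=; rewrite ?mulr1n ?mulr0n; lra.
Qed.

Lemma anc_idx N n x : (n <= N)%N -> anc N n (idx N x) = idx n x.
Proof.
elim: N => [|N IH]; first by rewrite leqn0 => /eqP ->; rewrite ancnn.
rewrite leq_eqVlt => /predU1P[->|]; first by rewrite ancnn.
by rewrite ltnS => nN; rewrite ancS// idxS IH.
Qed.

Lemma dyadic_arcP k m x : (m < 2 ^ k)%N -> dyadic_arc delta k m x <-> idx k x = m.
Proof.
move=> mk; have p := pi2_gt0.
have k0 : 0 < 2 ^+ k :> R by rewrite exprn_gt0.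
have E (z : int) : (pi2 * (m%:R / 2 ^+ k + delta) <= x + pi2 * z%:~R < pi2 * (m.+1%:R / 2 ^+ k + delta)) =
   (m%:R <= 2 ^+ k * (turn x + z%:~R) < m.+1%:R).
  have -> : x + pi2 * z%:~R = pi2 * (turn x + z%:~R + delta).
    by rewrite -[in LHS](turnK x); ring.
  by rewrite ler_pM2l// ltr_pM2l// lerD2r ltrD2r ler_pdivrMr// ltr_pdivlMr// mulrC.
split.
- move=> [z]; rewrite E => h.
  have zE : Num.floor (turn x) = - z.
    apply/eqP; rewrite floor_eq; move: h => /andP[h1 h2].
    have h3 : 0 <= 2 ^+ k * (turn x + z%:~R) by rewrite (le_trans _ h1).
    have h4 : 2 ^+ k * (turn x + z%:~R) < 2 ^+ k * 1.
      by rewrite mulr1 (lt_le_trans h2)// -natrX ler_nat.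
    move: h3 h4; rewrite pmulr_rge0// ltr_pM2l// intrD mulr1z intrN; lra.
  by apply/idxP; rewrite /phase zE intrN opprK.
- move/idxP => h; exists (- Num.floor (turn x)); rewrite E intrN; exact: h.
Qed.

Lemma idx_periodic n x : idx n (x + pi2) = idx n x.
Proof.
have tE : turn (x + pi2) = turn x + 1.
  by rewrite /turn mulrDl divff ?lt0r_neq0 ?pi2_gt0// addrAC.
by rewrite /idx /phase tE floorDrz// floor1 intrD opprD addrACA subrr addr0.
Qed.

Lemma idx_close n x y : idx n x = idx n y ->
  exists z : int, `|x + pi2 * z%:~R - y| <= pi2 / 2 ^+ n.
Proof.
move=> xy; have p := pi2_gt0.
have k0 : 0 < 2 ^+ n :> R by rewrite exprn_gt0.
have /idxP := xy; have /idxP := erefl (idx n y); set m := idx n y => hy hx.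
exists (Num.floor (turn y) - Num.floor (turn x)).
have -> : x + pi2 * (Num.floor (turn y) - Num.floor (turn x))%:~R - y = pi2 / 2 ^+ n * (2 ^+ n * phase x - 2 ^+ n * phase y).
  rewrite /phase; set fx := Num.floor _; set fy := Num.floor _.
  rewrite -[in LHS](turnK x) -[in LHS](turnK y) intrB -mulrBr mulrA divfK ?lt0r_neq0//.
  ring.
have l0 : 0 <= pi2 / 2 ^+ n by rewrite divr_ge0 ?(ltW p) ?(ltW k0).
rewrite normrM (ger0_norm l0) ler_piMr//.
move: hx hy; rewrite -natr1 ler_norml; lra.
Qed.

Definition arc n m : set R := [set x | idx n x = m].

Lemma measurable_dyadic_arc k m : measurable (dyadic_arc delta k m : set (measurableTypeR R)).
Proof.
pose I (z : int) : set R := `[pi2 * (m%:R / 2 ^+ k + delta) - pi2 * z%:~R, pi2 * (m.+1%:R / 2 ^+ k + delta) - pi2 * z%:~R[%classic.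
have -> : dyadic_arc delta k m = \bigcup_n (I (Posz n) `|` I (- Posz n)).
  apply/seteqP; split=> x.
    move=> [z hz]; exists `|z|%N => //; case: (intP z) hz => [|n|n] hz; [left|left|right];
      by rewrite /I/= in_itv /=; move: hz; rewrite ?absz_nat ?abszN; lra.
  by case=> n _ [] h; [exists (Posz n)|exists (- Posz n)]; move: h; rewrite /I/= in_itv/=; lra.
apply: bigcupT_measurable => n; apply: measurableU; exact: measurable_itv.
Qed.

Lemma measurable_arc n m : measurable (arc n m : set (measurableTypeR R)).
Proof.
have [mn|nm] := ltnP m (2 ^ n).
  rewrite (_ : arc n m = dyadic_arc delta n m); first exact: measurable_dyadic_arc.
  by apply/seteqP; split=> x /dyadic_arcP; apply.
rewrite (_ : arc n m = set0)// -subset0 => x /= xE.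
by have := idx_lt n x; rewrite xE ltnNge nm.
Qed.

Definition len n : R := pi2 / 2 ^+ n.

Lemma mu_arc n m : (m < 2 ^ n)%N -> mu (arc n m) = (len n)%:E.
Proof.
move=> mn; have p := pi2_gt0; move: hdelta => /andP[d0 d1].
have k0 : 0 < 2 ^+ n :> R by rewrite exprn_gt0.
rewrite /torus_measure /mrestr.
pose w := (2 ^+ n)^-1 : R; pose a := m%:R * w + delta : R.
have w0 : 0 < w by rewrite invr_gt0.
have mw : m%:R * w + w <= 1.
  rewrite -[X in _ + X]mul1r -mulrDl ler_pdivrMr// mul1r natr1 -natrX ler_nat//.
have m0 : 0 <= m%:R * w by rewrite mulr_ge0 ?(ltW w0).
(* An arc may run over the end of the period. Its trace on [[0, 2pi[] consists of a part [A] where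
   [turn] is negative and a part [B] where it is not; either may be empty. *)
pose A : set R := `[pi2 * Num.max 0 (a - 1), pi2 * (a + w - 1)[%classic.
pose B : set R := `[pi2 * a, pi2 * Num.min 1 (a + w)[%classic.
have AB : arc n m `&` `[0, pi2[ = A `|` B.
  have arcE x : arc n m x <-> m%:R * w <= phase x < m%:R * w + w.
    rewrite /arc /= idxP -[X in _ < _ * w + X]mul1r -mulrDl natr1.
    by rewrite ler_pdivrMr// ltr_pdivlMr// mulrC.
  have inA x : A x <-> Num.max 0 (a - 1) <= turn x + delta < a + w - 1.
    by rewrite /A /= in_itv /= -[in X in X <-> _](turnK x) ler_pM2l// ltr_pM2l.
  have inB x : B x <-> a <= turn x + delta < Num.min 1 (a + w).
    by rewrite /B /= in_itv /= -[in X in X <-> _](turnK x) ler_pM2l// ltr_pM2l.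
  have inT x : `[0, pi2[%classic x <-> 0 <= turn x + delta < 1.
    rewrite /= in_itv /= -[in X in X <-> _](turnK x) pmulr_rge0// -[X in _ < X]mulr1.
    by rewrite ltr_pM2l.
  apply/seteqP; split => x.
    move=> [/arcE xa /inT x1].
    have [u0|u0] := ltP (turn x) 0.
      left; apply/inA; move: xa.
      rewrite /phase (_ : Num.floor (turn x) = -1); last by apply/eqP; rewrite floor_eq intrN mulr1z; lra.
      rewrite intrN mulr1z ge_max -andbA /a; lra.
    right; apply/inB; move: xa.
    rewrite /phase (_ : Num.floor (turn x) = 0); last by apply/eqP; rewrite floor_eq mulr0z add0r mulr1z; lra.
    rewrite mulr0z subr0 lt_min /a; lra.
  move=> [/inA|/inB] h; split; try (apply/inT); try (apply/arcE); move: h; rewrite ?ge_max ?lt_min /a.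
  - rewrite /phase => h; rewrite (_ : Num.floor (turn x) = -1).
      by rewrite intrN mulr1z; lra.
    by apply/eqP; rewrite floor_eq intrN mulr1z; lra.
  - lra.
  - rewrite /phase => h; rewrite (_ : Num.floor (turn x) = 0).
      by rewrite mulr0z; lra.
    by apply/eqP; rewrite floor_eq mulr0z add0r mulr1z; lra.
  - lra.
rewrite -[LHS]/(lebesgue_measure (arc n m `&` `[0, pi2[%classic)) AB measureU; last 3 first.
- exact: measurable_itv.
- exact: measurable_itv.
- rewrite -subset0 => x []; rewrite /A /B /= !in_itv /= => /andP[_ h1] /andP[h2 _].
  by have := le_lt_trans h2 h1; rewrite ltr_pM2l// ltNge => /negP; apply; rewrite /a; lra.
transitivity (lebesgue_measure A + lebesgue_measure B)%E => //.
rewrite /A /B !lebesgue_measure_itv /= !lte_fin !ltr_pM2l// /len.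
have c4 : a - 1 < a + w - 1 by lra.
have c6 : a < a + w by lra.
rewrite -/w gt_max lt_min c4 c6 !andbT subr_gt0 [Num.max _ _]maxElt subr_gt0 [Num.min _ _]minElt.
case: (ltP 1 (a + w)) => c2; case: (ltP a 1) => c5; rewrite ?(lt_geF c5) ?(le_gtF c5).
- by rewrite (le_gtF (ltW c5)) -EFinD; congr (_%:E); ring.
- case: (ltP 1 a) => c1; rewrite ?adde0 -?EFinD; congr (_%:E); first by ring.
  by have -> : a = 1 by [lra]; ring.
- by rewrite add0e -EFinD; congr (_%:E); ring.
- by exfalso; lra.
Qed.


Lemma len_gt0 n : 0 < len n.
Proof. by rewrite divr_gt0 ?pi2_gt0 ?exprn_gt0. Qed.

Lemma lenS n : len n = 2 * len n.+1.
Proof. by rewrite /len exprS invfM mulrCA mulVKf. Qed.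

(** A class closed under the operations below, in which integrability is automatic, the measure
    being finite. *)
Definition bndm (f : R -> R) : Prop :=
  measurable_fun setT (f : measurableTypeR R -> measurableTypeR R) /\
  exists K, forall x, `|f x| <= K.

Definition Rint (f : R -> R) : R := \int[mu]_x f x.

Lemma mu_setT : mu setT = pi2%:E.
Proof.
have := @mu_arc 0 0 isT; rewrite /len expr0 divr1 => <-; congr (mu _).
apply/seteqP; split=> x //= _; have := idx_lt 0 x; by rewrite ltnS leqn0 => /eqP.
Qed.

Lemma bndm_integrable f : bndm f -> mu.-integrable setT (EFin \o f).
Proof.
move=> [mf [K hK]]; apply: measurable_bounded_integrable => //.
- by rewrite /= [X in (X < _)%E]mu_setT ltry.
- by exists K; split; [exact: num_real|move=> M KM x _; exact: le_trans (hK x) (ltW KM)].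
Qed.

Lemma bndm_cst c : bndm (fun=> c).
Proof. by split; [exact: measurable_cst|exists `|c|]. Qed.

Lemma bndmD f g : bndm f -> bndm g -> bndm (fun x => f x + g x).
Proof.
move=> [mf [K hK]] [mg [L hL]]; split; first exact: measurable_funD.
by exists (K + L) => x; rewrite (le_trans (ler_normD _ _))// lerD.
Qed.

Lemma bndmM f g : bndm f -> bndm g -> bndm (fun x => f x * g x).
Proof.
move=> [mf [K hK]] [mg [L hL]]; split; first exact: measurable_funM.
by exists (K * L) => x; rewrite normrM ler_pM.
Qed.

Lemma bndmZ c f : bndm f -> bndm (fun x => c * f x).
Proof. by move=> bf; apply: bndmM => //; exact: bndm_cst. Qed.

Lemma bndmN f : bndm f -> bndm (fun x => - f x).
Proof. by move=> /(bndmZ (-1)); under eq_fun do rewrite mulN1r. Qed.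

Lemma bndmB f g : bndm f -> bndm g -> bndm (fun x => f x - g x).
Proof. by move=> bf /bndmN; exact: bndmD. Qed.

Lemma bndm_indic A : measurable (A : set (measurableTypeR R)) -> bndm \1_A.
Proof.
move=> mA; split; first exact: measurable_indic.
by exists 1 => x; rewrite indicE; case: (x \in A); rewrite ?normr1 ?normr0.
Qed.

Lemma bndm_arc_indic n m : bndm \1_(arc n m).
Proof. apply: bndm_indic; exact: measurable_arc. Qed.

Lemma bndm_sum k (f : nat -> R -> R) : (forall i, bndm (f i)) -> bndm (fun x => \sum_(i < k) f i x).
Proof.
move=> bf; elim: k => [|k IH].
  by under eq_fun do rewrite big_ord0; exact: bndm_cst.
by under eq_fun do rewrite big_ord_recr /=; exact: bndmD.
Qed.

Lemma RintD f g : bndm f -> bndm g -> Rint (fun x => f x + g x) = Rint f + Rint g.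
Proof. by move=> bf bg; rewrite /Rint RintegralD//; exact: bndm_integrable. Qed.

Lemma RintZ c f : bndm f -> Rint (fun x => c * f x) = c * Rint f.
Proof. by move=> bf; rewrite /Rint RintegralZl//; exact: bndm_integrable. Qed.

Lemma RintB f g : bndm f -> bndm g -> Rint (fun x => f x - g x) = Rint f - Rint g.
Proof. by move=> bf bg; rewrite /Rint RintegralB//; exact: bndm_integrable. Qed.

Lemma Rint_sum k (f : nat -> R -> R) : (forall i, bndm (f i)) ->
  Rint (fun x => \sum_(i < k) f i x) = \sum_(i < k) Rint (f i).
Proof.
move=> bf; elim: k => [|k IH].
  rewrite big_ord0; under [X in Rint X]eq_fun do rewrite big_ord0.
  by rewrite /Rint Rintegral_cst// mul0r.
rewrite big_ord_recr /= -IH -RintD//; last exact: bndm_sum.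
by under [X in Rint X]eq_fun do rewrite big_ord_recr /=.
Qed.

Lemma le_Rint f g : bndm f -> bndm g -> (forall x, f x <= g x) -> Rint f <= Rint g.
Proof. by move=> bf bg fg; apply: le_Rintegral => //; exact: bndm_integrable. Qed.

Lemma bndm_norm f : bndm f -> bndm (fun x => `|f x|).
Proof.
move=> [mf [K hK]]; split; first by apply: measurableT_comp => //; exact: measurable_normr.
by exists K => x; rewrite normr_id.
Qed.

Lemma le_norm_Rint f g : bndm f -> bndm g -> (forall x, `|f x| <= g x) -> `|Rint f| <= Rint g.
Proof.
move=> bf bg fg; apply: le_trans (le_Rint (bndm_norm bf) bg fg).
by apply: le_normr_Rintegral => //; exact: bndm_integrable.
Qed.

Lemma stepE n (g : nat -> R) x : g (idx n x) = \sum_(m < 2 ^ n) g m * \1_(arc n m) x.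
Proof.
rewrite (bigD1 (Ordinal (idx_lt n x)))//= big1 => [|i ine].
  by rewrite addr0 indicE mem_set ?mulr1.
rewrite indicE memNset ?mulr0// /arc /= => E; move: ine; rewrite -val_eqE /= E.
by rewrite eqxx.
Qed.

Lemma bndm_step n (g : nat -> R) : bndm (fun x => g (idx n x)).
Proof.
under eq_fun do rewrite stepE.
apply: (@bndm_sum (2 ^ n) (fun m x => g m * \1_(arc n m) x)) => m.
exact/bndmZ/bndm_arc_indic.
Qed.

Definition mass f n m := Rint (fun x => f x * \1_(arc n m) x).

Lemma bndm_arc f n m : bndm f -> bndm (fun x => f x * \1_(arc n m) x).
Proof. by move=> bf; apply: bndmM => //; exact: bndm_arc_indic. Qed.

Lemma Rint_step f n g : bndm f ->
  Rint (fun x => f x * g (idx n x)) = \sum_(m < 2 ^ n) g m * mass f n m.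
Proof.
move=> bf; under [X in Rint X]eq_fun do rewrite stepE big_distrr /=.
have bm m := bndm_arc n m bf.
rewrite (@Rint_sum _ (fun m x => f x * (g m * \1_(arc n m) x))); last first.
  by move=> m; under eq_fun do rewrite mulrCA; exact: bndmZ.
apply: eq_bigr => m _; under [X in Rint X]eq_fun do rewrite mulrCA.
exact: RintZ.
Qed.

Lemma indic_arcS n m x : \1_(arc n m) x = \1_(arc n.+1 m.*2) x + \1_(arc n.+1 m.*2.+1) x :> R.
Proof.
have := idxS n x; have mem k j : (x \in arc k j) = (idx k x == j).
  by apply/idP/idP => [/set_mem/eqP//|/eqP ?]; rewrite mem_set.
rewrite !indicE !mem => <-; have := odd_double_half (idx n.+1 x).
set j := _./2 => <-; case: odd => /=; rewrite ?add0n ?add1n.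
  rewrite eqSS (_ : j.*2.+1 == m.*2 = false) ?add0r; last by apply/negbTE; lia.
  by rewrite (inj_eq double_inj).
rewrite (_ : j.*2 == m.*2.+1 = false) ?addr0; last by apply/negbTE; lia.
by rewrite (inj_eq double_inj).
Qed.

Lemma massS f n m : bndm f -> mass f n m = mass f n.+1 m.*2 + mass f n.+1 m.*2.+1.
Proof.
move=> bf; rewrite /mass -RintD; [|exact: bndm_arc|exact: bndm_arc].
by congr Rint; apply/funext => x; rewrite indic_arcS mulrDr.
Qed.

Lemma Rint_indic n m : (m < 2 ^ n)%N -> Rint \1_(arc n m) = len n.
Proof.
move=> mn; rewrite /Rint /Rintegral integral_indic ?setIT//; last exact: measurable_arc.
by rewrite [X in fine X]mu_arc.
Qed.

Lemma norm_Rint_arc f n m K : bndm f -> (m < 2 ^ n)%N -> (forall x, `|f x| <= K * \1_(arc n m) x) ->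
  `|Rint f| <= K * len n.
Proof.
move=> bf mn fK; rewrite -(Rint_indic mn) -RintZ; last exact: bndm_arc_indic.
apply: le_norm_Rint => //; exact/bndmZ/bndm_arc_indic.
Qed.

Lemma Rint_cst c : Rint (fun=> c) = c * pi2.
Proof. by rewrite /Rint Rintegral_cst//= [X in fine X]mu_setT. Qed.

Lemma Rint_mean n g : Rint (fun x => g (idx n x)) = pi2 * mean n g.
Proof.
have := Rint_step n g (bndm_cst 1); under [X in Rint X]eq_fun do rewrite mul1r.
move=> ->; rewrite /mean mulrA -/(len n) big_distrr /=; apply: eq_bigr => m _.
rewrite mulrC -(Rint_indic (ltn_ord m)); congr (_ * _).
by rewrite /mass; under [X in Rint X]eq_fun do rewrite mul1r.
Qed.

Definition avg f n m := mass f n m / len n.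

(* dif f n m = |J|^(-1/2) <f, h_J> for the arc J of generation n, position m. *)
Definition dif f n m := (avg f n.+1 m.*2 - avg f n.+1 m.*2.+1) / 2.

Lemma avgS f n m : bndm f -> avg f n m = (avg f n.+1 m.*2 + avg f n.+1 m.*2.+1) / 2.
Proof.
move=> bf; rewrite /avg massS// (lenS n); have := len_gt0 n.+1 => l0.
by field; rewrite gt_eqF.
Qed.

Lemma Rint_step_avg f n g : bndm f ->
  Rint (fun x => f x * g (idx n x)) = pi2 * mean n (fun m => g m * avg f n m).
Proof.
move=> bf; rewrite Rint_step// /mean mulrA -/(len n) big_distrr /=; apply: eq_bigr => m _.
by rewrite /avg; field; rewrite gt_eqF ?len_gt0.
Qed.

(** Parseval's identity up to generation [N], polarised: over two siblings the mean of the products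
    is the product of the means plus the product of the half-differences. *)
Lemma mean_avgM f g N : bndm f -> bndm g ->
  mean N (fun m => avg f N m * avg g N m) =
  avg f 0 0 * avg g 0 0 + \sum_(n < N) mean n (fun m => dif f n m * dif g n m).
Proof.
move=> bf bg; elim: N => [|N IH]; first by rewrite mean0 big_ord0 addr0.
rewrite big_ord_recr /= addrA -IH -meanD meanS; apply: eq_mean => m _.
by rewrite /dif (avgS N m bf) (avgS N m bg); field.
Qed.

End Torus.

(** * Series of atoms *)

Section Sequences.
Variable R : realType.
Implicit Types (u v : nat -> R).

Lemma cvgnP u (l : R) : u @ \oo --> l <->
  forall e, 0 < e -> exists N, forall n, (N <= n)%N -> `|u n - l| <= e.
Proof.
rewrite cvgrPdistC_le; split => h e /h.
  by move=> [N _ hN]; exists N => n Nn; exact: hN.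
by move=> [N hN]; exists N => // n /=; exact: hN.
Qed.

Definition psum u (K : nat) : R := \sum_(k < K) u k.

Lemma psumE u : psum u = series u.
Proof. by apply/funext => K; rewrite /psum /series /= big_mkord. Qed.

Lemma psum_abs_cvg u (B : nat -> R) : (forall k, `|u k| <= B k) -> cvgn (psum B) -> cvgn (psum u).
Proof.
move=> uB; rewrite !psumE => cB; apply: normed_cvg; move: cB; apply: series_le_cvg => //.
- by move=> k; exact: normr_ge0.
- by move=> k; apply: le_trans (uB k); exact: normr_ge0.
Qed.

Lemma cvgn_sum (k : nat) (f : nat -> nat -> R) (l : nat -> R) :
  (forall i, (i < k)%N -> f i @ \oo --> l i) ->
  (fun n => \sum_(i < k) f i n) @ \oo --> \sum_(i < k) l i.
Proof.
elim: k => [|k IH] h.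
  by rewrite big_ord0; under eq_fun do rewrite big_ord0; exact: cvg_cst.
rewrite big_ord_recr /=; under eq_fun do rewrite big_ord_recr /=.
by apply: cvgD; [apply: IH => i ik; exact/h/leqW|exact: h].
Qed.

Lemma cvgn_mean k (f : nat -> nat -> R) (l : nat -> R) :
  (forall m, (m < 2 ^ k)%N -> f m @ \oo --> l m) ->
  (fun n => mean k (f ^~ n)) @ \oo --> mean k l.
Proof. by move=> h; apply: cvgMr; exact: cvgn_sum. Qed.

Lemma psum_tail u (B : nat -> R) (U : R) : (forall k, `|u k| <= B k) -> cvgn (psum B) ->
  psum u @ \oo --> U -> forall K, `|U - psum u K| <= limn (psum B) - psum B K.
Proof.
move=> uB cB cU K.
have h : (fun n => `|psum u n - psum u K|) @ \oo --> `|U - psum u K|.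
  by apply: cvg_norm; apply: cvgB => //; exact: cvg_cst.
have h2 : (fun n => psum B n - psum B K) @ \oo --> limn (psum B) - psum B K.
  by apply: cvgB => //; exact: cvg_cst.
apply: (ler_cvg_to h h2); exists K => // n /= Kn.
have cat w : psum w n - psum w K = \sum_(K <= i < n) w i.
  by rewrite /psum -!(big_mkord xpredT) (big_cat_nat (n := K) (p := n))//= addrAC subrr add0r.
rewrite !cat.
by apply: le_trans (ler_norm_sum _ _ _) _; exact: ler_sum.
Qed.

Lemma tannery (t : nat -> nat -> R) (tl B T : nat -> R) (L : R) :
  (forall k N, `|t k N| <= B k) -> cvgn (psum B) ->
  (forall k, t k @ \oo --> tl k) ->
  (forall N, psum (t ^~ N) @ \oo --> T N) ->
  psum tl @ \oo --> L -> T @ \oo --> L.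
Proof.
move=> tB cB ct cT cL.
have tlB k : `|tl k| <= B k.
  by apply: (ler_cvg_to (cvg_norm (ct k)) (cvg_cst (B k))); exists 0%N => // n _; exact: tB.
apply/cvgnP => e e0.
have [K hK] : exists K, limn (psum B) - psum B K <= e / 4.
  have /cvgnP /(_ (e / 4)) [|K hK] := cB; first by rewrite divr_gt0.
  by exists K; have := hK K (leqnn _); rewrite distrC; apply: le_trans; exact: ler_norm.
have : (fun N => psum (t ^~ N) K) @ \oo --> psum tl K by apply: cvgn_sum => i _; exact: ct.
move=> /cvgnP /(_ (e / 4)) [|N0 hN0]; first by rewrite divr_gt0.
exists N0 => N /hN0 h.
have h1 := psum_tail (fun k => tB k N) cB (cT N) K.
have h2 := psum_tail tlB cB cL K.
move: h h1 h2; rewrite !ler_norml; lra.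
Qed.

End Sequences.

(** * Minkowski's inequality for truncated square functions *)

Section Minkowski.
Variable R : realType.

Lemma minkowski2 (a b c d : R) :
  Num.sqrt ((a + c) ^+ 2 + (b + d) ^+ 2) <= Num.sqrt (a ^+ 2 + b ^+ 2) + Num.sqrt (c ^+ 2 + d ^+ 2).
Proof. exact: (le_normcD (Complex a b) (Complex c d)). Qed.

Lemma minkowski_seq (I : Type) (r : seq I) (x y : I -> R) :
  Num.sqrt (\sum_(i <- r) (x i + y i) ^+ 2) <=
  Num.sqrt (\sum_(i <- r) x i ^+ 2) + Num.sqrt (\sum_(i <- r) y i ^+ 2).
Proof.
elim: r => [|i r IH]; first by rewrite !big_nil sqrtr0 addr0.
have s0 (z : I -> R) : 0 <= \sum_(i <- r) z i ^+ 2 by apply: sumr_ge0 => *; exact: sqr_ge0.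
rewrite !big_cons -(sqr_sqrtr (s0 x)) -(sqr_sqrtr (s0 y)).
apply: le_trans (minkowski2 _ _ _ _).
rewrite ler_wsqrtr// lerD2l -[leLHS](sqr_sqrtr (s0 (fun i => x i + y i))).
by rewrite ler_pXn2r ?nnegrE ?addr_ge0 ?sqrtr_ge0.
Qed.

Lemma sqrt_sum_le (I : Type) (r : seq I) (x : I -> R) :
  Num.sqrt (\sum_(i <- r) x i ^+ 2) <= \sum_(i <- r) `|x i|.
Proof.
elim: r => [|i r IH]; first by rewrite !big_nil sqrtr0.
have s0 (z : I -> R) : 0 <= \sum_(i <- r) z i ^+ 2 by apply: sumr_ge0 => *; exact: sqr_ge0.
rewrite !big_cons -(sqr_sqrtr (s0 x)).
have := minkowski2 (x i) 0 0 (Num.sqrt (\sum_(i <- r) x i ^+ 2)).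
rewrite addr0 add0r => /le_trans; apply.
by rewrite expr0n /= addr0 add0r !sqrtr_sqr lerD2l ger0_norm ?sqrtr_ge0.
Qed.

Definition sqf (d : nat -> nat -> R) N m := Num.sqrt (path_sum (fun n m => d n m ^+ 2) 0 N m).

Lemma sqf_ge0 d N m : 0 <= sqf d N m.
Proof. exact: sqrtr_ge0. Qed.

Lemma sqfD d d' N m : sqf (fun n m => d n m + d' n m) N m <= sqf d N m + sqf d' N m.
Proof. exact: minkowski_seq. Qed.

Lemma sqf_sum K (d : nat -> nat -> nat -> R) N m :
  sqf (fun n m => \sum_(k < K) d k n m) N m <= \sum_(k < K) sqf (d k) N m.
Proof.
elim: K => [|K IH].
  rewrite big_ord0 /sqf /path_sum big1 ?sqrtr0// => i _; by rewrite big_ord0 expr0n.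
rewrite big_ord_recr /=; apply: le_trans (lerD IH (lexx _)); apply: le_trans (sqfD _ _ _ _).
by rewrite /sqf /path_sum; under eq_bigr do rewrite big_ord_recr /=.
Qed.

Lemma sqf_le_sum d N m : sqf d N m <= path_sum (fun n m => `|d n m|) 0 N m.
Proof. exact: sqrt_sum_le. Qed.

End Minkowski.

(** * Haar coefficients and square function of one atom *)

Section Atom.
Variables (R : realType) (delta : R).
Hypothesis hdelta : 0 <= delta < 1.
Notation idx := (idx delta).
Notation arc := (arc delta).
Notation avg := (avg delta).
Notation dif := (dif delta).
Notation mass := (mass delta).

(** The real or imaginary part of a multiple of an atom, with a bound that holds at every point and
    not just almost everywhere. *)
Definition batom (n m : nat) (b : R) (beta : R -> R) : Prop :=
  [/\ (m < 2 ^ n)%N, bndm beta, (forall x, `|beta x| <= b * \1_(arc n m) x) & Rint beta = 0].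

Lemma indic_arc n m x : \1_(arc n m) x = (idx n x == m)%:R :> R.
Proof.
by rewrite indicE; congr ((nat_of_bool _)%:R); apply/idP/idP => [/set_mem/eqP//|/eqP ?]; rewrite mem_set.
Qed.

Section One.
Variables (n m : nat) (b : R) (beta : R -> R).
Hypothesis hb : batom n m b beta.

Lemma batom_bndm : bndm beta. Proof. by case: hb. Qed.

Lemma batom_ge0 : 0 <= b.
Proof.
case: hb => mn _ bb _.
have [x xE] : exists x, idx n x = m.
  apply: contrapT => ne; have := mu_arc hdelta mn.
  rewrite (_ : arc n m = set0) ?measure0.
    by move=> -[] /eqP; rewrite lt_eqF// len_gt0.
  by rewrite -subset0 => x xE; apply: ne; exists x.
by have := bb x; rewrite indic_arc xE eqxx mulr1; apply: le_trans; exact: normr_ge0.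
Qed.

Lemma mass_le n' m' : (m' < 2 ^ n')%N -> `|mass beta n' m'| <= b * len R n'.
Proof.
case: hb => _ bd bb _ mn'; apply: (norm_Rint_arc hdelta (bndm_arc delta n' m' bd) mn') => x.
rewrite normrM (ger0_norm (x := \1_ _ x)) ?indic_arc ?ler0n// ler_wpM2r ?ler0n//.
by apply: le_trans (bb x) _; rewrite indic_arc ler_piMr ?batom_ge0//; case: eqP.
Qed.

Lemma avg_le n' m' : (m' < 2 ^ n')%N -> `|avg beta n' m'| <= b.
Proof.
move=> /mass_le h; have l0 := len_gt0 R n'.
by rewrite /avg normrM normfV (gtr0_norm l0) ler_pdivrMr.
Qed.

Lemma batom_out x : idx n x != m -> beta x = 0.
Proof.
case: hb => _ _ bb _ xm; have := bb x; rewrite indic_arc (negbTE xm) mulr0 normr_le0.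
by move/eqP.
Qed.

Lemma avg_out n' m' : (n <= n')%N -> anc n' n m' != m -> avg beta n' m' = 0.
Proof.
move=> nn' am; rewrite /avg /mass (_ : (fun x => _) = fun=> 0) ?(Rint_cst hdelta) ?mul0r//.
apply/funext => x; rewrite indic_arc; case: eqP => [xE|]; last by rewrite mulr0.
by rewrite mulr1 batom_out// -(anc_idx delta x nn') xE.
Qed.

(** An arc of generation at most [n] either contains the arc of the atom, whose total mass is zero,
    or misses it. *)
Lemma avg_coarse n' m' : (n' <= n)%N -> avg beta n' m' = 0.
Proof.
move=> n'n; rewrite /avg /mass; have [am|am] := eqVneq (anc n n' m) m'.
  rewrite (_ : (fun x => _) = beta); first by case: hb => _ _ _ ->; rewrite mul0r.
  apply/funext => x; rewrite indic_arc; have [xm|/batom_out ->] := eqVneq (idx n x) m.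
    by rewrite -(anc_idx delta x n'n) xm am eqxx mulr1.
  by rewrite mul0r.
rewrite (_ : (fun x => _) = fun=> 0) ?(Rint_cst hdelta) ?mul0r//; apply/funext => x.
rewrite indic_arc; have [xm|/batom_out ->] := eqVneq (idx n x) m; last by rewrite mul0r.
by rewrite -(anc_idx delta x n'n) xm (negbTE am) mulr0.
Qed.

Lemma dif_coarse n' m' : (n' < n)%N -> dif beta n' m' = 0.
Proof. by move=> n'n; rewrite /dif !avg_coarse// subrr mul0r. Qed.

Lemma dif_out n' m' : (n <= n')%N -> anc n' n m' != m -> dif beta n' m' = 0.
Proof.
move=> nn' am; rewrite /dif !avg_out ?subrr ?mul0r//; try exact: leqW; rewrite ancS ?doubleK//.
by rewrite -[_.*2.+1./2]/(uphalf m'.*2) uphalf_double.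
Qed.

Lemma dif_le n' m' : (m' < 2 ^ n')%N -> `|dif beta n' m'| <= b.
Proof.
move=> mn'; rewrite /dif normrM [X in _ * X]ger0_norm// ler_pdivrMr//.
apply: le_trans (ler_normB _ _) _; rewrite mulrDr mulr1.
by rewrite lerD// avg_le// expnS; lia.
Qed.

Lemma mean_avg_sq N : mean N (fun m => avg beta N m ^+ 2) <= b ^+ 2 / 2 ^+ n.
Proof.
have b0 := batom_ge0.
have q0 : 0 <= b ^+ 2 / 2 ^+ n by rewrite divr_ge0 ?sqr_ge0 ?exprn_ge0.
have [Nn|nN] := leqP N n.
  rewrite (eq_mean (g := fun=> 0)); first by rewrite /mean big1 ?mulr0.
  by move=> i _; rewrite avg_coarse// expr0n.
apply: (@le_trans _ _ (mean N (fun m' => b ^+ 2 * (anc N n m' == m)%:R))).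
  apply: le_mean => m' mN; case: eqP => [_|/eqP am]; last by rewrite avg_out ?(ltnW nN)// expr0n mulr0.
  by rewrite mulr1 -real_normK ?num_real// ler_pXn2r ?nnegrE ?avg_le.
rewrite meanZ (mean_anc (fun m' => (m' == m)%:R) (ltnW nN)).
rewrite ler_wpM2l ?sqr_ge0// /mean -[leRHS]mulr1 ler_wpM2l ?invr_ge0 ?exprn_ge0//.
case: hb => mn _ _ _; rewrite (bigD1 (Ordinal mn))//= eqxx big1 ?addr0// => i.
by rewrite -val_eqE /= => /negbTE ->.
Qed.

(* Bessel's inequality for the Haar coefficients. *)
Lemma mean_sqf_sq N : mean N (fun m => sqf (dif beta) N m ^+ 2) <= b ^+ 2 / 2 ^+ n.
Proof.
apply: le_trans (mean_avg_sq N).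
rewrite (eq_mean (g := path_sum (fun n m => dif beta n m ^+ 2) 0 N)); last first.
  by move=> i _; rewrite sqr_sqrtr// path_sum_ge0// => *; exact: sqr_ge0.
rewrite mean_path_sum big_mkord; under [leRHS]eq_mean do rewrite expr2.
by rewrite (mean_avgM hdelta N batom_bndm batom_bndm) -expr2 lerDr sqr_ge0.
Qed.

Lemma sqf_out N m' : (N <= n)%N || (anc N n m' != m) -> sqf (dif beta) N m' = 0.
Proof.
move=> h; rewrite /sqf /path_sum big_nat big1 ?sqrtr0// => k /= kN.
have [kn|nk] := ltnP k n; first by rewrite dif_coarse// expr0n.
have nN : (n < N)%N by exact: leq_ltn_trans kN.
move: h; rewrite leqNgt nN /= => h.
by rewrite dif_out ?expr0n// anc_trans// nk ltnW.
Qed.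

(** [moderate_quad] at level [b], on the arc of the atom: the constant term contributes
    [P b / 2 ^+ n] and the quadratic one, by Bessel's inequality, no more. Hence the factor [2]. *)
Lemma mean_P_sqf P N : moderate P -> mean N (fun m => P (sqf (dif beta) N m)) <= 2 * (P b / 2 ^+ n).
Proof.
move=> mP; have b0 := batom_ge0; have Pb := moderate_ge0 mP b0.
have q0 : 0 <= 2 * (P b / 2 ^+ n) by rewrite mulr_ge0// divr_ge0 ?exprn_ge0.
have [Nn|nN] := leqP N n.
  rewrite (eq_mean (g := fun=> 0)); first by rewrite /mean big1 ?mulr0.
  by move=> i _; rewrite sqf_out ?Nn// moderate0.
(* For [b = 0], where [moderate_quad] does not apply, Bessel's inequality makes the square function
   vanish at every node. *)
have [bz|bp] := eqVneq b 0.
  have := mean_sqf_sq N; rewrite bz expr0n mul0r /= => h.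
  rewrite (eq_mean (g := fun=> 0)); first by rewrite /mean big1 ?mulr0 ?moderate0 ?mul0r ?mulr0.
  move=> i iN; rewrite (_ : sqf _ _ _ = 0) ?moderate0//; apply/eqP.
  move: h; rewrite /mean pmulr_rle0 ?invr_gt0 ?exprn_gt0// => h.
  have /eqP := le_anti (introT andP (conj h (sumr_ge0 _ (fun (j : 'I_(2 ^ N)) _ => sqr_ge0 (sqf (dif beta) N j))))).
  by rewrite psumr_eq0 => [/allP /(_ (Ordinal iN))|*]; [rewrite mem_index_enum sqrf_eq0 => /(_ isT)|exact: sqr_ge0].
have bgt : 0 < b by rewrite lt_neqAle eq_sym bp.
apply: (@le_trans _ _ (mean N (fun m' => P b * (anc N n m' == m)%:R + P b / b ^+ 2 * sqf (dif beta) N m' ^+ 2))).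
  apply: le_mean => m' _; case: eqP => [_|/eqP am].
    by apply: le_trans (moderate_quad mP (sqf_ge0 _ _ _) bgt) _; rewrite mulr1 mulrDr mulr1 mulrA mulrAC.
  by rewrite sqf_out ?am ?orbT// moderate0// expr0n !mulr0 addr0.
rewrite meanD !meanZ (mean_anc (fun m' => (m' == m)%:R) (ltnW nN)).
have -> : mean n (fun m' => (m' == m)%:R) = (2 ^+ n)^-1 :> R.
  case: hb => mn _ _ _; rewrite /mean (bigD1 (Ordinal mn))//= eqxx big1 ?addr0 ?mulr1// => i.
  by rewrite -val_eqE /= => /negbTE ->.
have := ler_wpM2l (_ : 0 <= P b / b ^+ 2) (mean_sqf_sq N); rewrite divr_ge0 ?sqr_ge0// => /(_ isT).
rewrite [X in _ <= X -> _](_ : _ = P b / 2 ^+ n); first lra.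
by field; rewrite gt_eqF ?exprn_gt0.
Qed.

End One.
End Atom.

(** * Pairing atomic series with dyadically Lipschitz functions *)

Section Pairing.
Variables (R : realType) (delta : R).
Hypothesis hdelta : 0 <= delta < 1.
Notation idx := (idx delta).
Notation arc := (arc delta).
Notation avg := (avg delta).
Notation dif := (dif delta).
Notation len := (len R).
Notation pi2 := (pi *+ 2 : R).

Lemma len_ge0 n : 0 <= len n.
Proof. exact/ltW/len_gt0. Qed.

(** What is used of a test function: a bound on its oscillation over an arc by a multiple of the
    length. Smooth periodic functions have it by [tame_smooth]. *)
Definition tame (M : R) (phi : R -> R) : Prop :=
  [/\ bndm phi, 0 <= M &
  forall k x y, idx k x = idx k y -> `|phi x - phi y| <= M * len k].

Lemma tame_avg M phi N x : tame M phi -> `|phi x - avg phi N (idx N x)| <= M * len N.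
Proof.
move=> [bp M0 lp]; have l0 := len_gt0 R N; set m := idx N x.
have mN : (m < 2 ^ N)%N := idx_lt delta N x.
have -> : phi x - avg phi N m = Rint (fun y => (phi x - phi y) * \1_(arc N m) y) / len N.
  rewrite (_ : (fun y => _) = fun y => phi x * \1_(arc N m) y - phi y * \1_(arc N m) y); last first.
    by apply/funext => y; rewrite mulrBl.
  rewrite (RintB hdelta); [|exact/bndmZ/bndm_arc_indic|exact: bndm_arc].
  rewrite (RintZ hdelta); last exact: bndm_arc_indic.
  by rewrite Rint_indic// mulrBl mulfK// gt_eqF.
rewrite normrM normfV (gtr0_norm l0) ler_pdivrMr//.
apply: (norm_Rint_arc hdelta _ mN) => [|y].
  by apply: bndm_arc; apply: bndmB => //; exact: bndm_cst.
rewrite normrM (ger0_norm (x := \1_ _ y)) ?indic_arc ?ler0n//.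
have [/esym/lp h|] := eqVneq (idx N y) m; first by rewrite !mulr1.
by rewrite !mulr0.
Qed.

Section One.
Variables (n m : nat) (b : R) (beta : R -> R) (M : R) (phi : R -> R).
Hypothesis hb : batom delta n m b beta.
Hypothesis hphi : tame M phi.

Definition haar_pair (phi beta : R -> R) N := pi2 * \sum_(n < N) mean n (fun m => dif beta n m * dif phi n m).

Lemma haar_pairE N : haar_pair phi beta N = Rint (fun x => beta x * avg phi N (idx N x)).
Proof.
case: hphi => bp _ _; have bb := batom_bndm hb.
rewrite (Rint_step_avg hdelta)// (_ : (fun m => _) = fun m => avg beta N m * avg phi N m); last first.
  by apply/funext => i; rewrite mulrC.
by rewrite (mean_avgM hdelta)// (avg_coarse hdelta hb)// mul0r add0r.
Qed.

(** Cancellation: as [beta] has mean zero, [g] may be replaced by [g - c]. *)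
Lemma batom_pair_le (g : R -> R) c K : bndm g -> 0 <= K ->
  (forall x, idx n x = m -> `|g x - c| <= K) ->
  `|Rint (fun x => beta x * g x)| <= b * K * len n.
Proof.
move=> bg K0 hg; have bb := batom_bndm hb; have b0 := batom_ge0 hdelta hb.
have [mn _ bd z] := hb.
have -> : Rint (fun x => beta x * g x) = Rint (fun x => beta x * (g x - c)).
  have -> : (fun x => beta x * (g x - c)) = (fun x => beta x * g x - c * beta x).
    by apply/funext => x; rewrite mulrBr (mulrC c).
  by rewrite (RintB hdelta) ?(RintZ hdelta)// ?z ?mulr0 ?subr0//; [exact: bndmM|exact: bndmZ].
apply: (norm_Rint_arc hdelta _ mn) => [|x].
  by apply: bndmM => //; apply: bndmB => //; exact: bndm_cst.
rewrite indic_arc normrM; have [xm|/(batom_out hb) ->] := eqVneq (idx n x) m.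
  rewrite mulr1 ler_pM// ?hg//.
  by have := bd x; rewrite indic_arc xm eqxx mulr1.
by rewrite normr0 mul0r mulr0.
Qed.

Lemma haar_pair_close N : `|Rint (fun x => beta x * phi x) - haar_pair phi beta N| <=
  b * (M * len N) * len n.
Proof.
case: (hphi) => bp M0 lp; have bb := batom_bndm hb.
have bs := bndm_step delta N (avg phi N).
rewrite haar_pairE -(RintB hdelta); [|exact: bndmM|exact: bndmM].
rewrite (_ : (fun x => _) = fun x => beta x * (phi x - avg phi N (idx N x))); last first.
  by apply/funext => x; rewrite mulrBr.
apply: (@batom_pair_le _ 0); first exact: bndmB.
  by rewrite mulr_ge0// ltW// len_gt0.
by move=> x _; rewrite subr0; exact: tame_avg.
Qed.

Lemma pair_le : `|Rint (fun x => beta x * phi x)| <= b * (M * len n) * len n.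
Proof.
case: (hphi) => bp M0 lp; have [mn _ _ _] := hb.
have [[x0 x0E]|ne] := pselect (exists x, idx n x = m).
  apply: (@batom_pair_le _ (phi x0)) => //; first by rewrite mulr_ge0// ltW// len_gt0.
  by move=> x xE; apply: lp; rewrite xE.
apply: (@batom_pair_le _ 0) => //; first by rewrite mulr_ge0// ltW// len_gt0.
by move=> x xE; exfalso; apply: ne; exists x.
Qed.

Lemma len_le N : (n <= N)%N -> len N <= len n.
Proof.
by move=> nN; rewrite ler_wpM2l ?(ltW (pi2_gt0 R))// lef_pV2 ?posrE ?exprn_gt0// ler_weXn2l// ler1n.
Qed.

(** The bound is uniform in [N] and serves as the domination when the limit in [N] is exchanged with
    the sum over the atoms. *)
Lemma haar_pair_le N : `|haar_pair phi beta N| <= 2 * (b * (M * len n) * len n).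
Proof.
case: (hphi) => bp M0 lp; have b0 := batom_ge0 hdelta hb; have l0 := len_gt0 R n.
have q0 := mulr_ge0 (mulr_ge0 b0 (mulr_ge0 M0 (len_ge0 n))) (len_ge0 n).
have [Nn|nN] := leqP N n.
  rewrite /haar_pair big1 ?mulr0 ?normr0 => [|i _]; first by rewrite pmulr_rge0.
  rewrite /mean big1 ?mulr0// => j _.
  by rewrite (dif_coarse hdelta hb) ?mul0r// (leq_trans _ Nn).
have := haar_pair_close N; have := pair_le.
have : b * (M * len N) * len n <= b * (M * len n) * len n.
  by apply: ler_wpM2r; [exact: ltW|apply: ler_wpM2l => //; apply: ler_wpM2l => //; exact/len_le/ltnW].
rewrite !ler_norml; lra.
Qed.

Lemma haar_pair_cvg : haar_pair phi beta @ \oo --> Rint (fun x => beta x * phi x).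
Proof.
case: (hphi) => bp M0 lp; have b0 := batom_ge0 hdelta hb; have l0 := len_gt0 R n.
have h : (fun N => b * (M * (pi2 * (2^-1) ^+ N)) * len n) @ \oo --> (0 : R).
  rewrite -[X in _ --> X](mul0r (len n)); apply: cvgMl; rewrite -(mulr0 b); apply: cvgMr.
  rewrite -[X in _ --> X](mulr0 M); apply: cvgMr; rewrite -[X in _ --> X](mulr0 pi2); apply: cvgMr.
  by apply: cvg_expr; rewrite ger0_norm ?invf_lt1// ltr1n.
apply/cvgnP => e e0; have /cvgnP /(_ e e0) [N0 hN0] := h.
exists N0 => N /hN0; rewrite subr0 => hN.
rewrite distrC; apply: le_trans (haar_pair_close N) _; rewrite /len -exprVn.
apply: le_trans hN; exact: ler_norm.
Qed.

End One.

(* sum |I_k| Psi0(b_k) < oo forces log(e + b_k) = O(n_k + 1), so that it controls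
   the sum of these weights, in which no logarithm of b_k occurs. *)
Definition weight (b : R) (n : nat) : R := b / 2 ^+ n / n.+1%:R.

Lemma weight_len b n : 0 <= b -> b * len n * len n <= pi2 ^+ 2 * weight b n.
Proof.
move=> b0; rewrite /weight /len; have p := pi2_gt0 R.
have e0 : 0 < 2 ^+ n :> R by rewrite exprn_gt0.
rewrite [leLHS](_ : _ = pi2 ^+ 2 * (b / 2 ^+ n / 2 ^+ n)); last by field; rewrite gt_eqF.
rewrite ler_wpM2l ?sqr_ge0// ler_wpM2l ?divr_ge0 ?(ltW e0)//.
by rewrite lef_pV2 ?posrE// -natrX ler_nat ltn_expl.
Qed.

Lemma weight_ge0 b n : 0 <= b -> 0 <= weight b n.
Proof. by move=> b0; rewrite !divr_ge0// exprn_ge0. Qed.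

(** Only atoms with [n <= k] have coefficients at generation [k], and this makes the series of these
    coefficients converge absolutely although the sum of [b |I|] over all atoms may diverge. *)
Lemma weight_coarse b n k : 0 <= b -> (n <= k)%N -> b <= 2 ^+ k * k.+1%:R * weight b n.
Proof.
move=> b0 nk; rewrite /weight; have e0 : 0 < 2 ^+ n :> R by rewrite exprn_gt0.
rewrite [leRHS](_ : _ = b * (2 ^+ k * k.+1%:R) / (2 ^+ n * n.+1%:R)); last first.
  by field; rewrite !gt_eqF// ltr0n.
rewrite ler_pdivlMr ?mulr_gt0// ler_wpM2l// ler_pM ?exprn_ge0// ?ler_nat//.
by rewrite ler_weXn2l// ler1n.
Qed.

Lemma weight_Psi0 (M : R) b n : 0 <= b -> 0 <= M -> Psi0 b <= M * 2 ^+ n ->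
  weight b n <= 2 * (expR 1 + 2 * M) * (Psi0 b / 2 ^+ n).
Proof.
move=> b0 M0 h; have e0 : 0 < 2 ^+ n :> R by rewrite exprn_gt0.
have l1 := ge1_ln_e b0; have l0 : 0 < ln (expR 1 + b) by exact: lt_le_trans l1.
have -> : weight b n = b / ln (expR 1 + b) / 2 ^+ n * (ln (expR 1 + b) / n.+1%:R).
  by rewrite /weight; field; rewrite !gt_eqF// addrC natr1.
rewrite mulrC ler_wpM2r ?divr_ge0 ?(ltW e0) ?(ltW l0)//.
by rewrite ler_pdivrMr//; exact: ln_e_le_Psi0.
Qed.

Lemma weight_summable (nk : nat -> nat) (bk : nat -> R) : (forall k, 0 <= bk k) ->
  cvgn (psum (fun k => Psi0 (bk k) / 2 ^+ nk k)) ->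
  cvgn (psum (fun k => weight (bk k) (nk k))).
Proof.
move=> b0 cP; pose P k := Psi0 (bk k) / 2 ^+ nk k.
have P0 k : 0 <= P k by rewrite divr_ge0 ?exprn_ge0// (moderate_ge0 (Psi0_moderate R)).
have [M M0 hM] : exists2 M, 0 <= M & forall k, P k <= M.
  have nd : nondecreasing_seq (psum P).
    by apply/nondecreasing_seqP => k; rewrite /psum big_ord_recr /= lerDl.
  exists (limn (psum P)).
    by apply: le_trans (nondecreasing_cvgn_le nd cP 0%N); rewrite /psum big_ord0.
  move=> k; apply: le_trans (nondecreasing_cvgn_le nd cP k.+1).
  by rewrite /psum big_ord_recr /= lerDr sumr_ge0.
apply: (psum_abs_cvg (B := fun k => 2 * (expR 1 + 2 * M) * P k)); last first.
  have -> : psum (fun k => 2 * (expR 1 + 2 * M) * P k) = fun K => 2 * (expR 1 + 2 * M) * psum P K.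
    by apply/funext => K; rewrite /psum big_distrr.
  exact: is_cvgMr.
move=> k; rewrite ger0_norm ?weight_ge0//; apply: weight_Psi0 => //.
by rewrite -ler_pdivrMr ?exprn_gt0//; exact: hM.
Qed.

Section Seq.
Variables (nk mk : nat -> nat) (bk : nat -> R) (bt : nat -> R -> R).
Hypothesis hb : forall k, batom delta (nk k) (mk k) (bk k) (bt k).
Hypothesis hW : cvgn (psum (fun k => weight (bk k) (nk k))).

Definition coef n m := limn (psum (fun k => dif (bt k) n m)).

Let bk0 k : 0 <= bk k. Proof. exact: (batom_ge0 hdelta (hb k)). Qed.

Lemma cvg_psumZ (c : R) (u : nat -> R) : cvgn (psum u) -> cvgn (psum (fun k => c * u k)).
Proof.
move=> cu; have -> : psum (fun k => c * u k) = fun K => c * psum u K.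
  by apply/funext => K; rewrite /psum big_distrr.
exact: is_cvgMr.
Qed.

Lemma coef_cvg n m : (m < 2 ^ n)%N -> psum (fun k => dif (bt k) n m) @ \oo --> coef n m.
Proof.
move=> mn; apply: (psum_abs_cvg (B := fun k => 2 ^+ n * n.+1%:R * weight (bk k) (nk k))).
  move=> k; have [nkn|nkn] := leqP (nk k) n.
    exact: le_trans (dif_le hdelta (hb k) mn) (weight_coarse (bk0 k) nkn).
  by rewrite (dif_coarse hdelta (hb k))// normr0 !mulr_ge0 ?weight_ge0 ?exprn_ge0.
exact: cvg_psumZ.
Qed.

(** For each [K] the coefficients are those of the first [K] atoms, treated by Minkowski's
    inequality and subadditivity, plus a remainder. At the finitely many nodes of generation below
    [N] the remainder tends to [0] with [K], and the linear bound on [P] disposes of it. *)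
Lemma mean_P_coef (P : R -> R) (C Y : R) N : moderate P -> 0 <= C ->
  (forall t, 0 <= t -> P t <= C * t) ->
  (forall K, psum (fun k => P (bk k) / 2 ^+ nk k) K <= Y) ->
  mean N (fun m => P (sqf coef N m)) <= 2 * Y.
Proof.
move=> mP C0 PC hY.
pose dK K n m := psum (fun k => dif (bt k) n m) K.
pose err K := \sum_(n < N) mean n (fun m => `|coef n m - dK K n m|).
have errc : err @ \oo --> (0 : R).
  rewrite -[X in _ --> X](_ : \sum_(n < N) mean n (fun=> 0) = 0); last first.
    by rewrite big1// => n _; rewrite /mean big1 ?mulr0.
  apply: (cvgn_sum (f := fun n K => mean n (fun m => `|coef n m - dK K n m|))
    (l := fun n => mean n (fun=> 0))) => n _.
  apply: (cvgn_mean (f := fun m K => `|coef n m - dK K n m|)) => m mn.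
  rewrite -[X in _ --> X](@normr0 _ R) -(subrr (coef n m)).
  by apply: cvg_norm; apply: cvgB; [exact: cvg_cst|exact: coef_cvg].
have main K : mean N (fun m => P (sqf coef N m)) <= 2 * Y + C * err K.
  apply: (@le_trans _ _ (\sum_(k < K) mean N (fun m => P (sqf (dif (bt k)) N m)) + C * err K)).
    rewrite -(mean_sum N K (fun k m => P (sqf (dif (bt k)) N m))) /err -[in leRHS](big_mkord xpredT (fun n => mean n (fun m => `|coef n m - dK K n m|))).
    rewrite -(mean_path_sum (fun n m => `|coef n m - dK K n m|)) -meanZ -meanD; apply: le_mean => m _.
    have e0 : 0 <= path_sum (fun n m => `|coef n m - dK K n m|) 0 N m by exact: path_sum_ge0.
    have s0 : 0 <= \sum_(k < K) sqf (dif (bt k)) N m by apply: sumr_ge0 => *; exact: sqf_ge0.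
    apply: le_trans (lerD (moderate_sum mP K (f := fun k => sqf (dif (bt k)) N m) _) (PC _ e0)).
      apply: le_trans (moderate_add mP s0 e0); apply: (moderate_le mP); first exact: sqf_ge0.
      apply: le_trans (lerD (sqf_sum K (fun k => dif (bt k)) N m) (sqf_le_sum (fun n m => coef n m - dK K n m) N m)).
      apply: le_trans (sqfD _ _ _ _); rewrite le_eqVlt; apply/orP; left; apply/eqP.
      by congr sqf; apply/funext => n; apply/funext => i; rewrite addrC subrK.
    by move=> k; exact: sqf_ge0.
  rewrite lerD2r; have := hY K; rewrite /psum => h.
  apply: le_trans (_ : \sum_(k < K) 2 * (P (bk k) / 2 ^+ nk k) <= _); last by rewrite -big_distrr ler_wpM2l.
  by apply: ler_sum => k _; exact: (mean_P_sqf hdelta (hb k)).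
have h : (fun K => 2 * Y + C * err K) @ \oo --> 2 * Y.
  by rewrite -[X in _ --> X]addr0 -[X in _ + X](mulr0 C); apply: cvgD; [exact: cvg_cst|exact: cvgMr].
by apply: (ler_cvg_to (cvg_cst _) h); exists 0%N => // K _; exact: main.
Qed.

Variables (M : R) (phi : R -> R).
Hypothesis hphi : tame M phi.

Let B k := 2 * (M * pi2 ^+ 2) * weight (bk k) (nk k).

Let BE k : 2 * (bk k * (M * len (nk k)) * len (nk k)) <= B k.
Proof.
case: (hphi) => _ M0 _.
have := ler_wpM2l M0 (weight_len (nk k) (bk0 k)); rewrite /B; lra.
Qed.

Lemma pair_cvg : cvgn (psum (fun k => Rint (fun x => bt k x * phi x))).
Proof.
case: (hphi) => _ M0 _.
apply: (psum_abs_cvg (B := B)); last exact: cvg_psumZ.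
move=> k; apply: le_trans (BE k); apply: le_trans (pair_le (hb k) hphi) _.
have q0 := mulr_ge0 (mulr_ge0 (bk0 k) (mulr_ge0 M0 (len_ge0 (nk k)))) (len_ge0 (nk k)).
lra.
Qed.

(** Tannery's theorem, with the atoms as terms. For fixed [N] only finitely many coefficients occur,
    each the sum of a convergent series. *)
Lemma haar_cvg :
  (fun N => pi2 * \sum_(n < N) mean n (fun m => coef n m * dif phi n m)) @ \oo -->
  limn (psum (fun k => Rint (fun x => bt k x * phi x))).
Proof.
apply: (tannery (t := fun k => haar_pair phi (bt k)) (B := B) _ _ _ _ pair_cvg).
- by move=> k N; apply: le_trans (BE k); exact: (haar_pair_le (hb k) hphi).
- exact: cvg_psumZ.
- by move=> k; exact: (haar_pair_cvg (hb k) hphi).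
- move=> N; rewrite (_ : psum _ = fun K => pi2 * \sum_(n < N) mean n (fun m => psum (fun k => dif (bt k) n m) K * dif phi n m)).
    apply: cvgMr.
    apply: (cvgn_sum (f := fun n K => mean n (fun m => psum (fun k => dif (bt k) n m) K * dif phi n m))
      (l := fun n => mean n (fun m => coef n m * dif phi n m))) => n _.
    apply: (cvgn_mean (f := fun m K => psum (fun k => dif (bt k) n m) K * dif phi n m)) => m mn.
    by apply: cvgMl; exact: coef_cvg.
  apply/funext => K; rewrite /psum /haar_pair -big_distrr /= exchange_big /=; congr (_ * _).
  apply: eq_bigr => n _; rewrite -(mean_sum n K (fun k m => dif (bt k) n m * dif phi n m)).
  by apply: eq_mean => m _; rewrite big_distrl.
Qed.

End Seq.

End Pairing.

(** * Uniqueness of the coefficients *)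

Section Smooth.
Variable R : realType.
Implicit Types f g : R -> R.

(** Derivatives are exhibited rather than computed, so that products, inverses and affine
    substitutions go through by induction on [n]; [Ck_smooth] returns to iterated derivatives. *)
Fixpoint Ck n f : Prop :=
  if n is k.+1 then exists f' : R -> R, (forall x : R, is_derive x 1 f (f' x)) /\ Ck k f' else True.

Lemma is_derive_derive1 f f' : (forall x : R, is_derive x 1 f (f' x)) -> f^`()%classic = f'.
Proof. by move=> h; apply/funext => x; rewrite derive1E; have := h x => ?; rewrite derive_val. Qed.

Lemma Ck_smooth f : (forall n, Ck n f) -> smooth f.
Proof.
move=> h n; move: (h n.+1) => {h}; elim: n f => [|n IH] f [f' [df Cf']] x.
  by have := df x => ?.
by rewrite derive1Sn (is_derive_derive1 df); exact: IH.
Qed.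

Lemma CkS n f : Ck n.+1 f -> Ck n f.
Proof.
elim: n f => [//|n IH] f [f' [df Cf']]; exists f'; split => //; exact: IH.
Qed.

Lemma CkD n f g : Ck n f -> Ck n g -> Ck n (fun x => f x + g x).
Proof.
elim: n f g => [//|n IH] f g [f' [df Cf]] [g' [dg Cg]].
by exists (fun x => f' x + g' x); split; [move=> x; exact: is_deriveD|exact: IH].
Qed.

Lemma Ck_cst n c : Ck n (fun=> c).
Proof.
elim: n c => [//|n IH] c; exists (fun=> 0); split => // x; exact: is_derive_cst.
Qed.

Lemma CkM n f g : Ck n f -> Ck n g -> Ck n (fun x => f x * g x).
Proof.
elim: n f g => [//|n IH] f g Cf' Cg'; have [f' [df Cf]] := Cf'; have [g' [dg Cg]] := Cg'.
exists (fun x => f x * g' x + g x * f' x); split; first by move=> x; exact: is_deriveM.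
by apply: CkD; apply: IH => //; exact: CkS.
Qed.

Lemma Ck_inv n f : (forall x, f x != 0) -> Ck n f -> Ck n (fun x => (f x)^-1).
Proof.
move=> f0; elim: n => [//|n IH] Cf'; have [f' [df Cf]] := Cf'.
exists (fun x => (-1) * ((f x)^-1 * (f x)^-1) * f' x); split.
  move=> x; have dfx := df x; have dv : derivable f x 1 by [].
  apply: DeriveDef; first exact: derivableV.
  rewrite deriveV// derive_val mulN1r expr2 invfM /GRing.scale /=; ring.
have Ci := IH (CkS Cf').
apply: CkM => //; apply: CkM; [exact: Ck_cst|exact: CkM].
Qed.

Lemma Ck_affine n f a b : Ck n f -> Ck n (fun x => f (a * x + b)).
Proof.
elim: n f => [//|n IH] f [f' [df Cf]].
exists (fun x => f' (a * x + b) * a); split; last by apply: CkM; [exact: IH|exact: Ck_cst].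
move=> x; have d1 : is_derive x 1 (fun y : R => a * y + b) a.
  have h : is_derive x 1 (fun y : R => a * y) a.
    have := is_deriveZ a (is_derive_id x (1 : R)).
    by rewrite /GRing.scale /= mulr1.
  by have := is_deriveD h (is_derive_cst b x 1); rewrite addr0.
have h := df (a * x + b).
exact: (@is_derive1_comp R f (fun y => a * y + b) x _ _ h d1).
Qed.

(** The flat function [exp (-1/x)] divided by [x ^ k]. Derivatives of members of the family are
    combinations of members, so smoothness is one induction for all [k]. *)
Definition eflat (k : nat) (x : R) : R := if 0 < x then x^-1 ^+ k * expR (- x^-1) else 0.

(** The term of order [k + 2] of the exponential series at [1 / x] beats the factor [x ^ -k] by
    [x ^ 2]. *)
Lemma eflat_le k x : `|eflat k x| <= (k.+2)`!%:R * x ^+ 2.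
Proof.
rewrite /eflat; case: ifP => [x0|_]; last by rewrite normr0 mulr_ge0 ?sqr_ge0.
have y0 : 0 < x^-1 by rewrite invr_gt0.
rewrite ger0_norm; last by rewrite mulr_ge0 ?expR_ge0// exprn_ge0// ltW.
rewrite expRN -ler_pdivlMr ?invr_gt0 ?expR_gt0// invrK.
have h := expR_ge1Dxn k.+1 (ltW y0).
have f0 : 0 < (k.+2)`!%:R :> R by rewrite ltr0n fact_gt0.
rewrite mulrAC -mulrA; apply: (@le_trans _ _ ((k.+2)`!%:R * (x^-1 ^+ k.+2 / (k.+2)`!%:R * x ^+ 2))).
  rewrite le_eqVlt; apply/orP; left; apply/eqP.
  by rewrite -[k.+2 in RHS]addn2 exprD; field; rewrite !gt_eqF.
by rewrite ler_pM2l// mulrC mulrC ler_wpM2r ?sqr_ge0//; lra.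
Qed.

Lemma is_derive_eflat k (x : R) : is_derive x 1 (eflat k) (eflat k.+2 x - k%:R * eflat k.+1 x).
Proof.
have [x0|x0|x0] := ltgtP x 0.
- rewrite /eflat ltNge (ltW x0) /= mulr0 subr0.
  apply: (near_eq_is_derive _ (is_derive_cst 0 x 1)).
  near=> y; rewrite ltNge (_ : y <= 0)//; apply/ltW; near: y; exact: lt_nbhsl.
- have xn0 : x != 0 by rewrite gt_eqF.
  have dV : is_derive x 1 (fun y : R => y^-1) (- x^-1 ^+ 2).
    apply: DeriveDef; first exact: derivableV.
    rewrite (@deriveV R R (fun y : R => y) x 1 xn0)// derive_id exprVn; exact: mulr1.
  have dX : is_derive x 1 (fun y : R => y^-1 ^+ k) (k%:R * x^-1 ^+ k.-1 * - x^-1 ^+ 2).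
    have := is_deriveX k dV; congr (is_derive _ _ _ _).
    by apply/funext => y; rewrite exprfctE.
  have dN : is_derive x 1 (fun y : R => - y^-1) (x^-1 ^+ 2).
    by have := is_deriveN dV; rewrite opprK.
  have dE : is_derive x 1 (fun y : R => expR (- y^-1)) (expR (- x^-1) * x^-1 ^+ 2).
    exact: (@is_derive1_comp R expR (fun y : R => - y^-1) x _ _ (is_derive_expR (- x^-1)) dN).
  have dM := is_deriveM dX dE.
  apply: is_derive_eq (near_eq_is_derive _ dM) _.
    near=> y; rewrite /eflat (_ : 0 < y)//; near: y; exact: lt_nbhsr.
  rewrite /eflat x0 /GRing.scale /=; case: k {dX dM} => [|k] /=; first by ring.
  by rewrite !exprS; ring.
- subst x; have e0 j : eflat j 0 = 0 by rewrite /eflat ltxx.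
  rewrite !e0 mulr0 subr0.
  (* The quadratic bound of [eflat_le] makes the difference quotient at [0] of linear size. *)
  have hlim : (fun h : R => h^-1 *: (eflat k (h *: 1 + 0) - eflat k 0)) @ 0^' --> (0 : R).
    apply: (@cvg_to_0_linear _ _ (k.+2)`!%:R 1) => // r /andP[r0 _].
    rewrite e0 subr0 addr0 [r *: 1]mulr1 normrM normfV ler_pdivrMl//.
    by apply: le_trans (eflat_le k r) _; rewrite -real_normK ?num_real// expr2; nra.
  apply: DeriveDef; first exact/cvgP/hlim.
  exact: (cvg_lim _ hlim).
Unshelve. all: by end_near. Qed.

Lemma Ck_eflat n k : Ck n (eflat k).
Proof.
elim: n k => [//|n IH] k; exists (fun x => eflat k.+2 x - k%:R * eflat k.+1 x); split.
  exact: is_derive_eflat.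
have -> : (fun x => eflat k.+2 x - k%:R * eflat k.+1 x) = (fun x => eflat k.+2 x + (- k%:R) * eflat k.+1 x).
  by apply/funext => x; rewrite mulNr.
by apply: CkD => //; apply: CkM => //; exact: Ck_cst.
Qed.

Definition step (x : R) : R := eflat 0 x / (eflat 0 x + eflat 0 (1 - x)).

Lemma eflat_ge0 x : 0 <= eflat 0 x.
Proof. by rewrite /eflat expr0 mul1r; case: ifP => // _; exact: expR_ge0. Qed.

Lemma eflat_gt0 x : 0 < x -> 0 < eflat 0 x.
Proof. by move=> x0; rewrite /eflat x0 expr0 mul1r expR_gt0. Qed.

Lemma step_den x : 0 < eflat 0 x + eflat 0 (1 - x).
Proof.
have [x0|x0] := leP x 0; first by rewrite ltr_wpDl ?eflat_ge0// eflat_gt0//; lra.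
by rewrite ltr_pwDl ?eflat_ge0// eflat_gt0.
Qed.

Lemma Ck_step n : Ck n step.
Proof.
have C1 : Ck n (fun x => eflat 0 (1 - x)).
  have := Ck_affine (-1) 1 (Ck_eflat n 0); congr Ck; apply/funext => x; congr eflat; ring.
apply: CkM; first exact: Ck_eflat.
apply: Ck_inv; first by move=> x; rewrite gt_eqF// step_den.
by apply: CkD => //; exact: Ck_eflat.
Qed.

Lemma step_itv x : 0 <= step x <= 1.
Proof.
have := step_den x; have := eflat_ge0 x; have := eflat_ge0 (1 - x); rewrite /step => a b c.
by rewrite divr_ge0 ?(ltW c)//= ler_pdivrMr// mul1r lerDl.
Qed.

Lemma step0 x : x <= 0 -> step x = 0.
Proof. by move=> x0; rewrite /step {1}/eflat ltNge x0 mul0r. Qed.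

Lemma step1 x : 1 <= x -> step x = 1.
Proof.
move=> x1; rewrite /step (_ : eflat 0 (1 - x) = 0).
  by rewrite addr0 divff// gt_eqF// eflat_gt0//; lra.
by rewrite /eflat (_ : 0 < 1 - x = false)//; apply/negbTE; rewrite -leNgt; lra.
Qed.

Lemma smooth_lipschitz f a b : smooth f -> a <= b ->
  exists2 M, 0 <= M & forall x y, a <= x <= b -> a <= y <= b -> `|f x - f y| <= M * `|x - y|.
Proof.
move=> sf ab.
have df (x : R) : is_derive x 1 f (f^`()%classic x) by rewrite derive1E; apply: DeriveDef => //; exact: (sf 0%N).
have cf1 : {within `[a, b], continuous (fun x => `|f^`()%classic x|)}.
  apply: continuous_subspaceT => x; apply: continuous_comp; last exact: norm_continuous.
  exact/differentiable_continuous/derivable1_diffP/(sf 1%N).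
have cf : continuous f by move=> x; exact/differentiable_continuous/derivable1_diffP/(sf 0%N).
have [c cab hc] := EVT_max ab cf1.
exists `|f^`()%classic c| => // x y.
wlog xy : x y / x <= y.
  move=> h hx hy; have [xy|/ltW yx] := leP x y; first exact: h.
  by rewrite distrC (distrC x); exact: h.
move=> /andP[ax xb] /andP[ay yb].
have [d /[!in_itv] /andP[xd dy] dE] := MVT_segment xy (fun z _ => df z) (continuous_subspaceT cf).
rewrite distrC dE normrM (distrC x) ler_wpM2r//; apply: hc.
by rewrite in_itv /= (le_trans ax xd) (le_trans dy yb).
Qed.

(** [step] is constant on either side of [[0, 1]], so clamping the arguments reduces the claim to
    this compact interval. *)
Lemma step_lipschitz : exists2 M, 0 <= M & forall x y, `|step x - step y| <= M * `|x - y|.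
Proof.
have [M M0 hM] := smooth_lipschitz (Ck_smooth Ck_step) ler01.
exists M => // x y; pose cl (z : R) := Num.max 0 (Num.min z 1).
have clE z : step (cl z) = step z.
  rewrite /cl; have [z1|/ltW z1] := leP z 1; last by rewrite max_r// !step1.
  by have [//|z0] := leP 0 z; rewrite !step0// ltW.
have cl01 z : 0 <= cl z <= 1.
  by rewrite /cl le_max lexx /= ge_max ler01 ge_min lexx orbT.
rewrite -(clE x) -(clE y); apply: le_trans (hM _ _ (cl01 x) (cl01 y)) _.
rewrite ler_wpM2l//; have clm u v : u <= v -> 0 <= cl v - cl u <= v - u.
  move=> uv; rewrite /cl; have [v1|v1] := leP v 1; have [u1|u1] := leP u 1;
    rewrite ?(max_r ler01); have [v0|v0] := leP 0 v; have [u0|u0] := leP 0 u; lra.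
have [/clm|/ltW/clm] := leP x y => /andP[h1 h2].
  by rewrite distrC (distrC x) !ger0_norm//; lra.
by rewrite !ger0_norm//; lra.
Qed.

Lemma smooth_local f : (forall x : R, exists2 g, smooth g & \forall y \near x, f y = g y) -> smooth f.
Proof.
move=> h; have key n (x : R) g : smooth g -> (\forall y \near x, f y = g y) ->
    \forall y \near x, derive1n n f y = derive1n n g y.
  move=> sg; elim: n => [//|n IH] /IH /near_join h'.
  near=> y; rewrite !derive1nS !derive1E; apply: near_eq_derive.
  by near: y.
move=> n x; have [g sg fg] := h x.
apply: near_eq_derivable (sg n x).
by have := key n x g sg fg; apply: filterS => y ->.
Unshelve. all: by end_near. Qed.

End Smooth.

(** * Smooth bumps on arcs, and recovery of the masses from the distribution *)

Section Bump.
Variables (R : realType) (delta : R).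
Hypothesis hdelta : 0 <= delta < 1.
Notation idx := (idx delta).
Notation arc := (arc delta).
Notation avg := (avg delta).
Notation dif := (dif delta).
Notation mass := (mass delta).
Notation len := (len R).
Notation phase := (phase delta).
Notation turn := (turn delta).
Notation pi2 := (pi *+ 2 : R).

Lemma periodic_int (V : zmodType) (f : R -> V) (z : int) x : periodic f pi2 -> f (x + pi2 * z%:~R) = f x.
Proof.
move=> pf; have pn n y : f (y + pi2 * n%:R) = f y.
  by elim: n y => [|n IH] y; rewrite ?mulr0 ?addr0// -natr1 mulrDr mulr1 addrA pf IH.
case: (intP z) => [|n|n]; rewrite ?mulr0z ?mulr0 ?addr0//; first exact: pn.
by rewrite -[in RHS](subrK (pi2 * n.+1%:R) x) pn intrN mulrN.
Qed.

Lemma tame_smooth phi : smooth phi -> periodic phi pi2 -> exists M, tame delta M phi.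
Proof.
move=> sp pp; have p := pi2_gt0 R.
(* One period is added on either side of [[0, 2pi]]: when the second of two points of an arc is
   moved into that period, the first has a translate within distance [2pi] of it. *)
have ab : - pi2 <= pi2 *+ 2 by lra.
have [M M0 hM] := smooth_lipschitz sp ab.
have red x : exists z : int, 0 <= x + pi2 * z%:~R <= pi2.
  exists (- Num.floor (x / pi2)); have /andP[h1 h2] := floor_itv (x / pi2).
  move: h1 h2; rewrite intrN intrD mulr1z; set f := _%:~R; rewrite ler_pdivlMr// ltr_pdivrMr//; nra.
have cf : continuous phi by move=> x; exact/differentiable_continuous/derivable1_diffP/(sp 0%N).
exists M; split => // [|k x y].
  split; first exact: continuous_measurable_fun.
  exists (`|phi 0| + M * pi2) => x; have [z hz] := red x.
  rewrite -(periodic_int z x pp); set y := x + _ in hz *.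
  have : `|phi y - phi 0| <= M * `|y - 0| by apply: hM; lra.
  rewrite subr0 (ger0_norm (x := y)); last by lra.
  have := ler_normD (phi y - phi 0) (phi 0); rewrite subrK.
  have : M * y <= M * pi2 by rewrite ler_wpM2l//; lra.
  lra.
move=> /idx_close [z hz]; have [w hw] := red y.
have lk : len k <= pi2 by rewrite ler_pdivrMr ?exprn_gt0// ler_peMr ?(ltW p)// exprn_ege1// ler1n.
rewrite -(periodic_int (z + w) x pp) -(periodic_int w y pp).
move: hz; rewrite -/(len k) intrD mulrDr addrA; set u := x + _; set v := pi2 * w%:~R.
move=> hz; have uv : `|u + v - (y + v)| <= len k.
  by rewrite opprD addrACA subrr addr0.
apply: (@le_trans _ _ (M * `|u + v - (y + v)|)); last by rewrite ler_wpM2l.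
by apply: hM; move: uv hw; rewrite ler_norml -/v; lra.
Qed.

Section OneBump.
Variables (j mj i : nat).
Hypothesis mj_lt : (mj < 2 ^ j)%N.
Hypothesis ji : (j < i)%N.

Let A : nat := (mj * 2 ^ (i - j))%N.
Let W : nat := (2 ^ (i - j))%N.

(** In units of [2^-i] the arc [(j, mj)] is [[A, A + W[]. The profile rises on its first subarc of
    generation [i], falls on its last, and vanishes off the arc. *)
Definition profile (p : R) : R := step (2 ^+ i * p - A%:R) * step (A%:R + W%:R - 2 ^+ i * p).
Definition bump (x : R) : R := profile (phase x).

Lemma bump_periodic : periodic bump pi2.
Proof.
move=> x; have tE : turn (x + pi2) = turn x + 1.
  by rewrite /turn mulrDl divff ?lt0r_neq0 ?pi2_gt0// addrAC.
by rewrite /bump /phase tE floorDrz// floor1 intrD opprD addrACA subrr addr0.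
Qed.

Lemma profile_le0 p : p <= 0 -> profile p = 0.
Proof.
move=> p0; rewrite /profile step0 ?mul0r//.
have : 2 ^+ i * p <= 0 by rewrite mulr_ge0_le0 ?exprn_ge0.
have : 0 <= A%:R :> R by [].
lra.
Qed.

Lemma AW_le : (A + W <= 2 ^ i)%N.
Proof.
have -> : (2 ^ i = 2 ^ j * 2 ^ (i - j))%N by rewrite -expnD subnKC// ltnW.
by rewrite /A /W -mulSnr leq_mul2r mj_lt orbT.
Qed.

Lemma profile_ge1 p : 1 <= p -> profile p = 0.
Proof.
move=> p1; rewrite /profile [X in _ * X]step0 ?mulr0//.
have : A%:R + W%:R <= 2 ^+ i :> R by rewrite -natrD -natrX ler_nat AW_le.
have : 2 ^+ i * 1 <= 2 ^+ i * p :> R by rewrite ler_wpM2l// exprn_ge0.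
lra.
Qed.

Lemma smooth_profile_turn c : smooth (fun x => profile (turn x + c)).
Proof.
apply: Ck_smooth => n; rewrite /profile; apply: CkM.
  have := Ck_affine (2 ^+ i / pi2) (2 ^+ i * (c - delta) - A%:R) (Ck_step R n).
  by congr Ck; apply/funext => x; congr step; rewrite /turn; ring.
have := Ck_affine (- (2 ^+ i / pi2)) (A%:R + W%:R - 2 ^+ i * (c - delta)) (Ck_step R n).
by congr Ck; apply/funext => x; congr step; rewrite /turn; ring.
Qed.

(** [phase] is discontinuous where [turn] is an integer. As the profile vanishes outside []0, 1[],
    the bump is near each point a sum of two translates of the profile, at most one of them nonzero
    at a time. *)
Lemma smooth_bump : smooth bump.
Proof.
apply: smooth_local => x; set N := Num.floor (turn x).
exists (fun y => 1 * profile (turn y - N%:~R) + 1 * profile (turn y + (1 - N%:~R))).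
  by apply: smooth_lin; exact: smooth_profile_turn.
have ct : turn y @[y --> x] --> turn x.
  by apply: cvgB; [apply: cvgMl|exact: cvg_cst].
have /andP[h1 h2] := floor_itv (turn x); rewrite -/N in h1 h2.
have n1 : \forall y \near x, N%:~R - 1 < turn y by apply: (cvgr_gt _ ct); lra.
have n2 : \forall y \near x, turn y < N%:~R + 1.
  by apply: (cvgr_lt _ ct); move: h2; rewrite intrD mulr1z.
near=> y; rewrite !mul1r.
have y1 : N%:~R - 1 < turn y by near: y.
have y2 : turn y < N%:~R + 1 by near: y.
rewrite /bump /phase; have [yN|yN] := leP (N%:~R) (turn y).
  rewrite (_ : Num.floor (turn y) = N); last by apply/eqP; rewrite floor_eq intrD mulr1z yN.
  by rewrite [X in _ = _ + X]profile_ge1 ?addr0//; lra.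
rewrite (_ : Num.floor (turn y) = N - 1); last first.
  by apply/eqP; rewrite floor_eq subrK yN intrB mulr1z ltW.
rewrite [X in _ = X + _]profile_le0 ?add0r; last by lra.
by congr profile; rewrite intrB mulr1z; ring.
Unshelve. all: by end_near. Qed.

Lemma profile_itv p : 0 <= profile p <= 1.
Proof.
have /andP[a0 a1] := step_itv (2 ^+ i * p - A%:R).
have /andP[b0 b1] := step_itv (A%:R + W%:R - 2 ^+ i * p).
by rewrite mulr_ge0//= mulr_ile1.
Qed.

Lemma idx_j x : (idx j x == mj) = (A <= idx i x < A + W)%N.
Proof.
rewrite -(anc_idx delta x (ltnW ji)) /anc /A /W -mulSnr.
by rewrite -leq_divRL ?expn_gt0// -ltn_divLR ?expn_gt0// ltnS eq_sym eqn_leq.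
Qed.

Lemma bump_indic x : `|bump x - \1_(arc j mj) x| <= \1_(arc i A) x + \1_(arc i (A + W).-1) x.
Proof.
rewrite !indic_arc idx_j.
have /andP[p0 p1] := profile_itv (phase x); rewrite -/(bump x) in p0 p1.
have /idxP := erefl (idx i x); set k := idx i x; rewrite /bump /profile; set t := 2 ^+ i * _ => /andP[k1 k2].
have W0 : (0 < W)%N by rewrite expn_gt0.
have kS : k.+1%:R = k%:R + 1 :> R by rewrite -natr1.
have [kA|Ak] := ltnP k A.
  rewrite (step0 (x := t - _)); last first.
    by have : k.+1%:R <= A%:R :> R by [rewrite ler_nat]; lra.
  by rewrite mul0r subrr normr0 addr_ge0.
have [kAW|AWk] := ltnP k (A + W); last first.
  rewrite (step0 (x := _ - t)); last first.
    by have : (A + W)%:R <= k%:R :> R by [rewrite ler_nat]; rewrite natrD; lra.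
  by rewrite mulr0 subrr normr0 addr_ge0.
have b1 : `|step (t - A%:R) * step (A%:R + W%:R - t) - 1| <= 1.
  by rewrite -[step _ * _]/(bump x) ler_norml; lra.
have [_|kA'] := eqVneq k A; first by apply: le_trans b1 _; rewrite lerDl.
have [_|kW] := eqVneq k (A + W).-1; first by apply: le_trans b1 _; rewrite lerDr.
rewrite !step1; [by rewrite mul1r subrr normr0 addr0| |].
- have : (k.+2)%:R <= (A + W)%:R :> R by rewrite ler_nat; lia.
  by rewrite -natr1 kS natrD; lra.
- have : (A.+1)%:R <= k%:R :> R by rewrite ler_nat; lia.
  by rewrite -natr1; lra.
Qed.

Lemma bump_close M n x y : (forall u v, `|step u - step v| <= M * `|u - v|) ->
  idx n x = idx n y -> `|bump x - bump y| <= 2 * M * (2 ^+ i / 2 ^+ n).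
Proof.
move=> hM xy; have k0 : 0 < 2 ^+ n :> R by rewrite exprn_gt0.
have M0 : 0 <= M by have := hM 1 0; rewrite subr0 normr1 mulr1; apply: le_trans.
have ph : 2 ^+ i * `|phase x - phase y| <= 2 ^+ i / 2 ^+ n.
  rewrite ler_wpM2l ?exprn_ge0// -[leRHS]mul1r ler_pdivlMr//.
  have -> : `|phase x - phase y| * 2 ^+ n = `|2 ^+ n * phase x - 2 ^+ n * phase y|.
    by rewrite -mulrBr normrM gtr0_norm// mulrC.
  have /idxP := xy; have /idxP := erefl (idx n y).
  by set m := idx n y; rewrite -natr1 ler_norml; lra.
rewrite /bump /profile; set u := 2 ^+ i * phase x; set v := 2 ^+ i * phase y.
have uv : `|u - v| <= 2 ^+ i / 2 ^+ n.
  by rewrite -mulrBr normrM ger0_norm// exprn_ge0.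
have := hM (u - A%:R) (v - A%:R); have := hM (A%:R + W%:R - u) (A%:R + W%:R - v).
rewrite (_ : _ - u - _ = - (u - v)); last by ring.
rewrite normrN (_ : u - A%:R - _ = u - v); last by ring.
set a := step (u - _); set b := step (v - _); set c := step (_ - u); set d := step (_ - v) => h1 h2.
have Muv := ler_wpM2l M0 uv.
have -> : a * c - b * d = a * (c - d) + (a - b) * d by ring.
apply: le_trans (ler_normD _ _) _; rewrite (normrM a (c - d)) (normrM (a - b) d).
have /andP[a0 a1] : 0 <= a <= 1 by exact: step_itv.
have /andP[d0 d1] : 0 <= d <= 1 by exact: step_itv.
have := normr_ge0 (c - d); have := normr_ge0 (a - b).
rewrite (ger0_norm a0) (ger0_norm d0); nra.
Qed.

Lemma bump_bndm : bndm bump.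
Proof.
split.
  apply: continuous_measurable_fun => x; have h := @smooth_bump 0%N x.
  exact/differentiable_continuous/derivable1_diffP.
by exists 1 => x; rewrite /bump ger0_norm; have /andP[] := profile_itv (phase x).
Qed.

End OneBump.

Definition gap (i n : nat) : nat := ((i - n) + (n - i))%N.

(** An atom of generation [n <= i] meets the error only on the two extreme subarcs of generation
    [i]. If [n > i], the indicator is constant on the arc of the atom because [j < i], and
    cancellation leaves the oscillation of the bump, of order [2^(i - n)]. *)
Lemma bump_error : exists2 C, 0 <= C & forall j mj i, (mj < 2 ^ j)%N -> (j < i)%N ->
  forall n m b beta, batom delta n m b beta ->
  `|Rint (fun x => beta x * bump j mj i x) - mass beta j mj| <= C * (b / 2 ^+ n / 2 ^+ gap i n).
Proof.
have [M M0 hM] := step_lipschitz R; have p := pi2_gt0 R.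
exists (pi2 * (2 + 4 * M)); first by rewrite mulr_ge0 ?(ltW p)//; lra.
move=> j mj i mjj ji n m b beta hb; have b0 := batom_ge0 hdelta hb; have bb := batom_bndm hb.
have bu := bump_bndm mjj ji; have e n' : 0 < 2 ^+ n' :> R by rewrite exprn_gt0.
have q0 : 0 <= b / 2 ^+ n / 2 ^+ gap i n by rewrite !divr_ge0 ?(ltW (e _)).
rewrite /mass -(RintB hdelta); [|exact: bndmM|exact: bndm_arc].
have -> : (fun x => beta x * bump j mj i x - beta x * \1_(arc j mj) x) =
    (fun x => beta x * (bump j mj i x - \1_(arc j mj) x)) by apply/funext => x; rewrite mulrBr.
have be : bndm (fun x => bump j mj i x - \1_(arc j mj) x) by apply: bndmB => //; exact: bndm_arc_indic.
have [ni|i_n] := leqP n i.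
  apply: (@le_trans _ _ (b * (2 * len i))).
    have -> : b * (2 * len i) = Rint (fun x => b * (\1_(arc i (mj * 2 ^ (i - j))) x +
        \1_(arc i (mj * 2 ^ (i - j) + 2 ^ (i - j)).-1) x)).
      have AW := AW_le mjj ji; have W0 : (0 < 2 ^ (i - j))%N by rewrite expn_gt0.
      rewrite (RintZ hdelta) ?(RintD hdelta) ?Rint_indic//; try exact: bndm_arc_indic; try lia.
        by rewrite mulr2n mulrDl mul1r.
      by apply: bndmD; exact: bndm_arc_indic.
    apply: (le_norm_Rint hdelta); first exact: bndmM.
      by apply: bndmZ; apply: bndmD; exact: bndm_arc_indic.
    move=> x; rewrite normrM ler_pM//; last exact: bump_indic.
    have [_ _ /(_ x) h _] := hb; apply: le_trans h _; rewrite indic_arc ler_piMr//.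
    by case: eqP.
  have -> : gap i n = (i - n)%N by rewrite /gap; lia.
  have -> : b * (2 * len i) = pi2 * 2 * (b / 2 ^+ n / 2 ^+ (i - n)).
    have E : 2 ^+ i = 2 ^+ n * 2 ^+ (i - n) :> R by rewrite -exprD subnKC.
    by rewrite /len E; field; rewrite !gt_eqF.
  have : 0 <= b / 2 ^+ n / 2 ^+ (i - n) by rewrite !divr_ge0 ?(ltW (e _)).
  by move=> q1; rewrite ler_wpM2r// ler_wpM2l ?(ltW p)//; lra.
have -> : gap i n = (n - i)%N by rewrite /gap; lia.
have q1 : 0 <= b / 2 ^+ n / 2 ^+ (n - i) by rewrite !divr_ge0 ?(ltW (e _)).
apply: (@le_trans _ _ (b * (2 * M * (2 ^+ i / 2 ^+ n)) * len n)).
  have K0 : 0 <= 2 * M * (2 ^+ i / 2 ^+ n) by rewrite !mulr_ge0 ?invr_ge0 ?(ltW (e _)).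
  have jn : (j <= n)%N by lia.
  have [[x0 x0E]|ne] := pselect (exists x, idx n x = m); last first.
    apply: (@batom_pair_le _ _ hdelta n m b beta hb _ 0) => // x xE; exfalso; apply: ne; by exists x.
  apply: (@batom_pair_le _ _ hdelta n m b beta hb _ (bump j mj i x0 - \1_(arc j mj) x0)) => // x xE.
  have -> : \1_(arc j mj) x = \1_(arc j mj) x0 :> R.
    by rewrite !indic_arc -!(anc_idx delta _ jn) xE x0E.
  rewrite opprB addrA subrK; apply: bump_close => //; by rewrite xE.
have -> : b * (2 * M * (2 ^+ i / 2 ^+ n)) * len n = pi2 * (2 * M) * (b / 2 ^+ n / 2 ^+ (n - i)).
  have E : 2 ^+ n = 2 ^+ i * 2 ^+ (n - i) :> R by rewrite -exprD subnKC// ltnW.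
  by rewrite /len E; field; rewrite !gt_eqF.
rewrite ler_wpM2r// ler_wpM2l ?(ltW p)//; lra.
Qed.

Section Mass.
Variables (nk mk : nat -> nat) (bk : nat -> R) (bt : nat -> R -> R).
Hypothesis hb : forall k, batom delta (nk k) (mk k) (bk k) (bt k).
Hypothesis hW : cvgn (psum (fun k => weight (bk k) (nk k))).

Let bk0 k : 0 <= bk k. Proof. exact: (batom_ge0 hdelta (hb k)). Qed.

Definition mass_sum j m := limn (psum (fun k => mass (bt k) j m)).

Lemma mass_cvg j m : (m < 2 ^ j)%N -> psum (fun k => mass (bt k) j m) @ \oo --> mass_sum j m.
Proof.
move=> mj; have l0 := len_ge0 R j.
apply: (psum_abs_cvg (B := fun k => 2 ^+ j * j.+1%:R * len j * weight (bk k) (nk k))); last exact: cvg_psumZ.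
move=> k; rewrite mulrAC; have [nkj|nkj] := leqP (nk k) j.
  apply: le_trans (mass_le hdelta (hb k) mj) _; apply: ler_wpM2r => //; exact: weight_coarse.
have := avg_coarse hdelta (hb k) m (ltnW nkj); rewrite /avg => /eqP.
rewrite mulf_eq0 invr_eq0 (gt_eqF (len_gt0 R j)) orbF => /eqP ->.
rewrite normr0; apply: mulr_ge0 => //; apply: mulr_ge0; last exact: weight_ge0.
by rewrite mulr_ge0// exprn_ge0.
Qed.

Lemma coef_mass n m : (m < 2 ^ n)%N ->
  coef delta bt n m = (mass_sum n.+1 m.*2 - mass_sum n.+1 m.*2.+1) / len n.+1 / 2.
Proof.
move=> mn; apply/cvg_lim => //.
have -> : psum (fun k => dif (bt k) n m) =
    fun K => (psum (fun k => mass (bt k) n.+1 m.*2) K - psum (fun k => mass (bt k) n.+1 m.*2.+1) K) / len n.+1 / 2.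
  apply/funext => K; rewrite /psum -sumrB !big_distrl /=; apply: eq_bigr => k _.
  by rewrite /dif /avg -mulrBl.
by apply: cvgMl; apply: cvgMl; apply: cvgB; apply: mass_cvg; rewrite expnS; lia.
Qed.

Definition tail i := psum (fun k => bk k / 2 ^+ nk k / 2 ^+ gap i (nk k)).

(* This is n + 1 <= (i + 1)(1 + |i - n|). *)
Lemma gap_le (b : R) n i : 0 <= b ->
  b / 2 ^+ n / 2 ^+ gap i n <= i.+1%:R * (weight b n * ((gap i n).+1%:R / 2 ^+ gap i n)).
Proof.
move=> b0; have e0 k : 0 < 2 ^+ k :> R by rewrite exprn_gt0.
have -> : i.+1%:R * (weight b n * ((gap i n).+1%:R / 2 ^+ gap i n)) =
    b / 2 ^+ n / 2 ^+ gap i n * ((i.+1 * (gap i n).+1)%:R / n.+1%:R).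
  by rewrite /weight natrM; field; rewrite !gt_eqF// addrC natr1.
rewrite ler_peMr ?divr_ge0 ?(ltW (e0 _))// ler_pdivlMr// mul1r ler_nat /gap; nia.
Qed.

Lemma tail_cvg i : cvgn (tail i).
Proof.
apply: (psum_abs_cvg (B := fun k => i.+1%:R * weight (bk k) (nk k))); last exact: cvg_psumZ.
move=> k; have e0 n : 0 < 2 ^+ n :> R by rewrite exprn_gt0.
rewrite ger0_norm; last by rewrite !divr_ge0// ltW.
apply: le_trans (gap_le _ _ (bk0 k)) _; rewrite ler_wpM2l// ler_piMr ?weight_ge0//.
by rewrite ler_pdivrMr// mul1r -natrX ler_nat ltn_expl.
Qed.

(** The scales [i >= n] and the scales [i < n] each contribute at most the full series of
    [(j + 1) / 2^j], whose sum is [4]. *)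
Lemma sum_gap_le n I : \sum_(i < I) ((gap i n).+1%:R / 2 ^+ gap i n) <= 8 :> R.
Proof.
pose g (j : nat) : R := j.+1%:R / 2 ^+ j.
have e0 k : 0 < 2 ^+ k :> R by rewrite exprn_gt0.
have gs J : \sum_(0 <= j < J) g j = 4 - 2 * (J%:R + 2) / 2 ^+ J.
  elim: J => [|J IH]; first by rewrite big_geq// expr0; field.
  by rewrite big_nat_recr//= IH /g exprS -!natr1; field; rewrite !gt_eqF.
have g4 J : \sum_(0 <= j < J) g j <= 4.
  by rewrite gs lerBlDr lerDl divr_ge0// ?(ltW (e0 _))// mulr_ge0// addr_ge0.
have g0 j : 0 <= g j by rewrite divr_ge0// ltW.
apply: (@le_trans _ _ (\sum_(0 <= i < n + I) ((gap i n).+1%:R / 2 ^+ gap i n))).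
  rewrite -(big_mkord xpredT (fun i => (gap i n).+1%:R / 2 ^+ gap i n)).
  rewrite (big_cat_nat (n := I) (p := n + I)) ?leq_addl//= lerDl.
  by apply: sumr_ge0 => i _; exact: g0.
rewrite (big_cat_nat (n := n)) ?leq_addr//= (_ : 8 = 4 + 4); last by ring.
apply: lerD; last first.
  rewrite -{1}[n]add0n big_addn addKn; apply: le_trans (g4 I).
  by rewrite le_eqVlt; apply/orP; left; apply/eqP/eq_bigr => i _; rewrite /gap /g addnK (_ : n - (i + n) = 0)%N ?addn0//; lia.
rewrite big_nat_rev /= add0n; apply: le_trans (g4 n.+1); rewrite big_nat_recl//= ler_wpDl//.
rewrite le_eqVlt; apply/orP; left; apply/eqP/eq_big_nat => i /andP[_ i_n]; rewrite /g /gap.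
by rewrite (_ : n - i.+1 - n + (n - (n - i.+1)) = i.+1)%N//; lia.
Qed.

Lemma sum_tail_le I : \sum_(i < I) limn (tail i) / i.+1%:R <= 8 * limn (psum (fun k => weight (bk k) (nk k))).
Proof.
have h1 : (fun K => \sum_(i < I) tail i K / i.+1%:R) @ \oo --> \sum_(i < I) limn (tail i) / i.+1%:R.
  apply: (cvgn_sum (f := fun i K => tail i K / i.+1%:R) (l := fun i => limn (tail i) / i.+1%:R)) => i _.
  by apply: cvgMl; exact: tail_cvg.
have h2 : (fun K => 8 * psum (fun k => weight (bk k) (nk k)) K) @ \oo -->
    8 * limn (psum (fun k => weight (bk k) (nk k))) by exact: cvgMr.
apply: (ler_cvg_to h1 h2); exists 0%N => // K _ /=.
rewrite /tail /psum big_distrr /=.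
under eq_bigr do rewrite big_distrl /=.
rewrite exchange_big /=; apply: ler_sum => k _.
apply: le_trans (_ : weight (bk k) (nk k) * \sum_(i < I) ((gap i (nk k)).+1%:R / 2 ^+ gap i (nk k)) <= _); last first.
  by rewrite mulrC ler_wpM2r ?weight_ge0// sum_gap_le.
rewrite big_distrr /=; apply: ler_sum => i _; rewrite ler_pdivrMr// [leRHS]mulrC; exact: gap_le.
Qed.

Lemma tail_ge0 i : 0 <= limn (tail i).
Proof.
apply: (ler_cvg_to (cvg_cst (0 : R)) (tail_cvg (i := i))); exists 0%N => // K _.
by apply: sumr_ge0 => k _; rewrite !divr_ge0 ?exprn_ge0.
Qed.

Lemma bump_mass C : (forall j mj i, (mj < 2 ^ j)%N -> (j < i)%N ->
  forall n m b beta, batom delta n m b beta ->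
  `|Rint (fun x => beta x * bump j mj i x) - mass beta j mj| <= C * (b / 2 ^+ n / 2 ^+ gap i n)) ->
  forall j mj i, (mj < 2 ^ j)%N -> (j < i)%N ->
  `|limn (psum (fun k => Rint (fun x => bt k x * bump j mj i x))) - mass_sum j mj| <= C * limn (tail i).
Proof.
move=> hC j mj i mjj ji.
have [M hM] := tame_smooth (smooth_bump mjj ji) (@bump_periodic j mj i).
have h1 : (fun K => `|psum (fun k => Rint (fun x => bt k x * bump j mj i x)) K - psum (fun k => mass (bt k) j mj) K|) @ \oo -->
    `|limn (psum (fun k => Rint (fun x => bt k x * bump j mj i x))) - mass_sum j mj|.
  by apply: cvg_norm; apply: cvgB; [exact: (pair_cvg hdelta hb hW hM)|exact: mass_cvg].
have h2 : (fun K => C * tail i K) @ \oo --> C * limn (tail i) by apply: cvgMr; exact: tail_cvg.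
apply: (ler_cvg_to h1 h2); exists 0%N => // K _ /=.
rewrite /tail /psum big_distrr /= -sumrB; apply: le_trans (ler_norm_sum _ _ _) _.
by apply: ler_sum => k _; exact: (hC _ _ _ mjj ji _ _ _ _ (hb k)).
Qed.

End Mass.

(** The coefficients are differences of masses. If two masses on an arc differ by [G], then
    [G <= C * T i] at each scale [i > j], because both series agree on the bump. After division by
    [i + 1] and summation, [G > 0] would bound the harmonic series. *)
Lemma coef_unique nk mk bk bt nk' mk' bk' bt' :
  (forall k, batom delta (nk k) (mk k) (bk k) (bt k)) ->
  cvgn (psum (fun k => weight (bk k) (nk k))) ->
  (forall k, batom delta (nk' k) (mk' k) (bk' k) (bt' k)) ->
  cvgn (psum (fun k => weight (bk' k) (nk' k))) ->
  (forall phi, smooth phi -> periodic phi pi2 ->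
    limn (psum (fun k => Rint (fun x => bt k x * phi x))) =
    limn (psum (fun k => Rint (fun x => bt' k x * phi x)))) ->
  forall n m, (m < 2 ^ n)%N -> coef delta bt n m = coef delta bt' n m.
Proof.
move=> hb hW hb' hW' eqphi n m mn.
suff : forall j mj, (mj < 2 ^ j)%N -> mass_sum bt j mj = mass_sum bt' j mj.
  move=> E; rewrite (coef_mass hb hW mn) (coef_mass hb' hW' mn).
  by rewrite !E// expnS; lia.
move=> j mj mjj; have [C C0 hC] := bump_error.
pose T i := limn (tail nk bk i) + limn (tail nk' bk' i).
pose D := 8 * (limn (psum (fun k => weight (bk k) (nk k))) + limn (psum (fun k => weight (bk' k) (nk' k)))).
have sT I : \sum_(i < I) T i / i.+1%:R <= D.
  rewrite /T; under eq_bigr do rewrite mulrDl.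
  rewrite big_split /D mulrDr; apply: lerD; [exact: (@sum_tail_le _ _ _ _ hb hW)|exact: (@sum_tail_le _ _ _ _ hb' hW')].
pose G := `|mass_sum bt j mj - mass_sum bt' j mj|.
have GT i : (j < i)%N -> G <= C * T i.
  move=> ji; have := bump_mass hb hW hC mjj ji; have := bump_mass hb' hW' hC mjj ji.
  rewrite (eqphi _ (smooth_bump mjj ji) (@bump_periodic j mj i)).
  set r := limn _ => h' h; apply: le_trans (ler_distD r _ _) _.
  by rewrite /T mulrDr lerD// distrC.
have T0 i : 0 <= T i by rewrite addr_ge0// ?(@tail_ge0 _ _ _ _ hb hW)// (@tail_ge0 _ _ _ _ hb' hW').
apply/eqP; rewrite -subr_eq0 -normr_le0 leNgt -/G; apply/negP => Gp.
apply: (@dvg_harmonic R); rewrite -psumE; apply: nondecreasing_is_cvgn.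
  by apply/nondecreasing_seqP => k; rewrite /psum big_ord_recr /= lerDl.
(* The [j + 1] scales [i <= j], for which there is no bump, contribute at most [1] each. *)
exists (j.+1%:R + C * D / G) => _ [I _ <-].
apply: (@le_trans _ _ (\sum_(i < I) ((i <= j)%N%:R + C / G * (T i / i.+1%:R)))).
  apply: ler_sum => i _; rewrite /harmonic /=; have [ij|ji] := leqP i j.
    have : 0 <= C / G * (T i / i.+1%:R) by rewrite mulr_ge0// divr_ge0// ltW.
    have : (i.+1%:R : R)^-1 <= 1 by rewrite invf_le1// ler1n.
    by move=> h1 h2; rewrite (le_trans h1)// lerDl.
  rewrite add0r mulrA ler_pdivlMr// mulVf ?pnatr_eq0// mulrAC ler_pdivlMr// mul1r; exact: GT.
rewrite big_split /= lerD//.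
  apply: (@le_trans _ _ (\sum_(0 <= i < I + j.+1) (i <= j)%N%:R)).
    rewrite -(big_mkord xpredT (fun i => (i <= j)%N%:R)) (big_cat_nat (n := I) (p := I + j.+1)) ?leq_addr//=.
    by rewrite lerDl sumr_ge0.
  rewrite (big_cat_nat (n := j.+1)) ?leq_addl//= [X in _ + X]big_nat_cond [X in _ + X]big1 ?addr0; last first.
    by move=> i /andP[/andP[ji _] _]; rewrite leqNgt ji.
  rewrite (eq_big_nat _ _ (F2 := fun=> 1)) ?sumr_const_nat ?subn0// => i /andP[_].
  by rewrite ltnS => ->.
have CG : 0 <= C / G by apply: divr_ge0 => //; exact: ltW.
by rewrite -big_distrr /= [leRHS]mulrAC; exact: (ler_wpM2l CG (sT I)).
Qed.

End Bump.

(** * Atoms from Haar data *)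

Section Heap.

(** Atomic series are indexed by natural numbers, so the tree is enumerated generation by
    generation, in heap order; the first [2^N - 1] indices exhaust the generations [n < N]. *)
Definition hgen (i : nat) : nat := trunc_log 2 i.+1.
Definition hpos (i : nat) : nat := (i.+1 - 2 ^ hgen i)%N.
Definition heap (n m : nat) : nat := (2 ^ n + m).-1.

Lemma hpos_lt i : (hpos i < 2 ^ hgen i)%N.
Proof.
have /andP[h1 h2] := @trunc_log_bounds 2 i.+1 isT isT.
by move: h2; rewrite /hpos /hgen expnS; set k := trunc_log _ _ in h1 *; lia.
Qed.

Lemma heapK i : heap (hgen i) (hpos i) = i.
Proof.
have /andP[h1 h2] := @trunc_log_bounds 2 i.+1 isT isT.
by rewrite /heap /hpos subnKC.
Qed.

Lemma hgen_heap n m : (m < 2 ^ n)%N -> hgen (heap n m) = n.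
Proof.
move=> mn; have e : (0 < 2 ^ n)%N by rewrite expn_gt0.
by rewrite /hgen /heap prednK ?addn_gt0 ?e//; apply: trunc_log_eq => //; rewrite leq_addr expnS; lia.
Qed.

Lemma hpos_heap n m : (m < 2 ^ n)%N -> hpos (heap n m) = m.
Proof.
move=> mn; have e : (0 < 2 ^ n)%N by rewrite expn_gt0.
by rewrite /hpos hgen_heap// /heap prednK ?addn_gt0 ?e// addKn.
Qed.

Lemma sum_heap (V : nmodType) (F : nat -> nat -> V) N :
  \sum_(i < (2 ^ N).-1) F (hgen i) (hpos i) = \sum_(n < N) \sum_(m < 2 ^ n) F n m.
Proof.
elim: N => [|N IH]; first by rewrite !big_ord0.
have e : (0 < 2 ^ N)%N by rewrite expn_gt0.
rewrite big_ord_recr /= -IH -!(big_mkord xpredT (fun i => F (hgen i) (hpos i))).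
rewrite (big_cat_nat (n := (2 ^ N).-1))//=; last by rewrite expnS; lia.
congr (_ + _); rewrite -{1}[(2 ^ N).-1]add0n big_addn (_ : (2 ^ N.+1).-1 - (2 ^ N).-1 = 2 ^ N)%N; last by rewrite expnS; lia.
rewrite big_mkord; apply: eq_bigr => m _.
have -> : (m + (2 ^ N).-1)%N = heap N m by rewrite /heap; lia.
by rewrite hgen_heap// hpos_heap.
Qed.

Lemma hgen_lt N i : (i < (2 ^ N).-1)%N -> (hgen i < N)%N.
Proof.
move=> iN; have /andP[h1 h2] := @trunc_log_bounds 2 i.+1 isT isT.
by rewrite -(ltn_exp2l (m := 2))//; apply: leq_ltn_trans h1 _; lia.
Qed.

End Heap.

(** * Finite Haar sums as functions, and the atoms made from blocks *)

Section Mart.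
Variables (R : realType) (delta : R).
Hypothesis hdelta : 0 <= delta < 1.
Notation idx := (idx delta).
Notation avg := (avg delta).
Notation dif := (dif delta).
Notation mass := (mass delta).
Notation len := (len R).
Notation pi2 := (pi *+ 2 : R).

Variable L : R[i] -> R.
Hypothesis LD : forall z w, L (z + w) = L z + L w.
Hypothesis LM : forall z w, L (z - w) = L z - L w.

Lemma mart_l d N m : L (mart d N.+1 m.*2) = L (mart d N m) + L (d N m).
Proof. by rewrite martS doubleK sgnD mul1r LD. Qed.

Lemma mart_r d N m : L (mart d N.+1 m.*2.+1) = L (mart d N m) - L (d N m).
Proof.
rewrite martS sgnDS mulN1r LM (_ : m.*2.+1./2 = m)//.
by rewrite -[LHS]/(uphalf m.*2) uphalf_double.
Qed.

Lemma part0 : L 0 = 0.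
Proof. by have := LM 0 0; rewrite !subrr. Qed.

Lemma mart_pair d f N : bndm f ->
  mean N (fun m => L (mart d N m) * avg f N m) = \sum_(n < N) mean n (fun m => L (d n m) * dif f n m).
Proof.
move=> bf; elim: N => [|N IH].
  by rewrite mean0 big_ord0 /mart big_ord0 part0 mul0r.
rewrite big_ord_recr /= -IH -meanD meanS; apply: eq_mean => m _.
by rewrite mart_l mart_r /dif (avgS hdelta N m bf); field.
Qed.

(** The martingale property: increments from generation [n] on average out against a function of the
    ancestor at generation [n]. *)
Lemma mean_mart_anc d n N (h : nat -> R) : (n <= N)%N ->
  mean N (fun m => L (mart d N m) * h (anc N n m)) = mean n (fun m => L (mart d n m) * h m).
Proof.
elim: N => [|N IH]; first by rewrite leqn0 => /eqP ->; apply: eq_mean => m _; rewrite ancnn.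
rewrite leq_eqVlt => /predU1P[->|]; first by apply: eq_mean => m _; rewrite ancnn.
rewrite ltnS => nN; rewrite -IH// meanS; apply: eq_mean => m _.
rewrite mart_l mart_r !ancS// doubleK (_ : m.*2.+1./2 = m); first by field.
by rewrite -[LHS]/(uphalf m.*2) uphalf_double.
Qed.

Lemma mart_stable (d : nat -> nat -> R[i]) T N m : (forall k j, (T <= k)%N -> d k j = 0) -> (T <= N)%N ->
  mart d N m = mart d T (anc N T m).
Proof.
move=> d0; elim: N m => [|N IH] m; first by rewrite leqn0 => /eqP ->; rewrite ancnn.
rewrite leq_eqVlt => /predU1P[->|]; first by rewrite ancnn.
by rewrite ltnS => TN; rewrite martS d0// mulr0 addr0 IH// ancS.
Qed.

Section Finite.
Variables (d : nat -> nat -> R[i]) (T : nat).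
Hypothesis d0 : forall k j, (T <= k)%N -> d k j = 0.

Definition martf (x : R) : R := L (mart d T (idx T x)).

Lemma martf_level N x : (T <= N)%N -> martf x = L (mart d N (idx N x)).
Proof. by move=> TN; rewrite (mart_stable _ d0 TN) anc_idx. Qed.

Lemma bndm_martf : bndm martf.
Proof. exact: (bndm_step delta T (fun m => L (mart d T m))). Qed.

Lemma avg_martf n m : (m < 2 ^ n)%N -> avg martf n m = L (mart d n m).
Proof.
move=> mn; have l0 := len_gt0 R n; pose N := maxn T n.
have TN : (T <= N)%N by rewrite leq_maxl.
have nN : (n <= N)%N by rewrite leq_maxr.
rewrite /avg /mass (_ : (fun x => _) = fun x => (fun k => L (mart d N k) * (anc N n k == m)%:R) (idx N x)); last first.
  by apply/funext => x; rewrite (martf_level x TN) indic_arc anc_idx.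
rewrite (Rint_mean hdelta N (fun k => L (mart d N k) * (anc N n k == m)%:R)) (mean_mart_anc d (fun k => (k == m)%:R) nN).
rewrite /mean (bigD1 (Ordinal mn))//= eqxx mulr1 big1 ?addr0.
  by rewrite mulrA -/(len n) mulrC mulKf// gt_eqF.
by move=> i; rewrite -val_eqE /= => /negbTE ->; rewrite mulr0.
Qed.

Lemma dif_martf n m : (m < 2 ^ n)%N -> dif martf n m = L (d n m).
Proof.
move=> mn; rewrite /dif !avg_martf ?mart_l ?mart_r; [by field|rewrite expnS; lia|rewrite expnS; lia].
Qed.

Lemma Rint_martf : Rint martf = 0.
Proof.
rewrite /martf (Rint_mean hdelta T (fun k => L (mart d T k))).
have h : mean T (fun m => L (mart d T m) * 1) = 0.
  by rewrite (mean_mart_anc d (fun=> 1) (leq0n T)) mean0 /mart big_ord0 part0 mul0r.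
by rewrite (eq_mean (g := fun m => L (mart d T m) * 1)) ?h ?mulr0// => m _; rewrite mulr1.
Qed.

End Finite.

Lemma Rint_mart_pair d f N : bndm f ->
  Rint (fun x => f x * L (mart d N (idx N x))) = pi2 * \sum_(n < N) mean n (fun m => L (d n m) * dif f n m).
Proof.
by move=> bf; rewrite (Rint_step_avg hdelta N (fun m => L (mart d N m)) bf) mart_pair.
Qed.

Section BlockAtom.
Variables (d : nat -> nat -> R[i]) (frc : pred nat).
Hypothesis frcP : forall n, exists2 t, (n < t)%N & frc t.
Hypothesis LN : forall z, `|L z| <= normc z.

(* A forced generation cuts every block, which is thus a finite Haar sum. *)
Definition horizon n := s2val (cid2 (frcP n)).

Lemma horizonP n : (n < horizon n)%N && frc (horizon n).
Proof. by rewrite /horizon; case: cid2 => t /= -> ->. Qed.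

(** Defined at every node, and zero where there is no restart, so that the heap order enumerates the
    whole family. *)
Definition block_atom n m (x : R) : R[i] :=
  if restart d frc n m then mart (block d frc n m) (horizon n) (idx (horizon n) x) else 0.

Definition block_bound n m : R :=
  if restart d frc n m then 10 * slev (stop d frc n m) else 0.

Lemma block_bound_ge0 n m : 0 <= block_bound n m.
Proof.
rewrite /block_bound; case: ifP => // _.
by have [_ /andP[l0 _] _ _ _] := stopP d frc n m; rewrite mulr_ge0.
Qed.

Lemma block_atom_le n m x : normc (block_atom n m x) <= block_bound n m.
Proof.
by rewrite /block_atom /block_bound; case: ifP => [r|_]; rewrite ?normc0//; exact: mart_block_le.
Qed.

Lemma block_atom_out n m x : idx n x != m -> block_atom n m x = 0.
Proof.
move=> xm; rewrite /block_atom; case: ifP => // r; apply: mart_block0.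
by have /andP[nh _] := horizonP n; rewrite anc_idx ?xm ?orbT// ltnW.
Qed.

Lemma block_far n m k j : restart d frc n m -> (horizon n <= k)%N -> block d frc n m k j = 0.
Proof. by move=> r hk; have /andP[nh fh] := horizonP n; exact: (block_ge _ _ _ fh nh hk). Qed.

Lemma block_batom n m : (m < 2 ^ n)%N ->
  batom delta n m (block_bound n m) (fun x => L (block_atom n m x)).
Proof.
move=> mn; have aE : (fun x => L (block_atom n m x)) =
    if restart d frc n m then martf (block d frc n m) (horizon n) else fun=> 0.
  by apply/funext => x; rewrite /block_atom; case: ifP => // _; rewrite part0.
split=> //.
- rewrite aE; case: ifP => _; [exact: bndm_martf|exact: bndm_cst].
- move=> x; rewrite indic_arc; have [xm|xm] := eqVneq (idx n x) m.
    by rewrite mulr1; apply: le_trans (LN _) _; exact: block_atom_le.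
  by rewrite block_atom_out// part0 normr0 mulr0.
- by rewrite aE; case: ifP => [r|_]; [exact: Rint_martf|rewrite (Rint_cst hdelta) mul0r].
Qed.

Lemma dif_block n m k j : (j < 2 ^ k)%N ->
  dif (fun x => L (block_atom n m x)) k j = if restart d frc n m then L (block d frc n m k j) else 0.
Proof.
move=> jk; have [r|r] := boolP (restart d frc n m).
  rewrite (_ : (fun x => _) = martf (block d frc n m) (horizon n)).
    by apply: dif_martf => // i i'; exact: block_far.
  by apply/funext => x; rewrite /block_atom r.
rewrite (_ : (fun x => _) = fun=> 0).
  have z n' m' : avg (fun=> 0) n' m' = 0.
    rewrite /avg /mass (_ : (fun x => _) = fun=> 0) ?(Rint_cst hdelta) ?mul0r//.
    by apply/funext => x; rewrite mul0r.
  by rewrite /dif !z subrr mul0r.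
by apply/funext => x; rewrite /block_atom (negbTE r) part0.
Qed.

Definition hatom (i : nat) : R -> R[i] := block_atom (hgen i) (hpos i).
Definition hbound (i : nat) : R := block_bound (hgen i) (hpos i).

(** By [restart_owner] exactly one block carries the coefficient at [(k, j)], so the partial sums
    are constant once the index [o] of its owner is passed. *)
Lemma hatom_coef k j : (j < 2 ^ k)%N ->
  coef delta (fun i x => L (hatom i x)) k j = L (d k j).
Proof.
move=> jk; pose o := heap (sgen (stop d frc k j)) (anc k (sgen (stop d frc k j)) j).
have gk := sgen_le d frc k j; have ak := anc_lt gk jk.
apply/cvg_lim => //; apply/cvgnP => e e0; exists o.+1 => K oK.
rewrite /psum (bigD1 (Ordinal oK))//= big1 ?addr0.
  rewrite dif_block// /o hgen_heap// hpos_heap// restart_owner /block !eqxx /= subrr normr0.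
  exact: ltW.
move=> i; rewrite -val_eqE /= => io; rewrite dif_block//; case: ifP => // r.
rewrite /block; case: ifP => [/andP[/eqP g1 /eqP g2]|_]; last exact: part0.
by move: io; rewrite /o g1 g2 heapK eqxx.
Qed.

End BlockAtom.

End Mart.

(** * The square function and the atomic series *)

Section Nodes.
Variables (R : realType) (delta : R).
Hypothesis hdelta : 0 <= delta < 1.
Notation idx := (idx delta).
Notation arc := (arc delta).
Notation len := (len R).
Notation mu := (torus_measure R).
Notation pi2 := (pi *+ 2 : R).

Definition dnode (i : nat) : dyadic := existT _ (hgen i) (Ordinal (hpos_lt i)).

Lemma dnode_bij : set_bij setT setT dnode.
Proof.
split=> // [i j _ _ e|[n [m mn]] _].
  by rewrite -(heapK i) -(heapK j); case: e => -> ->.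
exists (heap n m) => //; rewrite /dnode; move: (hpos_lt (heap n m)).
rewrite (hgen_heap mn) (hpos_heap mn) => mn'.
by congr existT; exact: val_inj.
Qed.

Lemma darcE (I : dyadic) : darc delta I = arc (tag I) (tagged I).
Proof. by apply/predeqP => x; rewrite /darc dyadic_arcP. Qed.

Lemma arc_leftE (I : dyadic) : arc_left delta I = arc (tag I).+1 (tagged I).*2.
Proof.
apply/predeqP => x; rewrite /arc_left mul2n dyadic_arcP//.
by have := ltn_ord (tagged I); rewrite expnS; lia.
Qed.

Lemma arc_rightE (I : dyadic) : arc_right delta I = arc (tag I).+1 (tagged I).*2.+1.
Proof.
apply/predeqP => x; rewrite /arc_right mul2n dyadic_arcP//.
by have := ltn_ord (tagged I); rewrite expnS; lia.
Qed.

Lemma arc_lenE (I : dyadic) : arc_len delta I = len (tag I).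
Proof. by rewrite /arc_len darcE (mu_arc hdelta). Qed.

Lemma sum_idx (V : nmodType) n (g : nat -> V) x :
  \sum_(m < 2 ^ n) (if idx n x == m then g m else 0) = g (idx n x).
Proof.
rewrite -big_mkcond (big_pred1 (Ordinal (idx_lt delta n x)))//.
Qed.

Section Coefficients.
Variable f : haar_data R.

(** The normalised coefficient [f_J |J|^(-1/2)], extended by [0] to positions that do not exist in
    generation [n]. *)
Definition dcoef (n m : nat) : R[i] :=
  oapp (fun j : 'I_(2 ^ n) => hd f (existT _ n j) / (Num.sqrt (len n))%:C%C) 0 (insub m).

Lemma sqrt_len_neq0 n : (Num.sqrt (len n))%:C%C != 0.
Proof. by rewrite eq_complex /= eqxx andbT gt_eqF// sqrtr_gt0 len_gt0. Qed.

Lemma hd_dcoef (I : dyadic) : hd f I = dcoef (tag I) (tagged I) * (Num.sqrt (len (tag I)))%:C%C.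
Proof. by rewrite /dcoef valK /= mulfVK ?sqrt_len_neq0//; case: I. Qed.

Lemma haar_term (I : dyadic) x : hd f I * (haar delta I x)%:C%C =
  if idx (tag I) x == tagged I then sgn R (idx (tag I).+1 x) * dcoef (tag I) (tagged I) else 0.
Proof.
rewrite /haar arc_lenE arc_leftE arc_rightE hd_dcoef !indicE.
case: I => n [m mn] /=; set s := Num.sqrt _.
have s0 : s != 0 by rewrite gt_eqF// sqrtr_gt0 len_gt0.
have sgnE (z : R) : dcoef n m * s%:C%C * (s^-1 * z)%:C%C = z%:C%C * dcoef n m.
  by rewrite -mulrA -rmorphM mulrA mulfV// mul1r mulrC.
rewrite sgnE -(idxS delta n x).
have aE k : (x \in arc n.+1 k) = (idx n.+1 x == k).
  by apply/idP/eqP => [/set_mem//|e]; exact: mem_set.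
rewrite !aE; set j := idx n.+1 x; rewrite -{1 2}(odd_double_half j) /sgn -signr_odd.
case: (odd j); rewrite /= ?add0n ?add1n.
  rewrite eqSS; have -> : (j./2.*2.+1 == m.*2)%N = false by apply/eqP; lia.
  have -> : (j./2.*2 == m.*2)%N = (j./2 == m) by apply/eqP/eqP; lia.
  by case: ifP => _; rewrite ?subr0 ?mul0r// sub0r rmorphN1 expr1.
have -> : (j./2.*2 == m.*2.+1)%N = false by apply/eqP; lia.
have -> : (j./2.*2 == m.*2)%N = (j./2 == m) by apply/eqP/eqP; lia.
by case: ifP => _; rewrite subr0 ?mul0r// expr0.
Qed.

(** Since [4 <= 2 pi < 8], the condition [|I| >= 2^-N] keeps the generations up to [N + 2]. *)
Lemma large_arc (I : dyadic) N : (2 ^- N <= arc_len delta I) = (tag I < N.+3)%N.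
Proof.
have /andP[p0 p2] := pihalf_02 R; have p3 := pi_ge2 R.
rewrite arc_lenE /len ler_pdivlMr ?exprn_gt0// mulrC ler_pdivrMr ?exprn_gt0//.
case: I => n m /=; apply/idP/idP => [h|].
  rewrite ltnNge; apply/negP => nN; have : 2 ^+ N.+3 <= 2 ^+ n :> R by rewrite ler_eXn2l// ltr1n.
  by rewrite 3!exprS leNgt => /negP; apply; apply: le_lt_trans h _; have : 0 < 2 ^+ N :> R by []; nra.
rewrite ltnS => nN; apply: (@le_trans _ _ (2 ^+ N.+2)); first by rewrite ler_eXn2l// ltr1n.
by rewrite 2!exprS; have : 0 < 2 ^+ N :> R by []; nra.
Qed.

Lemma haar_sumE N x : haar_sum delta f N x = hd0 f + mart dcoef N.+3 (idx N.+3 x).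
Proof.
rewrite /haar_sum; congr (_ + _); set Q := [set I | _].
have bij : set_bij `I_((2 ^ N.+3).-1) Q dnode.
  split=> [i /= iN|i j _ _|I].
  - by rewrite /Q /= large_arc; exact: hgen_lt.
  - by move=> e; rewrite -(heapK i) -(heapK j); case: e => -> ->.
  - rewrite /Q /= large_arc => tN; have [_ _ /(_ I Logic.I)[i _ iI]] := dnode_bij.
    exists i => //=; rewrite -(heapK i) /heap; have := hpos_lt i.
    have : (hgen i < N.+3)%N by rewrite -iI in tN.
    move=> a b; have : (2 ^ (hgen i).+1 <= 2 ^ N.+3)%N by rewrite leq_exp2l.
    by rewrite expnS; have : (0 < 2 ^ hgen i)%N by [rewrite expn_gt0]; lia.
rewrite (reindex_fsbig dnode _ _ _ bij) -fsbig_ord.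
under eq_bigr do rewrite haar_term /=.
rewrite (sum_heap (fun n m => if idx n x == m then sgn R (idx n.+1 x) * dcoef n m else 0)).
rewrite /mart; apply: eq_bigr => k _.
by rewrite (sum_idx k (fun m => sgn R (idx k.+1 x) * dcoef k m)) !anc_idx// ltnW.
Qed.

Definition spath N m : R := path_sum (esq dcoef) 0 N m.

Lemma spath_ge0 N m : 0 <= spath N m.
Proof. by apply: path_sum_ge0 => k i; rewrite sqr_ge0. Qed.

Lemma spath_idx N x : spath N (idx N x) = \sum_(n < N) esq dcoef n (idx n x).
Proof.
rewrite /spath /path_sum big_mkord; apply: eq_bigr => k _.
by rewrite anc_idx// ltnW.
Qed.

Lemma spath_homo x : {homo (fun N => spath N (idx N x)) : n m / (n <= m)%N >-> n <= m}.
Proof.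
move=> n m nm; rewrite !spath_idx -!(big_mkord xpredT (fun n => esq dcoef n (idx n x))).
by rewrite [leRHS](big_cat_nat (n:=n))//= lerDl sumr_ge0// => i _; rewrite sqr_ge0.
Qed.

(** The unordered sum is enumerated in heap order; its partial sums of length [2^N - 1] are the path
    sums at the arcs around [x]. *)
Lemma esum_spath x : (fun N => (spath N (idx N x))%:E) @ \oo -->
  \esum_(I in [set: dyadic]) (normc (hd f I) ^+ 2 * \1_(darc delta I) x / arc_len delta I)%:E.
Proof.
have termE I : normc (hd f I) ^+ 2 * \1_(darc delta I) x / arc_len delta I =
    if idx (tag I) x == tagged I then esq dcoef (tag I) (tagged I) else 0.
  rewrite arc_lenE darcE indicE hd_dcoef normcM exprMn.
  have -> : normc (Num.sqrt (len (tag I)))%:C%C ^+ 2 = len (tag I).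
    by rewrite normc_sqr /= expr0n addr0 sqr_sqrtr// len_ge0.
  have -> : (x \in arc (tag I) (tagged I)) = (idx (tag I) x == tagged I).
    by apply/idP/eqP => [/set_mem//|e]; exact: mem_set.
  case: ifP => _; last by rewrite mulr0 mul0r.
  by rewrite mulr1 mulfK// gt_eqF// len_gt0.
have t0 (I : dyadic) : (0 <= (normc (hd f I) ^+ 2 * \1_(darc delta I) x / arc_len delta I)%:E)%E.
  by rewrite lee_fin termE; case: ifP => // _; rewrite sqr_ge0.
rewrite (reindex_esum setT setT dnode _ dnode_bij) -nneseries_esumT//.
set u := fun i : nat => (normc (hd f (dnode i)) ^+ 2 * \1_(darc delta (dnode i)) x / arc_len delta (dnode i))%:E.
rewrite -/(\sum_(0 <= i <oo) u i)%E.
have cu : (fun n => (\sum_(0 <= i < n) u i)%E) @ \oo --> (\sum_(0 <= i <oo) u i)%E.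
  by apply: is_cvg_nneseries => i _ _; exact: t0.
have sub : (fun N => (2 ^ N).-1) @ \oo --> \oo.
  apply/cvgnyPge => A; exists A => // N /= AN.
  by rewrite -ltnS prednK ?expn_gt0//; apply: leq_ltn_trans AN _; exact: ltn_expl.
have := cvg_comp _ _ sub cu; apply: cvg_trans; apply: near_eq_cvg; near=> N.
rewrite /= big_mkord /u; under eq_bigr do rewrite termE /=.
rewrite (eq_bigr (fun i : 'I_ _ => ((if idx (hgen i) x == hpos i then esq dcoef (hgen i) (hpos i) else 0)%:E))); last first.
  by move=> i _; case: ifP.
rewrite sumEFin (sum_heap (fun n m => if idx n x == m then esq dcoef n m else 0)) spath_idx.
by congr (_%:E); apply: eq_bigr => k _; rewrite (sum_idx k (esq dcoef k)).
Unshelve. all: by end_near.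
Qed.

Definition node_level l N m : R := Psi0 (l^-1 * (normc (hd0 f) + Num.sqrt (spath N m))).

Section Integral.
Variable l : R.
Hypothesis l0 : 0 < l.

Let P_mod : moderate (fun t : R => Psi0 (l^-1 * t)).
Proof. exact: (moderate_scaled (Psi0_moderate R) l0). Qed.

Lemma node_arg_ge0 N m : 0 <= normc (hd0 f) + Num.sqrt (spath N m).
Proof. by rewrite addr_ge0 ?normc_ge0 ?sqrtr_ge0. Qed.

Lemma node_level_ge0 N m : 0 <= node_level l N m.
Proof. exact: (moderate_ge0 P_mod (node_arg_ge0 N m)). Qed.

Lemma node_level_homo x : {homo (fun N => node_level l N (idx N x)) : n m / (n <= m)%N >-> n <= m}.
Proof.
move=> n m nm; apply: (moderate_le P_mod (node_arg_ge0 _ _)).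
by rewrite lerD2l ler_wsqrtr// spath_homo.
Qed.

Lemma Psi0_cvg (v : nat -> R) (r : R) : (forall n, 0 <= v n) -> 0 <= r -> v @ \oo --> r ->
  (fun n => Psi0 (v n)) @ \oo --> Psi0 r.
Proof.
move=> v0 r0 vr; have e0 : 0 < expR 1 :> R by rewrite expR_gt0.
apply: cvgM => //; apply: cvgV; first by rewrite gt_eqF// (lt_le_trans _ (ge1_ln_e r0)).
apply: (@continuous_cvg _ _ _ _ _ (fun n => expR 1 + v n) (@ln R)).
  by apply: continuous_ln; rewrite ltr_wpDr.
by apply: cvgD => //; exact: cvg_cst.
Qed.

Lemma node_level_cvg x : (fun N => (node_level l N (idx N x))%:E) @ \oo -->
  Psi0e ((l^-1)%:E * `|square_fun delta f x|)%E.
Proof.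
have c0 := normc_ge0 (hd0 f); have li0 : 0 < l^-1 by rewrite invr_gt0.
have := @esum_spath x; rewrite /square_fun; set s := (\esum_(I in _) _)%E => hs.
have s0 : (0 <= s)%E.
  rewrite -(cvg_lim _ hs)//; apply: lime_ge; first by apply/cvg_ex; exists s.
  by near=> n; rewrite lee_fin spath_ge0.
case: s s0 hs => [r||//] s0 hs.
  have hr : (fun N => spath N (idx N x)) @ \oo --> r by move/fine_cvgP: hs => [_ hs'].
  rewrite /sqrte -EFinD abse_EFin -EFinM /Psi0e ger0_norm ?addr_ge0 ?sqrtr_ge0//.
  apply: cvg_EFin; first by near=> n.
  apply: Psi0_cvg => [n||]; rewrite ?mulr_ge0 ?addr_ge0 ?sqrtr_ge0// ?ltW//.
  apply: cvgM; first exact: cvg_cst.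
  apply: cvgD; first exact: cvg_cst.
  by apply: (@continuous_cvg _ _ _ _ _ (fun n => spath n (idx n x)) (@Num.sqrt R)) => //; exact: sqrt_continuous.
rewrite /sqrte addey// /= mulry gtr0_sg// mul1e.
have e0 : 0 < expR 1 :> R by rewrite expR_gt0.
(* The square function is infinite here. By [sqrt_le_Psi0], [Psi0] is at least [A] once its argument
   is at least [(e + 2 |A|)^2]. *)
apply/cvgeyPge => A; have /cvgeyPge/(_ ((l * (expR 1 + 2 * `|A|) ^+ 2) ^+ 2)) := hs.
apply: filterS => n; rewrite !lee_fin => h.
have B0 : 0 <= expR 1 + 2 * `|A| by rewrite addr_ge0 ?mulr_ge0// ltW.
have h1 : l * (expR 1 + 2 * `|A|) ^+ 2 <= Num.sqrt (spath n (idx n x)).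
  have B1 : 0 <= l * (expR 1 + 2 * `|A|) ^+ 2 by rewrite mulr_ge0 ?sqr_ge0 ?ltW.
  by rewrite -(ger0_norm B1) -sqrtr_sqr ler_wsqrtr.
set t := l^-1 * (normc (hd0 f) + Num.sqrt (spath n (idx n x))).
have h2 : (expR 1 + 2 * `|A|) ^+ 2 <= t.
  by rewrite /t ler_pdivlMl// (le_trans h1)// lerDr.
have t0 : 0 <= t by apply: le_trans h2; rewrite sqr_ge0.
have h3 := sqrt_le_Psi0 t0.
have h4 : expR 1 + 2 * `|A| <= Num.sqrt (expR 1 + t).
  by rewrite -(ger0_norm B0) -sqrtr_sqr ler_wsqrtr// (le_trans h2)// lerDr ltW.
rewrite /node_level -/t; have := ler_norm A; lra.
Unshelve. all: by end_near.
Qed.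

Lemma mean_node_level N :
  (\int[mu]_x (node_level l N (idx N x))%:E)%E = (pi2 * mean N (node_level l N))%:E.
Proof.
rewrite -(Rint_mean hdelta N (node_level l N)) /Rint /Rintegral fineK//.
by apply: integrable_fin_num => //; exact: (bndm_integrable hdelta (bndm_step _ N (node_level l N))).
Qed.

(** Monotone convergence. It reduces membership and quasi-norm to estimates on finite trees that are
    uniform in [N]. *)
Lemma square_int_le Y : (\int[mu]_x Psi0e ((l^-1)%:E * `|square_fun delta f x|) <= Y%:E)%E <->
  forall N, pi2 * mean N (node_level l N) <= Y.
Proof.
set g := fun N x => (node_level l N (idx N x))%:E.
have ghomo x : {homo (g^~ x) : n m / (n <= m)%N >-> (n <= m)%E}.
  by move=> n m nm; rewrite lee_fin node_level_homo.
have IE : (\int[mu]_x Psi0e ((l^-1)%:E * `|square_fun delta f x|) =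
    \int[mu]_x (limn (g^~ x)))%E.
  by apply: eq_integral => x _; apply/esym/cvg_lim => //; exact: node_level_cvg.
have J : (\int[mu]_x g N x)%E @[N --> \oo] --> (\int[mu]_x (limn (g^~ x)))%E.
  apply: cvg_monotone_convergence => //.
  - move=> n; apply/measurable_EFinP; exact: (bndm_step _ n (node_level l n)).1.
  - by move=> n x _; rewrite lee_fin node_level_ge0.
have JE N : (\int[mu]_x g N x)%E = (pi2 * mean N (node_level l N))%:E by exact: mean_node_level.
rewrite IE; split=> [h N|h].
  rewrite -lee_fin -JE; apply: le_trans h.
  have Jh : {homo (fun N => \int[mu]_x g N x)%E : n m / (n <= m)%N >-> (n <= m)%E}.
    move=> n m nm; apply: ge0_le_integral => //.
    - by move=> x _; rewrite lee_fin node_level_ge0.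
    - apply/measurable_EFinP; exact: (bndm_step _ n (node_level l n)).1.
    - apply/measurable_EFinP; exact: (bndm_step _ m (node_level l m)).1.
    - by move=> x _; exact: ghomo.
  rewrite -(cvg_lim _ J)//; have := ereal_nondecreasing_cvgn Jh => /cvg_lim -> //.
  by apply: ereal_sup_ubound; exists N.
rewrite -(cvg_lim _ J)//; apply: lime_le; first by apply/cvg_ex; eexists; exact: J.
by near=> N; rewrite JE lee_fin.
Unshelve. all: by end_near.
Qed.

End Integral.

Definition square_bound l Y := forall N, mean N (node_level l N) <= Y.

Lemma hlogP : hlog delta f <-> exists Y, square_bound 1 Y.
Proof.
have E : (\int[mu]_x Psi0e (square_fun delta f x) =
    \int[mu]_x Psi0e ((1^-1)%:E * `|square_fun delta f x|))%E.
  apply: eq_integral => x _; rewrite invr1 mul1e gee0_abs//.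
  by rewrite adde_ge0 ?sqrte_ge0// lee_fin normc_ge0.
have p0 := pi2_gt0 R.
rewrite /hlog E; set I := (\int[mu]_x _)%E.
have I0 : (0 <= I)%E.
  apply: integral_ge0 => x _; rewrite invr1 mul1e.
  case: (square_fun delta f x) => [r| |]//=.
  by rewrite lee_fin (moderate_ge0 (Psi0_moderate R)).
split=> [h|[Y h]].
  exists (fine I / pi2) => N; rewrite ler_pdivlMr// mulrC.
  have [+ _] := square_int_le ltr01 (fine I); apply.
  by rewrite fineK// ge0_fin_numE.
apply: (@le_lt_trans _ _ (pi2 * Y)%:E); last by rewrite ltry.
by apply/(square_int_le ltr01) => N; rewrite ler_pM2l.
Qed.

Lemma hlog_normE : hlog_norm delta f =
  ereal_inf [set l%:E | l in [set l : R | 0 < l /\ square_bound l 1]].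
Proof.
rewrite /hlog_norm /Llog_norm; congr (ereal_inf (_ @` _)); apply/seteqP.
have p0 := pi2_gt0 R.
have E l : 0 < l -> ((pi2^-1)%:E * \int[mu]_x Psi0e ((l^-1)%:E * `|square_fun delta f x|) <= 1)%E
    <-> square_bound l 1.
  move=> l0; rewrite lee_pdivrMl// mule1.
  split=> [/(square_int_le l0) h N|h]; first by rewrite -(ler_pM2l p0) mulr1.
  by apply/(square_int_le l0) => N; rewrite -[leRHS]mulr1 ler_pM2l.
by split=> l /= [l0 /(E _ l0) h].
Qed.

End Coefficients.
End Nodes.

(** * Complex limits through real and imaginary parts *)

Section ComplexLimits.
Variable R : realType.

Lemma normc_Re_Im (z : R[i]) : normc z <= `|complex.Re z| + `|complex.Im z|.
Proof.
rewrite -(@ler_pXn2r _ 2) ?nnegrE ?normc_ge0 ?addr_ge0//.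
rewrite normc_sqr sqrrD !real_normK ?num_real//.
by rewrite lerD2r lerDl mulrn_wge0 ?mulr_ge0.
Qed.

Lemma Re_le_normc (z : R[i]) : `|complex.Re z| <= normc z.
Proof.
rewrite -(@ler_pXn2r _ 2) ?nnegrE ?normc_ge0//.
by rewrite normc_sqr real_normK ?num_real// lerDl sqr_ge0.
Qed.

Lemma Im_le_normc (z : R[i]) : `|complex.Im z| <= normc z.
Proof.
rewrite -(@ler_pXn2r _ 2) ?nnegrE ?normc_ge0//.
by rewrite normc_sqr real_normK ?num_real// lerDr sqr_ge0.
Qed.

Lemma cvg_complexP (u : nat -> R[i]) (v : R[i]) : (u n @[n --> \oo] --> (v : R[i]^o)) <->
  (fun n => complex.Re (u n)) @ \oo --> complex.Re v /\
  (fun n => complex.Im (u n)) @ \oo --> complex.Im v.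
Proof.
split=> [/(@cvgrPdistC_le _ R[i]^o) h|[/cvgnP hr /cvgnP hi]].
  have H e : 0 < e -> exists N, forall n, (N <= n)%N -> normc (u n - v) <= e.
    move=> e0; have [|N _ hN] := h e%:C%C; first by rewrite ltcR.
    by exists N => n /hN; rewrite /= -[`|_|]/((normc (u n - v))%:C%C) lecR.
  split; apply/cvgnP => e /H[N hN]; exists N => n /hN; apply: le_trans.
    by have := Re_le_normc (u n - v); rewrite raddfB.
  by have := Im_le_normc (u n - v); rewrite raddfB.
apply/(@cvgrPdistC_le _ R[i]^o) => -[e e'] e0.
have {e0} [e0 e'0] : 0 < e /\ e' = 0.
  by move: e0; rewrite ltcE /= => /andP[/eqP -> ->].
have e2 : 0 < e / 2 by rewrite divr_gt0.
have [N hN] := hr _ e2; have [N' hN'] := hi _ e2.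
exists (maxn N N') => // n /=; rewrite geq_max => /andP[/hN h1 /hN' h2].
rewrite -[`|_|]/((normc (u n - v))%:C%C) e'0 lecR.
apply: le_trans (normc_Re_Im _) _; rewrite !raddfB; move: h1 h2; lra.
Qed.

End ComplexLimits.

(** * Essential bounds and nonnegative series *)

Section Linfty.
Variable R : realType.
Notation mu := (torus_measure R).

Lemma torus_gt0 : (0 < mu setT)%E.
Proof.
have d0 : 0 <= (0 : R) < 1 by rewrite lexx ltr01.
by rewrite (mu_setT d0) lte_fin pi2_gt0.
Qed.

Lemma ae_mono (P Q : R -> Prop) : (forall x, P x -> Q x) ->
  {ae mu, forall x, P x} -> {ae mu, forall x, Q x}.
Proof.
move=> PQ [A [mA A0 AP]]; exists A; split=> //.
by apply: subset_trans AP => x nQ /PQ.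
Qed.

Lemma Linfty_leP (f : R -> R[i]) y :
  (Linfty_norm f <= y)%E <-> {ae mu, forall x, ((normc (f x))%:E <= y)%E}.
Proof.
rewrite /Linfty_norm unlock torus_gt0.
split=> [/ess_supP|h].
  by apply: ae_mono => x /=; rewrite ger0_norm ?normc_ge0.
by apply/ess_supP; move: h; apply: ae_mono => x /=; rewrite ger0_norm ?normc_ge0.
Qed.

Lemma Linfty_ge0 (f : R -> R[i]) : (0 <= Linfty_norm f)%E.
Proof.
rewrite /Linfty_norm unlock torus_gt0; apply: ess_sup_gee; first exact: torus_gt0.
by apply: nearW => x; rewrite abse_ge0.
Qed.

Lemma nneseries_leP (u : nat -> R) Y : (forall k, 0 <= u k) ->
  (\sum_(0 <= k <oo) (u k)%:E <= Y%:E)%E <-> forall K, psum u K <= Y.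
Proof.
move=> u0; have u0' k : (0 <= (u k)%:E)%E by rewrite lee_fin.
split=> [h K|h].
  rewrite -lee_fin; apply: le_trans h.
  by rewrite /psum -sumEFin -(big_mkord xpredT (fun k => (u k)%:E)); apply: nneseries_lim_ge.
apply: lime_le; first exact: is_cvg_nneseries.
by near=> K; rewrite big_mkord sumEFin lee_fin; exact: h.
Unshelve. all: by end_near.
Qed.

Lemma nneseries_lty (u : nat -> R) : (forall k, 0 <= u k) ->
  (\sum_(0 <= k <oo) (u k)%:E < +oo)%E <-> exists Y, forall K, psum u K <= Y.
Proof.
move=> u0; split=> [h|[Y /nneseries_leP h]]; last exact: le_lt_trans (h u0) (ltry _).
exists (fine (\sum_(0 <= k <oo) (u k)%:E)%E); apply/nneseries_leP => //.
by rewrite fineK// ge0_fin_numE// nneseries_ge0// => k _ _; rewrite lee_fin.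
Qed.

Lemma psum_bounded_cvg (u : nat -> R) Y : (forall k, 0 <= u k) ->
  (forall K, psum u K <= Y) -> cvgn (psum u).
Proof.
move=> u0 h; apply: nondecreasing_is_cvgn.
  by rewrite psumE; exact: nondecreasing_series.
by exists Y => _ [K _ <-].
Qed.

End Linfty.

(** * From atoms to pointwise bounded functions *)

Section Atoms.
Variables (R : realType) (delta : R).
Hypothesis hdelta : 0 <= delta < 1.
Notation arc := (arc delta).
Notation len := (len R).
Notation mu := (torus_measure R).
Notation pi2 := (pi *+ 2 : R).

Lemma Llog_arc_int n m l : (m < 2 ^ n)%N -> 0 < l ->
  ((pi2^-1)%:E * \int[mu]_x Psi0e ((l^-1)%:E * `|(\1_(arc n m) x)%:E|) <= 1)%E <->
  Psi0 (l^-1) <= 2 ^+ n.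
Proof.
move=> mn l0; have p0 := pi2_gt0 R.
have -> : (\int[mu]_x Psi0e ((l^-1)%:E * `|(\1_(arc n m) x)%:E|))%E = (Psi0 (l^-1) * len n)%:E.
  rewrite -(Rint_indic hdelta mn) -(RintZ hdelta) ; last exact: bndm_arc_indic.
  rewrite /Rint /Rintegral fineK.
    apply: eq_integral => x _; rewrite abse_EFin /= indic_arc.
    by case: eqP => _; rewrite normr_nat /= ?mulr1// mulr0 (moderate0 (Psi0_moderate R)) mulr0.
  apply: integrable_fin_num => //; apply: (bndm_integrable hdelta).
  exact/bndmZ/bndm_arc_indic.
rewrite -EFinM lee_fin (_ : pi2^-1 * _ = Psi0 l^-1 / 2 ^+ n).
  by rewrite ler_pdivrMr ?exprn_gt0// mul1r.
by rewrite /len mulrCA mulKf// gt_eqF.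
Qed.

Lemma Llog_arc_le1 n m : (m < 2 ^ n)%N -> (Llog_norm (fun x => (\1_(arc n m) x)%:E) <= 1)%E.
Proof.
move=> mn; apply: ereal_inf_lbound; exists 1 => //; split => //.
apply/(Llog_arc_int mn ltr01); rewrite invr1.
by apply: le_trans (Psi0_le ler01) _; rewrite -[leLHS](expr1n _ n) lerXn2r ?nnegrE// ler1n.
Qed.

Definition atom_scale n : R := (expR 1 + 2 * 2 ^+ n) ^+ 2.

Lemma atom_scale_gt0 n : 0 < atom_scale n.
Proof. by rewrite exprn_gt0// addr_gt0 ?expR_gt0// mulr_gt0 ?exprn_gt0. Qed.

(** If [Psi0 (l^-1) <= 2 ^+ n], then [sqrt_le_Psi0] bounds [l^-1] by [atom_scale n]. Positivity of
    the norm is what makes a bounded mean-zero function on an arc a multiple of an atom. *)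
Lemma Llog_arc_ge n m : (m < 2 ^ n)%N ->
  (((atom_scale n)^-1)%:E <= Llog_norm (fun x => (\1_(arc n m) x)%:E))%E.
Proof.
move=> mn; apply: le_ereal_inf_tmp => _ [l [l0 /(Llog_arc_int mn l0) h] <-].
have li0 : 0 < l^-1 by rewrite invr_gt0.
have e0 : 0 < expR 1 :> R by rewrite expR_gt0.
rewrite lee_fin -[leRHS]invrK lef_pV2 ?posrE ?atom_scale_gt0//.
have := sqrt_le_Psi0 (ltW li0); rewrite /atom_scale => h1.
apply: (@le_trans _ _ (expR 1 + l^-1)); first by rewrite lerDr ltW.
rewrite -(@sqr_sqrtr _ (expR 1 + l^-1)); last by rewrite addr_ge0// ltW.
have hT : Num.sqrt (expR 1 + l^-1) <= expR 1 + 2 * 2 ^+ n.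
  by apply: le_trans h1 _; rewrite lerD2l ler_pM2l.
by rewrite !expr2 ler_pM// sqrtr_ge0.
Qed.

Lemma Re_mul (z w : R[i]) : complex.Re (z * w) =
  complex.Re z * complex.Re w - complex.Im z * complex.Im w.
Proof. by case: z w => [? ?] []. Qed.

Lemma Im_mul (z w : R[i]) : complex.Im (z * w) =
  complex.Re z * complex.Im w + complex.Im z * complex.Re w.
Proof. by case: z w => [? ?] []. Qed.

Lemma pairing_part (f phi : R -> R[i]) :
  bndm (fun x => complex.Re (f x)) -> bndm (fun x => complex.Im (f x)) ->
  bndm (fun x => complex.Re (phi x)) -> bndm (fun x => complex.Im (phi x)) ->
  complex.Re (torus_integral (fun x => f x * phi x)) =
    Rint (fun x => complex.Re (f x) * complex.Re (phi x)) -
    Rint (fun x => complex.Im (f x) * complex.Im (phi x)) /\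
  complex.Im (torus_integral (fun x => f x * phi x)) =
    Rint (fun x => complex.Re (f x) * complex.Im (phi x)) +
    Rint (fun x => complex.Im (f x) * complex.Re (phi x)).
Proof.
move=> fr fi pr pim; split.
  rewrite -(RintB hdelta (bndmM fr pr) (bndmM fi pim)) /=.
  by congr Rint; apply/funext => x; exact: Re_mul.
rewrite -(RintD hdelta (bndmM fr pim) (bndmM fi pr)) /=.
by congr Rint; apply/funext => x; exact: Im_mul.
Qed.

Lemma ae_Rint (f g : R -> R) : measurable_fun setT (f : measurableTypeR R -> measurableTypeR R) -> bndm g ->
  {ae mu, forall x, f x = g x} -> \int[mu]_x f x = Rint g.
Proof.
move=> mf [mg _] h; rewrite /Rint /Rintegral; congr fine; apply: ae_eq_integral => //.
- exact/measurable_EFinP.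
- exact/measurable_EFinP.
- by move: h; apply: ae_mono => x /= ->.
Qed.

Section Clip.
Variables (n m : nat) (r : R) (f : R -> R[i]).
Hypothesis mn : (m < 2 ^ n)%N.
Hypothesis fm : measurable_fun [set: R] (fun x => complex.Re (f x)) /\
  measurable_fun [set: R] (fun x => complex.Im (f x)).
Hypothesis f0 : forall x, ~ arc n m x -> f x = 0.
Hypothesis fI : torus_integral f = 0.
Hypothesis fr : Linfty_norm f = r%:E.

(** The norm bounds [f] only almost everywhere. Setting [f] to [0] where the bound fails yields a
    pointwise bound and changes no pairing. *)
Definition clip (x : R) : R[i] := if normc (f x) <= r then f x else 0.

Let r0 : 0 <= r.
Proof. by rewrite -lee_fin -fr Linfty_ge0. Qed.

Let S : set R := [set x | normc (f x) <= r].

Lemma measurable_normc : measurable_fun [set: R] (fun x => normc (f x)).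
Proof.
have [mr mi] := fm.
rewrite (_ : (fun x => _) = (fun x => Num.sqrt (complex.Re (f x) ^+ 2 + complex.Im (f x) ^+ 2))); last first.
  by apply/funext => x; rewrite -normc_sqr sqrtr_sqr ger0_norm// normc_ge0.
apply: (measurableT_comp (f := @Num.sqrt R)).
  by apply: continuous_measurable_fun; exact: sqrt_continuous.
by apply: measurable_funD; apply: measurable_funX.
Qed.

Let mS : measurable (S : set (measurableTypeR R)).
Proof.
have -> : S = setT `&` (fun x => normc (f x)) @^-1` `]-oo, r].
  by apply/seteqP; split=> x; rewrite /S /= in_itv /=; [move=> ->|case].
exact: measurable_normc.
Qed.

Let clip_part (L : R[i] -> R) x : L 0 = 0 -> L (clip x) = L (f x) * \1_S x.
Proof.
move=> L0; rewrite /clip indicE; case: ifP => h.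
  by rewrite mem_set ?mulr1.
by rewrite memNset ?mulr0// /S /= h.
Qed.

Lemma clip_le x : normc (clip x) <= r * \1_(arc n m) x.
Proof.
have n0 : normc (0 : R[i]) = 0 by rewrite normc0.
rewrite /clip indic_arc; case: eqP => [_|ne].
  by rewrite mulr1; case: ifP => //; rewrite n0.
by rewrite f0// if_same n0 mulr0.
Qed.

Lemma clip_ae : {ae mu, forall x, clip x = f x}.
Proof.
have : (Linfty_norm f <= r%:E)%E by rewrite fr.
by move/Linfty_leP; apply: ae_mono => x; rewrite lee_fin /clip => ->.
Qed.

Lemma clip_bndm (L : R[i] -> R) : (forall z, `|L z| <= normc z) -> 
  measurable_fun [set: R] (fun x => L (f x)) -> bndm (fun x => L (clip x)).
Proof.
move=> LN mL; have L0 : L 0 = 0.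
  by apply/eqP; rewrite -normr_le0; apply: le_trans (LN 0) _; rewrite normc0.
split; last first.
  exists r => x; apply: le_trans (LN _) _; apply: le_trans (clip_le x) _.
  by rewrite indic_arc; case: eqP => _; rewrite ?mulr1 ?mulr0.
rewrite (_ : (fun x => _) = (fun x => L (f x) * \1_S x)); last first.
  by apply/funext => x; exact: clip_part.
by apply: measurable_funM => //; exact: measurable_indic.
Qed.

Let mRe := clip_bndm (@Re_le_normc R) fm.1.
Let mIm := clip_bndm (@Im_le_normc R) fm.2.

Lemma clip_Re : batom delta n m r (fun x => complex.Re (clip x)).
Proof.
split=> // [x|]; first exact: le_trans (Re_le_normc _) (clip_le x).
rewrite -(@ae_Rint (fun x => complex.Re (f x)) _ fm.1 mRe).
  by have := congr1 (@complex.Re R) fI.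
by move: clip_ae; apply: ae_mono => x ->.
Qed.

Lemma clip_Im : batom delta n m r (fun x => complex.Im (clip x)).
Proof.
split=> // [x|]; first exact: le_trans (Im_le_normc _) (clip_le x).
rewrite -(@ae_Rint (fun x => complex.Im (f x)) _ fm.2 mIm).
  by have := congr1 (@complex.Im R) fI.
by move: clip_ae; apply: ae_mono => x ->.
Qed.

Lemma clip_pairing (phi : R -> R[i]) :
  bndm (fun x => complex.Re (phi x)) -> bndm (fun x => complex.Im (phi x)) ->
  torus_integral (fun x => f x * phi x) = torus_integral (fun x => clip x * phi x).
Proof.
move=> pr pim; have [mr mi] := fm.
have E (L : R[i] -> R) : measurable_fun setT ((fun x => L (f x * phi x)) : measurableTypeR R -> measurableTypeR R) ->
    bndm (fun x => L (clip x * phi x)) ->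
    \int[mu]_x L (f x * phi x) = \int[mu]_x L (clip x * phi x).
  move=> h1 h2; rewrite (ae_Rint h1 h2)//.
  by move: clip_ae; apply: ae_mono => x ->.
rewrite /torus_integral; congr (_ +i* _)%C.
  apply: E.
    rewrite (funext (fun x => Re_mul (f x) (phi x))).
    by apply: measurable_funB; apply: measurable_funM => //; [exact: pr.1|exact: pim.1].
  rewrite (funext (fun x => Re_mul (clip x) (phi x))).
  by apply: bndmB; exact: bndmM.
apply: E.
  rewrite (funext (fun x => Im_mul (f x) (phi x))).
  by apply: measurable_funD; apply: measurable_funM => //; [exact: pim.1|exact: pr.1].
rewrite (funext (fun x => Im_mul (clip x) (phi x))).
by apply: bndmD; exact: bndmM.
Qed.

End Clip.

Lemma Linfty_scale (c : R[i]) (a : R -> R[i]) (K : R) : (Linfty_norm a <= K%:E)%E ->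
  (Linfty_norm (fun x => (c * a x)%R) <= (normc c * K)%:E)%E.
Proof.
move=> /Linfty_leP h; apply/Linfty_leP; move: h; apply: ae_mono => x.
by rewrite !lee_fin normcM => h; rewrite ler_wpM2l ?normc_ge0.
Qed.

Lemma torus_integralZ (c : R[i]) (a : R -> R[i]) (r : R) : (Linfty_norm a <= r%:E)%E ->
  measurable_fun [set: R] (fun x => complex.Re (a x)) /\ measurable_fun [set: R] (fun x => complex.Im (a x)) ->
  torus_integral a = 0 -> torus_integral (fun x => c * a x) = 0.
Proof.
move=> ar [mr mi] a0; have ir : mu.-integrable setT (EFin \o (fun x => complex.Re (a x))) /\
  mu.-integrable setT (EFin \o (fun x => complex.Im (a x))).
  have H (L : R[i] -> R) : (forall z, `|L z| <= normc z) -> measurable_fun [set: R] (fun x => L (a x)) ->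
      mu.-integrable setT (EFin \o (fun x => L (a x))).
    move=> LN mL; apply/integrableP; split; first exact/measurable_EFinP.
    apply: (@le_lt_trans _ _ (\int[mu]_x `|r|%:E)%E).
      apply: ae_ge0_le_integral => //=.
      - by apply/measurable_EFinP; apply: measurableT_comp.
      - move/Linfty_leP: ar; apply: ae_mono => x; rewrite lee_fin => h _.
        by rewrite lee_fin (le_trans (LN _))// (le_trans h)// ler_norm.
    by rewrite integral_cst// (mu_setT hdelta) -EFinM ltry.
  by split; [exact: (H _ (@Re_le_normc R) mr)|exact: (H _ (@Im_le_normc R) mi)].
have [ira iia] := ir; have [h1 h2] : \int[mu]_x complex.Re (a x) = 0 /\ \int[mu]_x complex.Im (a x) = 0.
  by move: a0; rewrite /torus_integral => -[-> ->].
have iz (k : R) (g : R -> R) : mu.-integrable setT (EFin \o g) -> mu.-integrable setT (EFin \o (fun x => k * g x)).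
  by move=> ig; have := integrableZl measurableT k ig; apply: eq_integrable.
rewrite /torus_integral.
rewrite (funext (fun x => Re_mul c (a x))) (funext (fun x => Im_mul c (a x))).
rewrite RintegralB ?RintegralD ?RintegralZl ?h1 ?h2//; try exact: iz.
by rewrite !mulr0 subr0 addr0.
Qed.

Section Decomposition.
Variables (F : torus_dist R) (b : atom_seq R).
Hypothesis Fb : atomic_decomp delta F b.

Definition abound k : R := fine (Linfty_norm (atom_fun b k)).
Definition aclip k : R -> R[i] := clip (abound k) (atom_fun b k).

Let atomP k : [/\ measurable_fun [set: R] (fun x => complex.Re (atom_fun b k x)) /\
  measurable_fun [set: R] (fun x => complex.Im (atom_fun b k x)),
  forall x, ~ arc (tag (atom_arc b k)) (tagged (atom_arc b k)) x -> atom_fun b k x = 0,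
  torus_integral (atom_fun b k) = 0 & Linfty_norm (atom_fun b k) = (abound k)%:E].
Proof.
have [/(_ k)[c [a [[pa [mr mi] a0 aI aL] aE]]] _ _] := Fb.
have a1 : (Linfty_norm a <= 1%:E)%E.
  by apply: le_trans aL _; rewrite darcE; exact: Llog_arc_le1.
rewrite /abound aE; split.
- rewrite (funext (fun x => Re_mul c (a x))) (funext (fun x => Im_mul c (a x))).
  by split; [apply: measurable_funB|apply: measurable_funD]; apply: measurable_funM.
- by move=> x; rewrite -darcE => /a0 ->; rewrite mulr0.
- exact: (torus_integralZ c a1).
- rewrite fineK// ge0_fin_numE ?Linfty_ge0//.
  exact: (le_lt_trans (Linfty_scale c a1) (ltry _)).
Qed.

Lemma Linfty_atom k : Linfty_norm (atom_fun b k) = (abound k)%:E.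
Proof. by case: (atomP k). Qed.

Lemma aclip_Re k : batom delta (tag (atom_arc b k)) (tagged (atom_arc b k)) (abound k)
  (fun x => complex.Re (aclip k x)).
Proof. by case: (atomP k) => h1 h2 h3 h4; exact: clip_Re. Qed.

Lemma aclip_Im k : batom delta (tag (atom_arc b k)) (tagged (atom_arc b k)) (abound k)
  (fun x => complex.Im (aclip k x)).
Proof. by case: (atomP k) => h1 h2 h3 h4; exact: clip_Im. Qed.

Lemma abound_ge0 k : 0 <= abound k.
Proof. by rewrite -lee_fin -Linfty_atom Linfty_ge0. Qed.

Lemma atom_pairing k (phi : R -> R[i]) :
  bndm (fun x => complex.Re (phi x)) -> bndm (fun x => complex.Im (phi x)) ->
  complex.Re (torus_integral (fun x => atom_fun b k x * phi x)) =
    Rint (fun x => complex.Re (aclip k x) * complex.Re (phi x)) -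
    Rint (fun x => complex.Im (aclip k x) * complex.Im (phi x)) /\
  complex.Im (torus_integral (fun x => atom_fun b k x * phi x)) =
    Rint (fun x => complex.Re (aclip k x) * complex.Im (phi x)) +
    Rint (fun x => complex.Im (aclip k x) * complex.Re (phi x)).
Proof.
move=> pr pim; case: (atomP k) => h1 h2 h3 h4.
rewrite (clip_pairing h1 h2 h4 pr pim).
by apply: pairing_part => //; [exact: (batom_bndm (aclip_Re k))|exact: (batom_bndm (aclip_Im k))].
Qed.

Lemma atom_cost_ge0 l k : 0 < l -> 0 <= len (tag (atom_arc b k)) * Psi0 (l^-1 * abound k).
Proof.
move=> l0; rewrite (mulr_ge0 (len_ge0 R _))//.
by rewrite (moderate_ge0 (Psi0_moderate R)) ?mulr_ge0 ?abound_ge0// invr_ge0 ltW.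
Qed.

Lemma atom_costE l k : ((arc_len delta (atom_arc b k))%:E * Psi0e ((l^-1)%:E * Linfty_norm (atom_fun b k)))%E =
  (len (tag (atom_arc b k)) * Psi0 (l^-1 * abound k))%:E.
Proof. by rewrite (arc_lenE hdelta) Linfty_atom -EFinM. Qed.

Lemma abound_weight : cvgn (psum (fun k => weight (abound k) (tag (atom_arc b k)))).
Proof.
apply: weight_summable; first exact: abound_ge0.
have [_ _] := Fb; rewrite (eq_eseriesr (g := fun k => (len (tag (atom_arc b k)) * Psi0 (1^-1 * abound k))%:E)); last first.
  by move=> k _; rewrite -atom_costE invr1 mul1e.
move/nneseries_lty => [k|Y h]; first exact: atom_cost_ge0.
have p0 := pi2_gt0 R; apply: (@psum_bounded_cvg _ _ (Y / pi2)) => [k|K].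
  by rewrite divr_ge0 ?exprn_ge0// (moderate_ge0 (Psi0_moderate R)) ?abound_ge0.
rewrite ler_pdivlMr//; apply: le_trans (h K).
rewrite /psum big_distrl /=; apply: ler_sum => k _.
by rewrite invr1 mul1r /len mulrC mulrA mulrAC.
Qed.

End Decomposition.

End Atoms.

(** * Pairings of Haar sums and atomic series with test functions *)

Section Expansion.
Variables (R : realType) (delta : R).
Hypothesis hdelta : 0 <= delta < 1.
Notation idx := (idx delta).
Notation dif := (dif delta).
Notation pi2 := (pi *+ 2 : R).

Lemma test_tame (phi : test_fun R) : exists M M',
  tame delta M (fun x => complex.Re (phi x)) /\ tame delta M' (fun x => complex.Im (phi x)).
Proof.
have /asboolP[pp sr si] := test_valP phi.
have [|M hM] := tame_smooth delta sr; first by move=> x; rewrite pp.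
have [|M' hM'] := tame_smooth delta si; first by move=> x; rewrite pp.
by exists M, M'.
Qed.

Lemma test_bndm (phi : test_fun R) :
  bndm (fun x => complex.Re (phi x)) /\ bndm (fun x => complex.Im (phi x)).
Proof. by have [M [M' [[] ? _ _ [] ? _ _]]] := test_tame phi. Qed.

Lemma complexP (z w : R[i]) : complex.Re z = complex.Re w -> complex.Im z = complex.Im w -> z = w.
Proof. by case: z w => [? ?] [? ?] /= -> ->. Qed.

Lemma cvg_complex_addl (c : R[i]) (u : nat -> R[i]) (v : R[i]) :
  u n @[n --> \oo] --> (v : R[i]^o) -> (c + u n) @[n --> \oo] --> (c + v : R[i]^o).
Proof.
move=> /cvg_complexP[hr hi]; apply/cvg_complexP; rewrite !raddfD.
by split; under eq_fun do rewrite raddfD; (apply: cvgD; [exact: cvg_cst|]).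
Qed.

(* The complex bilinear pairing whose real and imaginary parts combine the
   real pairings S L g of a part L of the data with a part g of phi. *)
Definition bilin (S : (R[i] -> R) -> (R -> R) -> R) (phi : R -> R[i]) : R[i] :=
  Complex
    (S (@complex.Re R) (fun x => complex.Re (phi x)) - S (@complex.Im R) (fun x => complex.Im (phi x)))
    (S (@complex.Re R) (fun x => complex.Im (phi x)) + S (@complex.Im R) (fun x => complex.Re (phi x))).

Lemma bilin_cvg (S : nat -> (R[i] -> R) -> (R -> R) -> R) S' phi :
  (forall L, L = @complex.Re R \/ L = @complex.Im R -> forall g,
    g = (fun x => complex.Re (phi x)) \/ g = (fun x => complex.Im (phi x)) ->
    (fun N => S N L g) @ \oo --> S' L g) ->
  (fun N => bilin (S N) phi) n @[n --> \oo] --> (bilin S' phi : R[i]^o).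
Proof.
move=> h; apply/cvg_complexP; split=> /=.
  by apply: cvgB; apply: h; [left|left|right|right].
by apply: cvgD; apply: h; [left|right|right|left].
Qed.

Lemma pairing_bilin (f : R -> R[i]) (phi : test_fun R) :
  bndm (fun x => complex.Re (f x)) -> bndm (fun x => complex.Im (f x)) ->
  pairing f phi = bilin (fun L g => Rint (fun x => L (f x) * g x)) phi.
Proof.
move=> fr fi; have [pr pim] := test_bndm phi.
have [h1 h2] := pairing_part hdelta fr fi pr pim.
by apply: complexP; rewrite ?h1 ?h2.
Qed.

Lemma eq_bilin S S' phi : (forall L, L = @complex.Re R \/ L = @complex.Im R -> forall g,
    g = (fun x => complex.Re (phi x)) \/ g = (fun x => complex.Im (phi x)) -> S L g = S' L g) ->
  bilin S phi = bilin S' phi.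
Proof.
by move=> h; rewrite /bilin !h//; [right|left|left|right|right|right|left|left]. 
Qed.

Lemma bilinD S S' phi : bilin (fun L g => S L g + S' L g) phi = bilin S phi + bilin S' phi.
Proof. by apply: complexP; rewrite /bilin /=; ring. Qed.

Lemma bilin_sum n (S : nat -> (R[i] -> R) -> (R -> R) -> R) phi :
  bilin (fun L g => \sum_(k < n) S k L g) phi = \sum_(k < n) bilin (S k) phi.
Proof.
elim: n => [|n IH].
  by rewrite big_ord0 /bilin !big_ord0 subr0 addr0.
rewrite big_ord_recr /= -IH -bilinD; apply: eq_bilin => L _ g _.
by rewrite big_ord_recr.
Qed.

Section Part.
Variable L : R[i] -> R.
Hypothesis hL : L = @complex.Re R \/ L = @complex.Im R.

Lemma part_D z w : L (z + w) = L z + L w.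
Proof. by case: hL => ->; rewrite raddfD. Qed.

Lemma part_B z w : L (z - w) = L z - L w.
Proof. by case: hL => ->; rewrite raddfB. Qed.

Lemma part_le z : `|L z| <= normc z.
Proof. by case: hL => ->; [exact: Re_le_normc|exact: Im_le_normc]. Qed.

End Part.

Definition haar_part (d : nat -> nat -> R[i]) N (L : R[i] -> R) (g : R -> R) : R :=
  pi2 * \sum_(n < N) mean n (fun m => L (d n m) * dif g n m).

Lemma bndm_haar (f : haar_data R) N (L : R[i] -> R) : L = @complex.Re R \/ L = @complex.Im R ->
  bndm (fun x => L (haar_sum delta f N x)).
Proof.
move=> hL; rewrite (funext (haar_sumE hdelta f N)).
rewrite (_ : (fun x => _) = (fun x => L (hd0 f) + L (mart (dcoef f) N.+3 (idx N.+3 x)))); last first.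
  by apply/funext => x; rewrite part_D.
apply: bndmD; first exact: bndm_cst.
exact: (bndm_step delta N.+3 (fun j => L (mart (dcoef f) N.+3 j))).
Qed.

Lemma haar_pairing (f : haar_data R) N (phi : test_fun R) :
  pairing (haar_sum delta f N) phi =
  pairing (fun=> hd0 f) phi + bilin (haar_part (dcoef f) N.+3) phi.
Proof.
have [pr pim] := test_bndm phi.
have cb L : bndm (fun _ : R => L (hd0 f) : R) := bndm_cst _.
rewrite pairing_bilin; [|by apply: bndm_haar; left|by apply: bndm_haar; right].
rewrite pairing_bilin// -bilinD; apply: eq_bilin => L hL g hg.
have bg : bndm g by case: hg => ->.
have bm := bndm_step delta N.+3 (fun j => L (mart (dcoef f) N.+3 j)).
rewrite /haar_part -(Rint_mart_pair hdelta (part_D hL) (part_B hL))//.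
rewrite -(RintD hdelta (bndmM (cb L) bg) (bndmM bg bm)); congr Rint; apply/funext => x.
by rewrite (haar_sumE hdelta) (part_D hL) mulrDl [X in _ + X = _]mulrC.
Qed.

Definition atom_family (nk mk : nat -> nat) (bk : nat -> R) (B : nat -> R -> R[i]) :=
  (forall L, L = @complex.Re R \/ L = @complex.Im R ->
    forall k, batom delta (nk k) (mk k) (bk k) (fun x => L (B k x))) /\
  cvgn (psum (fun k => weight (bk k) (nk k))).

Definition atom_sum (B : nat -> R -> R[i]) (L : R[i] -> R) (g : R -> R) : R :=
  limn (psum (fun k => Rint (fun x => L (B k x) * g x))).

Section Family.
Variables (nk mk : nat -> nat) (bk : nat -> R) (B : nat -> R -> R[i]).
Hypothesis hB : atom_family nk mk bk B.

Lemma family_pairing k (phi : test_fun R) :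
  pairing (B k) phi = bilin (fun L g => Rint (fun x => L (B k x) * g x)) phi.
Proof.
have [h _] := hB.
by apply: pairing_bilin; apply: (batom_bndm (h _ _ k)); [left|right].
Qed.

Lemma family_cvg (phi : test_fun R) :
  (\sum_(k < n) pairing (B k) phi) @[n --> \oo] --> (bilin (atom_sum B) phi : R[i]^o).
Proof.
have [h w] := hB; have [M [M' [tr ti]]] := test_tame phi.
rewrite (_ : (fun n => _) = (fun n => bilin (fun L g => psum (fun k => Rint (fun x => L (B k x) * g x)) n) phi)); last first.
  apply/funext => n; rewrite /psum (bilin_sum n (fun k L g => Rint (fun x => L (B k x) * g x))).
  by apply: eq_bigr => k _; exact: family_pairing.
apply: (@bilin_cvg (fun n L g => psum (fun k => Rint (fun x => L (B k x) * g x)) n)) => L hL g [] ->.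
  exact: (pair_cvg hdelta (h L hL) w tr).
exact: (pair_cvg hdelta (h L hL) w ti).
Qed.

Variable f : haar_data R.
Hypothesis fB : forall L, L = @complex.Re R \/ L = @complex.Im R -> forall n m, (m < 2 ^ n)%N ->
  coef delta (fun k x => L (B k x)) n m = L (dcoef f n m).

Lemma haar_cvg_family : cvg_dist (fun N => pairing (haar_sum delta f N))
  (fun phi => pairing (fun=> hd0 f) phi + bilin (atom_sum B) phi).
Proof.
move=> phi; have [h w] := hB; have [M [M' [tr ti]]] := test_tame phi.
under eq_fun do rewrite haar_pairing.
apply: cvg_complex_addl.
apply: (@bilin_cvg (fun n => haar_part (dcoef f) n.+3)) => L hL g hg.
have [K tg] : exists K, tame delta K g by case: hg => ->; [exists M|exists M'].
have := haar_cvg hdelta (h L hL) w tg.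
rewrite (_ : (fun N => _) = (fun N => haar_part (dcoef f) N L g)); last first.
  apply/funext => N; congr (_ * _); apply: eq_bigr => n _; apply: eq_mean => m mn.
  by rewrite fB.
(* The Haar sum of index [N] comprises [N + 3] generations. *)
by move=> c; rewrite -(cvg_shiftn 3) in c; under eq_fun do rewrite -addn3.
Qed.

End Family.

End Expansion.

(** * Passage between Haar data and atomic decompositions *)

Section Decompositions.
Variables (R : realType) (delta : R).
Hypothesis hdelta : 0 <= delta < 1.
Notation idx := (idx delta).
Notation len := (len R).
Notation pi2 := (pi *+ 2 : R).

Let Psi0_mod := Psi0_moderate R.

Lemma cvg_complex_unique (u : nat -> R[i]) (v w : R[i]) :
  u n @[n --> \oo] --> (v : R[i]^o) -> u n @[n --> \oo] --> (w : R[i]^o) -> v = w.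
Proof.
move=> /cvg_complexP[vr vi] /cvg_complexP[wr wi].
by apply: complexP; [rewrite -(cvg_lim _ vr)// -(cvg_lim _ wr)|rewrite -(cvg_lim _ vi)// -(cvg_lim _ wi)].
Qed.

Lemma Psi0_rescale (l t : R) : 0 < l -> 0 <= t -> Psi0 t <= (1 + l) * Psi0 (l^-1 * t).
Proof.
move=> l0 t0; have s0 : 0 <= l^-1 * t by rewrite mulr_ge0// invr_ge0 ltW.
have -> : Psi0 t = Psi0 (l * (l^-1 * t)) by rewrite mulVKf// gt_eqF.
apply: le_trans (moderate_scale Psi0_mod _ s0); last by rewrite lerDl ltW.
apply: (moderate_le Psi0_mod); first by rewrite mulr_ge0// ltW.
by rewrite ler_wpM2r// lerDr.
Qed.

Lemma family_weight (nk : nat -> nat) (bk : nat -> R) l Y : 0 < l -> (forall k, 0 <= bk k) ->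
  (forall K, psum (fun k => Psi0 (l^-1 * bk k) / 2 ^+ nk k) K <= Y) ->
  (forall K, psum (fun k => Psi0 (bk k) / 2 ^+ nk k) K <= (1 + l) * Y) /\
  cvgn (psum (fun k => weight (bk k) (nk k))).
Proof.
move=> l0 b0 h; have H K : psum (fun k => Psi0 (bk k) / 2 ^+ nk k) K <= (1 + l) * Y.
  apply: (@le_trans _ _ ((1 + l) * psum (fun k => Psi0 (l^-1 * bk k) / 2 ^+ nk k) K)).
    rewrite /psum mulr_sumr; apply: ler_sum => k _.
    by rewrite mulrA ler_wpM2r ?invr_ge0 ?exprn_ge0//; exact: Psi0_rescale.
  by rewrite ler_wpM2l// addr_ge0// ltW.
split=> //; apply: weight_summable => //; apply: psum_bounded_cvg H => k.
by rewrite divr_ge0 ?exprn_ge0// (moderate_ge0 Psi0_mod).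
Qed.

Lemma pairing_cst (c : R[i]) : pairing (fun=> c) (test_cst 1) = c * pi2%:C%C.
Proof.
rewrite /pairing /torus_integral -!/(Rint _); under eq_fun do rewrite mulr1.
have h (a : R) : Rint (fun _ : R => a) = a * pi2 by rewrite (Rint_cst hdelta).
apply: complexP; rewrite /= ?Re_mul ?Im_mul /= mulr0 ?subr0 ?add0r -h; congr Rint; apply/funext => x /=; by rewrite mulr1.
Qed.

Section Family.
Variables (nk mk : nat -> nat) (bk : nat -> R) (B : nat -> R -> R[i]).
Hypothesis hB : atom_family delta nk mk bk B.

Lemma atom_sum_cst L c : L = @complex.Re R \/ L = @complex.Im R -> atom_sum B L (fun=> c) = 0.
Proof.
move=> hL; have [h _] := hB; rewrite /atom_sum.
rewrite (_ : psum _ = fun=> 0); first by rewrite lim_cst.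
apply/funext => K; rewrite /psum big1// => k _; have [_ bb _ b0] := h L hL k.
rewrite (_ : (fun x => _) = (fun x => c * L (B k x))); last by apply/funext => x; rewrite mulrC.
by rewrite (RintZ hdelta)// b0 mulr0.
Qed.

Variable f : haar_data R.
Hypothesis fB : forall L, L = @complex.Re R \/ L = @complex.Im R -> forall n m, (m < 2 ^ n)%N ->
  coef delta (fun k x => L (B k x)) n m = L (dcoef f n m).

(** Pairing with [1] annihilates every atom and thus isolates [hd0 f]; the remaining part of the
    limit is the atomic series. *)
Lemma family_iota (F : torus_dist R) : is_iota delta f F ->
  fourier0 F = hd0 f /\
  forall phi, F phi - pairing (fun=> fourier0 F) phi = bilin (atom_sum B) phi.
Proof.
move=> fF; have FE phi : F phi = pairing (fun=> hd0 f) phi + bilin (atom_sum B) phi.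
  by apply: cvg_complex_unique (fF phi) _; exact: (haar_cvg_family hdelta hB fB).
have p0 := pi2_gt0 R.
have F0 : fourier0 F = hd0 f.
  rewrite /fourier0 FE pairing_cst (_ : bilin _ _ = 0); last first.
    have h0 L c := @atom_sum_cst L c.
    by apply: complexP; rewrite /= !h0; try (by left); try (by right); rewrite ?subr0 ?addr0.
  by rewrite addr0 mulrCA -rmorphM mulVf ?gt_eqF// mulr1.
by split=> // phi; rewrite F0 FE addrC addKr.
Qed.

(** [mean_P_coef] gives [2 * Y] for the real and for the imaginary part, and
    [sqrt (a + c) <= sqrt a + sqrt c] joins the two square functions. *)
Lemma family_square l Y : 0 < l ->
  (forall K, psum (fun k => Psi0 (l^-1 * bk k) / 2 ^+ nk k) K <= Y) ->
  square_bound f l (Psi0 (l^-1 * normc (hd0 f)) + 4 * Y).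
Proof.
move=> l0 hY N; have Pm : moderate (fun t => Psi0 (l^-1 * t)) := moderate_scaled Psi0_mod l0.
have li0 : 0 <= l^-1 by rewrite invr_ge0 ltW.
have Pl t : 0 <= t -> Psi0 (l^-1 * t) <= l^-1 * t by move=> t0; rewrite Psi0_le// mulr_ge0.
have [h w] := hB.
pose s (L : R[i] -> R) m := sqf (coef delta (fun k x => L (B k x))) N m.
have s0 L m : 0 <= s L m by exact: sqf_ge0.
have H L : L = @complex.Re R \/ L = @complex.Im R -> mean N (fun m => Psi0 (l^-1 * s L m)) <= 2 * Y.
  by move=> hL; exact: (mean_P_coef hdelta (h L hL) w N Pm li0 Pl hY).
have hRe := H _ (or_introl erefl); have hIm := H _ (or_intror erefl).
apply: (@le_trans _ _ (mean N (fun m => Psi0 (l^-1 * normc (hd0 f)) +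
    (Psi0 (l^-1 * s (@complex.Re R) m) + Psi0 (l^-1 * s (@complex.Im R) m))))); last first.
  rewrite meanD (meanD N (fun m => Psi0 (l^-1 * s (@complex.Re R) m))).
  have -> : mean N (fun=> Psi0 (l^-1 * normc (hd0 f))) = Psi0 (l^-1 * normc (hd0 f)).
    by have := mean_anc (fun=> Psi0 (l^-1 * normc (hd0 f))) (leq0n N); rewrite mean0.
  have -> : 4 * Y = 2 * Y + 2 * Y by ring.
  by rewrite lerD2l (lerD hRe hIm).
apply: le_mean => m mN; rewrite /node_level.
apply: le_trans (moderate_add Pm (normc_ge0 _) (sqrtr_ge0 _)) _; rewrite lerD2l.
apply: le_trans (moderate_add Pm (s0 _ _) (s0 _ _)); apply: (moderate_le Pm (sqrtr_ge0 _)).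
have sE L : L = @complex.Re R \/ L = @complex.Im R ->
    s L m = Num.sqrt (\sum_(0 <= k < N) L (dcoef f k (anc N k m)) ^+ 2).
  move=> hL; rewrite /s /sqf /path_sum; congr Num.sqrt; apply: eq_big_nat => k /= kN.
  by rewrite fB// anc_lt// ltnW.
rewrite (sE _ (or_introl erefl)) (sE _ (or_intror erefl)) /spath /path_sum.
set a := \sum_(0 <= k < N) complex.Re _ ^+ 2; set c := \sum_(0 <= k < N) complex.Im _ ^+ 2.
have -> : \sum_(0 <= k < N) esq (dcoef f) k (anc N k m) = a + c.
  by rewrite /a /c -big_split; apply: eq_bigr => k _; exact: normc_sqr.
have a0 : 0 <= a by apply: sumr_ge0 => k _; rewrite sqr_ge0.
have c0 : 0 <= c by apply: sumr_ge0 => k _; rewrite sqr_ge0.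
rewrite -(@ler_pXn2r _ 2) ?nnegrE ?addr_ge0 ?sqrtr_ge0// sqr_sqrtr ?addr_ge0//.
by rewrite sqrrD !sqr_sqrtr// lerD2r lerDl mulrn_wge0// mulr_ge0 ?sqrtr_ge0.
Qed.

End Family.

(** The constant [100] is [10] from the bound [10 * slev] of a block, through [moderate_scale],
    times [10] from the total cost in [forced_generations]. *)
Lemma haar_family (f : haar_data R) l Y : 0 < l -> square_bound f l Y ->
  exists bk B, [/\ atom_family delta hgen hpos bk B,
    forall L, L = @complex.Re R \/ L = @complex.Im R -> forall n m, (m < 2 ^ n)%N ->
      coef delta (fun k x => L (B k x)) n m = L (dcoef f n m),
    forall K, psum (fun k => Psi0 (l^-1 * bk k) / 2 ^+ hgen k) K <= 100 * Y &
    [/\ forall k x, normc (B k x) <= bk k, forall k x, idx (hgen k) x != hpos k -> B k x = 0 &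
      forall k x, B k (x + pi2) = B k x]].
Proof.
move=> l0 hY; have Pm : moderate (fun t => Psi0 (l^-1 * t)) := moderate_scaled Psi0_mod l0.
have [|frc [frcP hc]] := @forced_generations R (dcoef f) _ Y Pm.
  move=> N; apply: le_trans (hY N); apply: le_mean => m mN.
  by apply: (moderate_le Pm (sqrtr_ge0 _)); rewrite lerDr normc_ge0.
have b0 k : 0 <= hbound (dcoef f) frc k by exact: block_bound_ge0.
have hK K : psum (fun k => Psi0 (l^-1 * hbound (dcoef f) frc k) / 2 ^+ hgen k) K <= 100 * Y.
  pose u n m := Psi0 (l^-1 * block_bound (dcoef f) frc n m) / 2 ^+ n.
  have u0 n m : 0 <= u n m.
    by rewrite divr_ge0 ?exprn_ge0// (moderate_ge0 Pm)// block_bound_ge0.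
  apply: (@le_trans _ _ (\sum_(i < (2 ^ K.+1).-1) u (hgen i) (hpos i))).
    rewrite /psum -!(big_mkord xpredT (fun i => u (hgen i) (hpos i))).
    rewrite [leRHS](big_cat_nat (n := K))//=; first by rewrite lerDl sumr_ge0.
    by rewrite -ltnS prednK ?expn_gt0// (ltn_trans _ (ltn_expl _ _)).
  rewrite (sum_heap u); apply: (@le_trans _ _ (\sum_(n < K.+1) 10 * mean n (cost (dcoef f) frc (fun t => Psi0 (l^-1 * t)) n))).
    apply: ler_sum => n _; rewrite /mean mulrCA mulr_sumr [leLHS](_ : _ = (2 ^+ n)^-1 * \sum_(m < 2 ^ n) Psi0 (l^-1 * block_bound (dcoef f) frc n m)).
      rewrite ler_wpM2l ?invr_ge0 ?exprn_ge0//; apply: ler_sum => m _.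
      rewrite /block_bound /cost; case: ifP => _; last by rewrite mulr0 mulr0 (moderate0 Psi0_mod).
      have [_ /andP[L0 _] _ _ _] := stopP (dcoef f) frc n m.
      by rewrite (moderate_scale Pm)// ler1n.
    by rewrite mulr_sumr; apply: eq_bigr => m _; rewrite mulrC.
  rewrite -mulr_sumr (_ : 100 * Y = 10 * (10 * Y)); last by ring.
  by rewrite ler_pM2l// hc.
exists (hbound (dcoef f) frc), (hatom delta (dcoef f) frcP); split=> //.
- split; last by have [_] := family_weight l0 b0 hK.
  move=> L hL k; apply: (block_batom hdelta (part_D hL) (part_B hL) (dcoef f) frcP (part_le hL)).
  exact: hpos_lt.
- move=> L hL n m mn.
  exact: (hatom_coef hdelta (part_D hL) (part_B hL) (dcoef f) frcP mn).
- split=> k x.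
  + exact: block_atom_le.
  + exact: block_atom_out.
  + by rewrite /hatom /block_atom idx_periodic.
Qed.

Lemma haar_decomp (f : haar_data R) (F : torus_dist R) l Y :
  is_iota delta f F -> 0 < l -> square_bound f l Y ->
  fourier0 F = hd0 f /\ exists b, atomic_decomp delta F b /\
    (\sum_(0 <= k <oo) (arc_len delta (atom_arc b k))%:E *
       Psi0e ((l^-1)%:E * Linfty_norm (atom_fun b k)) <= (pi2 * (100 * Y))%:E)%E.
Proof.
move=> fF l0 hY; have p0 := pi2_gt0 R.
have [bk [B [hB fB hK [B_le B_out B_per]]]] := haar_family l0 hY.
have [F0 FE] := family_iota hB fB fF; split=> //.
have [h w] := hB; have hRe := h _ (or_introl erefl); have hIm := h _ (or_intror erefl).
have b0 k : 0 <= bk k by exact: le_trans (normc_ge0 _) (B_le k 0).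
have B_Li k : (Linfty_norm (B k) <= (bk k)%:E)%E.
  by apply/Linfty_leP; apply: aeW => x; rewrite lee_fin.
have B_m k : measurable_fun [set: R] (fun x => complex.Re (B k x)) /\
    measurable_fun [set: R] (fun x => complex.Im (B k x)).
  by split; [exact: (batom_bndm (hRe k)).1|exact: (batom_bndm (hIm k)).1].
have B_I k : torus_integral (B k) = 0.
  by have [_ _ _ e1] := hRe k; have [_ _ _ e2] := hIm k; apply: complexP.
have [r rE] : exists r : nat -> R, forall k, Linfty_norm (B k) = (r k)%:E.
  exists (fun k => fine (Linfty_norm (B k))) => k; rewrite fineK// ge0_fin_numE ?Linfty_ge0//.
  exact: le_lt_trans (B_Li k) (ltry _).
have r_itv k : 0 <= r k <= bk k by rewrite -!lee_fin -rE Linfty_ge0 B_Li.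
have costE j k : ((arc_len delta (dnode k))%:E * Psi0e ((j^-1)%:E * Linfty_norm (B k)))%E =
    (len (hgen k) * Psi0 (j^-1 * r k))%:E.
  by rewrite (arc_lenE hdelta) rE -EFinM.
have cost0 j k : 0 < j -> 0 <= len (hgen k) * Psi0 (j^-1 * r k).
  move=> j0; rewrite (mulr_ge0 (len_ge0 R _))// (moderate_ge0 Psi0_mod)// mulr_ge0 ?invr_ge0 ?(ltW j0)//.
  by case/andP: (r_itv k).
have cost_le j Z : 0 < j -> (forall K, psum (fun k => Psi0 (j^-1 * bk k) / 2 ^+ hgen k) K <= Z) ->
    forall K, psum (fun k => len (hgen k) * Psi0 (j^-1 * r k)) K <= pi2 * Z.
  move=> j0 hZ K; apply: (@le_trans _ _ (pi2 * psum (fun k => Psi0 (j^-1 * bk k) / 2 ^+ hgen k) K)); last first.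
    by rewrite ler_pM2l.
  rewrite /psum mulr_sumr; apply: ler_sum => k _.
  rewrite /len mulrAC -mulrA ler_pM2l// ler_wpM2r ?invr_ge0 ?exprn_ge0//.
  have /andP[r0 rb] := r_itv k.
  by apply: (moderate_le Psi0_mod); rewrite ?mulr_ge0 ?invr_ge0 ?(ltW j0)// ler_wpM2l ?invr_ge0 ?(ltW j0).
exists (AtomSeq dnode B); split; last first.
  under eq_eseriesr do rewrite /= costE.
  by apply/nneseries_leP => [k|]; [exact: cost0|exact: cost_le].
split=> [k|phi|] /=.
(* Division by [c] brings [B k] below the lower bound of [Llog_arc_ge]; the summand [1] keeps [c]
   positive when [bk k] is zero. *)
- pose c : R := (bk k + 1) * atom_scale R (hgen k).
  have c0 : 0 < c by rewrite mulr_gt0 ?atom_scale_gt0// ltr_wpDl.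
  have cN : normc (c%:C%C)^-1 = c^-1.
    by rewrite -fmorphV /normc /= expr0n addr0 sqrtr_sqr ger0_norm// invr_ge0 ltW.
  exists c%:C%C, (fun x => (c%:C%C)^-1 * B k x); split; last first.
    by apply/funext => x; rewrite mulVKf// eq_complex /= eqxx andbT gt_eqF.
  split.
  + by move=> x; rewrite B_per.
  + have [mr mi] := B_m k.
    rewrite (funext (fun x => Re_mul (c%:C%C)^-1 (B k x))) (funext (fun x => Im_mul (c%:C%C)^-1 (B k x))).
    by split; [apply: measurable_funB|apply: measurable_funD]; apply: measurable_funM.
  + move=> x; rewrite darcE => nx; rewrite B_out ?mulr0//.
    by apply/eqP => e; apply: nx.
  + exact: (torus_integralZ hdelta _ (B_Li k)).
  + rewrite darcE; apply: le_trans (Llog_arc_ge hdelta (hpos_lt k)).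
    apply: le_trans (Linfty_scale _ (B_Li k)) _.
    rewrite lee_fin cN /c invfM mulrAC ler_piMl ?invr_ge0 ?(ltW (atom_scale_gt0 _ _))//.
    by rewrite mulrC ler_pdivrMr ?mul1r ?lerDl// ltr_wpDl.
- by rewrite FE; exact: (family_cvg hdelta hB).
- have [h1 _] := family_weight l0 b0 hK.
  rewrite (eq_eseriesr (g := fun k => (len (hgen k) * Psi0 (1^-1 * r k))%:E)); last first.
    by move=> k _; rewrite -costE invr1 mul1e.
  apply/nneseries_lty => [k|]; first exact: cost0.
  exists (pi2 * ((1 + l) * (100 * Y))); apply: cost_le => // K.
  by under eq_fun do rewrite invr1 mul1r.
Qed.

Section Decomposed.
Variables (F : torus_dist R) (b : atom_seq R).
Hypothesis Fb : atomic_decomp delta F b.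
Let nk k := tag (atom_arc b k).
Let mk k := nat_of_ord (tagged (atom_arc b k)).

Lemma decomp_family : atom_family delta nk mk (abound b) (aclip b).
Proof.
split; last exact: (abound_weight hdelta Fb).
by move=> L [] -> k; [exact: (aclip_Re hdelta Fb)|exact: (aclip_Im hdelta Fb)].
Qed.

Lemma decomp_sum phi : F phi - pairing (fun=> fourier0 F) phi = bilin (atom_sum (aclip b)) phi.
Proof.
have [_ /(_ phi) h _] := Fb.
apply: cvg_complex_unique h _.
rewrite (_ : (fun n => _) = (fun n => \sum_(k < n) pairing (aclip b k) phi)).
  exact: (family_cvg hdelta decomp_family).
apply/funext => n; apply: eq_bigr => k _; have [pr pim] := test_bndm delta phi.
have [e1 e2] := atom_pairing hdelta Fb k pr pim.
rewrite (family_pairing hdelta decomp_family).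
by apply: complexP; rewrite /= ?e1 ?e2.
Qed.

Lemma decomp_haar : exists f : haar_data R, [/\ hd0 f = fourier0 F, is_iota delta f F &
  forall L, L = @complex.Re R \/ L = @complex.Im R -> forall n m, (m < 2 ^ n)%N ->
    coef delta (fun k x => L (aclip b k x)) n m = L (dcoef f n m)].
Proof.
pose e n m := Complex (coef delta (fun k x => complex.Re (aclip b k x)) n m)
  (coef delta (fun k x => complex.Im (aclip b k x)) n m).
pose f := HaarData (fourier0 F) (fun I : dyadic => e (tag I) (tagged I) * (Num.sqrt (len (tag I)))%:C%C).
have fE L : L = @complex.Re R \/ L = @complex.Im R -> forall n m, (m < 2 ^ n)%N ->
    coef delta (fun k x => L (aclip b k x)) n m = L (dcoef f n m).
  move=> hL n m mn; rewrite /dcoef insubT /= mulfK ?sqrt_len_neq0//.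
  by case: hL => ->.
exists f; split=> // phi.
have -> : F phi = pairing (fun=> hd0 f) phi + bilin (atom_sum (aclip b)) phi.
  by rewrite -decomp_sum addrC subrK.
exact: (haar_cvg_family hdelta decomp_family fE).
Qed.

(** [haar_family] builds from [f] a second atomic series for [F], and [coef_unique] compares it with
    the given one. Estimates for an arbitrary decomposition of [F] thereby apply to the data [f]
    that define its quasi-norm. *)
Lemma decomp_coef (f : haar_data R) : hlog delta f -> is_iota delta f F ->
  forall L, L = @complex.Re R \/ L = @complex.Im R -> forall n m, (m < 2 ^ n)%N ->
    coef delta (fun k x => L (aclip b k x)) n m = L (dcoef f n m).
Proof.
move=> /(hlogP hdelta)[Y hY] fF L hL n m mn.
have [bk [B [hB fB _ _]]] := haar_family ltr01 hY.
have [_ FE] := family_iota hB fB fF.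
rewrite -fB//; have [h w] := hB; have [h' w'] := decomp_family.
apply: (coef_unique hdelta (h' L hL) w' (h L hL) w) => // phi sp pp.
(* For a real test function the complex pairing splits into those of the real and of the imaginary
   part. *)
have tphi : (fun x => (phi x)%:C%C) \in @test_pred R.
  by apply/asboolP; split; [move=> x; rewrite pp|exact: sp|exact: smooth_cst].
have : bilin (atom_sum (aclip b)) (TestFun tphi) = bilin (atom_sum B) (TestFun tphi).
  by rewrite -decomp_sum FE.
have c1 L' : L' = @complex.Re R \/ L' = @complex.Im R -> atom_sum (aclip b) L' (fun=> 0) = 0.
  exact: (atom_sum_cst decomp_family).
have c2 L' : L' = @complex.Re R \/ L' = @complex.Im R -> atom_sum B L' (fun=> 0) = 0.
  exact: (atom_sum_cst hB).
rewrite /bilin /= !c1 ?c2; [|by left|by right|by left|by right].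
by rewrite !subr0 !add0r => -[e1 e2]; case: hL => ->.
Qed.

End Decomposed.

End Decompositions.

(** * From modular inequalities to equivalence of quasi-norms *)

Section Equivalence.
Variables (R : realType) (delta : R).
Hypothesis hdelta : 0 <= delta < 1.
Notation len := (len R).
Notation pi2 := (pi *+ 2 : R).

Let Psi0_mod := Psi0_moderate R.

Lemma Psi0_dilate (l t : R) j : 0 < l -> 0 <= t ->
  Psi0 ((2 ^+ j * l)^-1 * t) <= (3 / 4) ^+ j * Psi0 (l^-1 * t).
Proof.
move=> l0 t0; rewrite invfM -mulrA mulrC.
by apply: (moderate_half_iter Psi0_mod); rewrite mulr_ge0// invr_ge0 ltW.
Qed.

Lemma square_bound_dilate (f : haar_data R) (l Y : R) j : 0 < l -> square_bound f l Y ->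
  square_bound f (2 ^+ j * l) ((3 / 4) ^+ j * Y).
Proof.
move=> l0 h N; apply: (@le_trans _ _ ((3 / 4) ^+ j * mean N (node_level f l N))).
  by rewrite -meanZ; apply: le_mean => m mN; exact: (Psi0_dilate j l0 (node_arg_ge0 f N m)).
by rewrite ler_wpM2l.
Qed.

Lemma square_bound_hd0 (f : haar_data R) (l Y : R) : 0 < l -> square_bound f l Y ->
  Psi0 (l^-1 * normc (hd0 f)) <= Y.
Proof.
move=> l0 /(_ 0%N); rewrite mean0; apply: le_trans.
have li0 : 0 <= l^-1 by rewrite invr_ge0 ltW.
apply: (moderate_le Psi0_mod); first by rewrite mulr_ge0 ?normc_ge0.
by rewrite ler_wpM2l// lerDl sqrtr_ge0.
Qed.

Section Atomic.
Variables (F : torus_dist R) (b : atom_seq R).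
Hypothesis Fb : atomic_decomp delta F b.

Definition atom_cost (l : R) := (\sum_(0 <= k <oo) (arc_len delta (atom_arc b k))%:E *
  Psi0e ((l^-1)%:E * Linfty_norm (atom_fun b k)))%E.

Lemma atom_cost_leP l Y : 0 < l -> (atom_cost l <= Y%:E)%E <->
  forall K, psum (fun k => len (tag (atom_arc b k)) * Psi0 (l^-1 * abound b k)) K <= Y.
Proof.
move=> l0; rewrite /atom_cost (eq_eseriesr (fun k _ => atom_costE hdelta Fb l k)).
by apply: nneseries_leP => k; exact: (atom_cost_ge0 hdelta Fb).
Qed.

Lemma atom_cost_dilate l Y j : 0 < l -> (atom_cost l <= Y%:E)%E ->
  (atom_cost (2 ^+ j * l) <= ((3 / 4) ^+ j * Y)%:E)%E.
Proof.
move=> l0 /(atom_cost_leP _ l0) h.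
have L0 : 0 < 2 ^+ j * l by rewrite mulr_gt0 ?exprn_gt0.
apply/(atom_cost_leP _ L0) => K.
apply: (@le_trans _ _ ((3 / 4) ^+ j * psum (fun k => len (tag (atom_arc b k)) * Psi0 (l^-1 * abound b k)) K)).
  rewrite /psum mulr_sumr; apply: ler_sum => k _.
  rewrite [leRHS]mulrCA (ler_wpM2l (len_ge0 R _))//.
  exact: (Psi0_dilate j l0 (abound_ge0 hdelta Fb k)).
by rewrite ler_wpM2l.
Qed.

Lemma atom_cost_psum l Y : 0 < l -> (atom_cost l <= Y%:E)%E ->
  forall K, psum (fun k => Psi0 (l^-1 * abound b k) / 2 ^+ tag (atom_arc b k)) K <= Y.
Proof.
move=> l0 /(atom_cost_leP _ l0) h K; apply: le_trans (h K); apply: ler_sum => k _.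
have p1 : 1 <= pi2 by have := pi_ge2 R; rewrite mulr2n; lra.
have s0 : 0 <= Psi0 (l^-1 * abound b k) / 2 ^+ tag (atom_arc b k).
  rewrite divr_ge0 ?exprn_ge0// (moderate_ge0 Psi0_mod)// mulr_ge0 ?(abound_ge0 hdelta Fb)//.
  by rewrite invr_ge0 ltW.
apply: (@le_trans _ _ (pi2 * (Psi0 (l^-1 * abound b k) / 2 ^+ tag (atom_arc b k)))).
  by rewrite ler_peMl.
by rewrite /len mulrA mulrAC.
Qed.

Lemma atomic_cost_fin : exists Y, (atom_cost 1 <= Y%:E)%E.
Proof.
have [_ _] := Fb; rewrite (eq_eseriesr (g := fun k => (len (tag (atom_arc b k)) * Psi0 (1^-1 * abound b k))%:E)); last first.
  by move=> k _; rewrite -(atom_costE hdelta Fb) invr1 mul1e.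
move/nneseries_lty => [k|Y h]; first exact: (atom_cost_ge0 hdelta Fb).
by exists Y; apply/(atom_cost_leP _ ltr01).
Qed.

Lemma Lambda_ooE : Lambda_oo delta F b = ereal_inf [set l%:E | l in [set l : R | 0 < l /\
  ((Psi0 (l^-1 * normc (fourier0 F)))%:E + atom_cost l <= 1)%E]].
Proof. by []. Qed.

End Atomic.

Lemma geometric_small (K : R) : exists j, (3 / 4) ^+ j * K <= 1.
Proof.
have /cvgnP h : (fun j => (3 / 4) ^+ j : R) @ \oo --> 0.
  by apply: cvg_expr; rewrite ger0_norm; lra.
have K1 : 0 < 1 + `|K| by rewrite ltr_pwDl.
have [|j /(_ j (leqnn _))] := h (1 + `|K|)^-1; first by rewrite invr_gt0.
rewrite subr0 => hj; exists j; have hj' := le_trans (ler_norm _) hj.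
apply: (@le_trans _ _ ((3 / 4) ^+ j * (1 + `|K|))).
  by rewrite ler_wpM2l// (le_trans (ler_norm K))// lerDr.
by rewrite -ler_pdivlMr// mul1r.
Qed.

(** At scale [l] the mean contributes at most [1] to the atomic modular and the atoms at most
    [2 pi * 100]; the dilation by [2 ^+ j] brings the sum below [1]. *)
Lemma Hlog_at_norm_le (F : torus_dist R) (f : haar_data R) j l :
  is_iota delta f F -> (3 / 4) ^+ j * (1 + pi2 * 100) <= 1 :> R -> 0 < l -> square_bound f l 1 ->
  (Hlog_at_norm delta F <= (2 ^+ j * l)%:E)%E.
Proof.
move=> fF hj l0 hl; have [F0 [b [Fb hb]]] := haar_decomp hdelta fF l0 hl.
have L0 : 0 < 2 ^+ j * l by rewrite mulr_gt0 ?exprn_gt0.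
apply: ge_ereal_inf; exists (Lambda_oo delta F b); first by exists b.
rewrite Lambda_ooE; apply: ereal_inf_lbound; exists (2 ^+ j * l) => //; split=> //.
have h2 := atom_cost_dilate Fb j l0 hb; rewrite mulr1 in h2.
have h1 := Psi0_dilate j l0 (normc_ge0 (fourier0 F)).
have h3 : Psi0 (l^-1 * normc (fourier0 F)) <= 1 by rewrite F0; exact: square_bound_hd0 hl.
have h4 : Psi0 ((2 ^+ j * l)^-1 * normc (fourier0 F)) <= (3 / 4) ^+ j.
  by apply: le_trans h1 _; rewrite ler_piMr.
apply: (@le_trans _ _ (((3 / 4) ^+ j)%:E + ((3 / 4) ^+ j * (pi2 * 100))%:E)%E).
  by apply: leeD h2; rewrite lee_fin.
by rewrite -EFinD lee_fin; move: hj; rewrite mulrDr mulr1.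
Qed.

(** By [decomp_coef] the coefficients of [f] are those of the atomic series, so [family_square]
    bounds its modular by [1 + 4]. The same [j] suffices, since [4 <= 2 pi * 100]. *)
Lemma hlog_norm_le (F : torus_dist R) (f : haar_data R) (b : atom_seq R) j l :
  hlog delta f -> is_iota delta f F -> atomic_decomp delta F b ->
  (3 / 4) ^+ j * (1 + pi2 * 100) <= 1 :> R -> 0 < l ->
  ((Psi0 (l^-1 * normc (fourier0 F)))%:E + atom_cost b l <= 1)%E ->
  (hlog_norm delta f <= (2 ^+ j * l)%:E)%E.
Proof.
move=> hf fF Fb hj l0 hl; have L0 : 0 < 2 ^+ j * l by rewrite mulr_gt0 ?exprn_gt0.
have P0 : 0 <= Psi0 (l^-1 * normc (fourier0 F)).
  by rewrite (moderate_ge0 Psi0_mod)// mulr_ge0 ?normc_ge0// invr_ge0 ltW.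
have c0 : (0 <= atom_cost b l)%E.
  rewrite /atom_cost (eq_eseriesr (fun k _ => atom_costE hdelta Fb l k)).
  by apply: nneseries_ge0 => k _ _; rewrite lee_fin (atom_cost_ge0 hdelta Fb).
have h1 : Psi0 (l^-1 * normc (fourier0 F)) <= 1.
  by rewrite -lee_fin; apply: le_trans hl; rewrite leeDl.
have h2 : (atom_cost b l <= 1%:E)%E by apply: le_trans hl; rewrite leeDr.
have fB := decomp_coef hdelta Fb hf fF.
have [F0 _] := family_iota hdelta (decomp_family hdelta Fb) fB fF.
have hs := family_square hdelta (decomp_family hdelta Fb) fB l0 (atom_cost_psum Fb l0 h2).
rewrite (hlog_normE hdelta); apply: ereal_inf_lbound; exists (2 ^+ j * l) => //; split=> // N.
apply: le_trans (square_bound_dilate j l0 hs N) _; apply: le_trans hj.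
rewrite ler_wpM2l// -F0 lerD// mulr1.
by have := pi_ge2 R; rewrite mulr2n; lra.
Qed.

End Equivalence.

(* The quasi-norm of F in the square-function space is hlog_norm delta f for
   F = iota(f); the estimates are stated for every such f. *)
Theorem theorem16 (R : realType) (delta : R) (hdelta : 0 <= delta < 1) :
  (forall F : torus_dist R, Hlog_at delta F <-> Hlog delta F) /\
  exists c C : R, 0 < c /\ 0 < C /\
    forall (F : torus_dist R) (f : haar_data R),
      hlog delta f -> is_iota delta f F ->
      (c%:E * Hlog_at_norm delta F <= hlog_norm delta f)%E /\
      (hlog_norm delta f <= C%:E * Hlog_at_norm delta F)%E.
Proof.
split=> [F|].
  split=> [[b Fb]|[f /(hlogP hdelta)[Y hY] fF]]; last first.
    by have [_ [b [Fb _]]] := haar_decomp hdelta fF ltr01 hY; exists b.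
  have [f [f0 fF fB]] := decomp_haar hdelta Fb; exists f => //; apply/(hlogP hdelta).
  have [Y hY] := atomic_cost_fin hdelta Fb; eexists.
  exact: (family_square hdelta (decomp_family hdelta Fb) fB ltr01 (atom_cost_psum hdelta Fb ltr01 hY)).
have [j hj] := geometric_small (1 + pi *+ 2 * 100 : R).
have j0 : 0 < 2 ^+ j :> R by rewrite exprn_gt0.
exists (2 ^+ j)^-1, (2 ^+ j); split; first by rewrite invr_gt0.
split=> // F f hf fF; split.
  rewrite (hlog_normE hdelta); apply: le_ereal_inf_tmp => _ [l [l0 hl] <-].
  by rewrite lee_pdivrMl// -EFinM; exact: Hlog_at_norm_le.
rewrite -lee_pdivrMl//; apply: le_ereal_inf_tmp => _ [b Fb <-].
apply: le_ereal_inf_tmp => _ [l [l0 hl] <-].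
by rewrite lee_pdivrMl// -EFinM; exact: (hlog_norm_le hdelta hf fF Fb).
Qed.
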